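(* The function $s\mapsto\mathrm{Li}_s$ extends to an entire function of $s\in\mathbb{C}$ taking values in distributions on the positive real axis $(0,\infty)$, defined on compactly supported smooth test functions $f\in C_c^\infty((0,\infty))$ by $$f\mapsto\int_0^\infty\mathrm{Li}_s(t)f(t)\,dt=\int_{-\infty}^\infty\mathrm{li}_s(x)\cdot e^xf(e^x)\,dx,$$ where the right-hand side denotes the pairing of the tempered distribution $\mathrm{li}_s$ with the function $x\mapsto e^xf(e^x)$. (Here ''extends'' means that the restriction of this distribution to $(0,1)$ is the classical polylogarithm $\mathrm{Li}_s(t)=\sum_{n\ge1}t^n/n^s$.)
   Context: The classical polylogarithm is $\mathrm{Li}_s(z)=\sum_{n\ge1}z^n/n^s$ for $|z|<1$. For $\mathrm{Re}\, s>0$, $\gamma_+^s$ is the tempered distribution on $\mathbb{R}$ given by the function equal to $x^{s-1}/\Gamma(s)$ for $x>0$ and $0$ for $x<0$. It extends to an entire function of $s\in\mathbb{C}$ with values in tempered distributions; explicitly, for $k\in\mathbb{N}$ and $\mathrm{Re}\, s>-k$, $\langle\gamma_+^s,f\rangle=\frac{(-1)^k}{\Gamma(s+k)}\int_0^\infty x^{s+k-1}f^{(k)}(x)\,dx$ for Schwartz functions $f$. For $s\in\mathbb{C}$ the tempered distribution $\mathrm{li}_s$ on $\mathbb{R}$ is the convolution $\gamma_+^s*\mathrm{PV}\frac{1}{e^{-x}-1}$, i.e. for Schwartz functions $f$, $$\langle \mathrm{li}_s,f\rangle=\lim_{\epsilon\to0^+}\int_{|t|>\epsilon}\frac{1}{e^{-t}-1}\,\langle\gamma_+^s,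 f(\cdot+t)\rangle\,dt .$$ *)

(* Defs.v *)
(* Stdlib reals with Coquelicot. *)
From Stdlib Require Export Reals.
From Coquelicot Require Export Coquelicot.
Open Scope R_scope.

Definition Cexp (z : C) : C :=
  RtoC (exp (Re z)) * (cos (Im z), sin (Im z)).

(* The principal power [x^s], meaningful for [0 < x] only. *)
Definition Rcpow (x : R) (s : C) : C := Cexp (s * RtoC (ln x)).

(* Euler's integral; it represents the Gamma function for [0 < Re z] and is
   used only there. *)
Definition Gamma (z : C) : C :=
  RInt_gen (V := C_R_CompleteNormedModule)
    (fun x => Rcpow x (z - 1) * RtoC (exp (- x)))%C
    (at_right 0) (Rbar_locally p_infty).

(* Functions of a real variable with complex values are differentiated
   componentwise, since [Derive_n] is available for real values only. *)
Definition CDerive_n (f : R -> C) (n : nat) (x : R) : C :=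
  (Derive_n (fun y => Re (f y)) n x, Derive_n (fun y => Im (f y)) n x).

Definition smooth (f : R -> C) : Prop :=
  forall (n : nat) (x : R),
    ex_derive_n (fun y => Re (f y)) n x /\ ex_derive_n (fun y => Im (f y)) n x.

Definition schwartz (f : R -> C) : Prop :=
  smooth f /\
  forall n k : nat, exists M : R,
    forall x : R, Rabs x ^ n * Cmod (CDerive_n f k x) <= M.

Definition supported_in (a b : R) (f : R -> C) : Prop :=
  forall x : R, ~ (a <= x <= b) -> f x = RtoC 0.

(* An element of [C_c^oo] of the open interval [(lo, hi)] is represented by its
   extension by zero to the real line. *)
Definition test_function (lo hi : Rbar) (f : R -> C) : Prop :=
  smooth f /\
  exists a b : R, Rbar_lt lo a /\ Rbar_lt b hi /\ supported_in a b f.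

(* Continuity is expressed by the usual seminorm estimates: on each compact
   interval, [u] is controlled by finitely many sup norms of derivatives; the
   bound [M] below stands for the maximum of these norms. *)
Definition distribution (lo hi : Rbar) (u : (R -> C) -> C) : Prop :=
  (forall (c : C) (f g : R -> C),
     test_function lo hi f -> test_function lo hi g ->
     u (fun x => c * f x + g x)%C = (c * u f + u g)%C) /\
  (forall a b : R, Rbar_lt lo a -> Rbar_lt b hi ->
     exists (A : R) (N : nat), forall (f : R -> C) (M : R),
       smooth f -> supported_in a b f ->
       (forall (j : nat) (x : R), (j <= N)%nat -> Cmod (CDerive_n f j x) <= M) ->
       Cmod (u f) <= A * M).

Definition entire (F : C -> C) : Prop :=
  forall s : C, ex_derive (K := C_AbsRing) (V := C_NormedModule) F s.

Definition entire_distribution (lo hi : Rbar) (u : C -> (R -> C) -> C) : Prop :=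
  (forall s : C, distribution lo hi (u s)) /\
  (forall f : R -> C, test_function lo hi f -> entire (fun s => u s f)).

(* [is_gamma_plus s f v] : the pairing of [gamma_+^s] with [f] is [v].  The
   defining formula is required for every admissible [k], so that the relation
   includes the independence of [k]. *)
Definition is_gamma_plus (s : C) (f : R -> C) (v : C) : Prop :=
  forall k : nat, - INR k < Re s ->
  exists I : C,
    is_RInt_gen (V := C_R_NormedModule)
      (fun x => Rcpow x (s + INR k - 1) * CDerive_n f k x)%C
      (at_right 0) (Rbar_locally p_infty) I /\
    v = (Cpow (- (1)) k / Gamma (s + INR k) * I)%C.

(* Integral of [h] over [{t | eps < |t|}]. *)
Definition is_RInt_outside (eps : R) (h : R -> C) (v : C) : Prop :=
  exists I1 I2 : C,
    is_RInt_gen (V := C_R_NormedModule) h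
      (Rbar_locally m_infty) (at_point (- eps)) I1 /\
    is_RInt_gen (V := C_R_NormedModule) h
      (at_point eps) (Rbar_locally p_infty) I2 /\
    v = (I1 + I2)%C.

(* [is_li s f v] : [f] is a Schwartz function and the pairing of [li_s] with
   [f] is [v].  The relation includes the existence of all the integrals and of
   the limit, and it determines [v]. *)
Definition is_li (s : C) (f : R -> C) (v : C) : Prop :=
  schwartz f /\
  exists G J : R -> C,
    (forall t : R, is_gamma_plus s (fun x => f (x + t)) (G t)) /\
    (forall eps : R, 0 < eps ->
       is_RInt_outside eps (fun t => RtoC (/ (exp (- t) - 1)) * G t)%C (J eps)) /\
    filterlim J (at_right 0) (locally (T := C_UniformSpace) v).

(* The classical polylogarithm, for [Cmod z < 1]; the index is shifted by one. *)
Definition is_polylog (s z l : C) : Prop :=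
  is_series (K := C_AbsRing) (V := C_NormedModule)
    (fun n => Cpow z (S n) / Rcpow (INR (S n)) s)%C l.

(* Main.v *)
Require Import Defs.
From Stdlib Require Import Reals Lra Lia ZArith.
From Stdlib Require Import FunctionalExtensionality ClassicalEpsilon.
From Coquelicot Require Import Coquelicot.
Open Scope R_scope.

(* The function [f] in [C_c^oo((0,oo))] becomes [g(x) = e^x f(e^x)] in
   [C_c^oo(R)], and [G(t) = <gamma_+^s, g(.+t)>] is smooth with
   [G, G' = O(e^(-t/2))]. Folding the principal value over the origin gives the
   absolutely convergent
   [<li_s, g> = int_0^oo ((G(-t) - G(t))/(e^t - 1) - G(t)) dt],
   a functional bounded by the exponentially weighted sup norms of [G] and [G'].
   Linearity, continuity in [f], and holomorphy in [s] then follow from the same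
   statements for [G], where they are estimates on the weight [x^(s+k-1)];
   holomorphy also needs that Gamma has no zero in the right half plane.
   If [g] is supported in [(-oo,0)], expanding [1/(e^t - 1)] in powers of [e^(-t)]
   and computing the Laplace transform of [G(-t)] gives
   [<li_s, g> = sum_n n^(-s) int e^(n x) g(x) dx], which is the pairing of the
   polylogarithm with [f]. *)

(** Neither dominated convergence nor Fubini is invoked. Every improper integral is compared with
    that of one real exponential, and derivatives in [t] and in [s] come from integrating a
    pointwise second-order Taylor remainder. The exponents are tuned to each other: weights may grow
    like [e^(x/4)], the functions they meet decay like [e^(-x/2)], so products decay like
    [e^(-x/4)]; the growth [e^(t/2)] of [G(-t)] is still beaten by [1/(e^t-1)]. The order [k]
    satisfies [Re s + k > 2], so that [x^(s+k-1)] stays bounded near the origin even after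
    multiplication by [ln x]. The defining formula of [gamma_+^s] must however be checked for all
    admissible [k], including those whose integrand is unbounded at the origin; integration by parts
    reduces these to the bounded case. For the zeros of Gamma, the functional equation moves the
    point far to the right at fixed imaginary part, where the oscillation of [x^(iy)] is too slow to
    cancel the mass of [x^(a-1) e^(-x)]. *)

Local Notation deriv f x l :=
  (is_derive (K := R_AbsRing) (V := C_R_NormedModule) f x l).
Local Notation cont f x :=
  (continuous (T := R_UniformSpace) (U := C_UniformSpace) f x).
Local Notation is_HInt p l :=
  (is_RInt_gen (V := C_R_NormedModule) p (at_right 0) (Rbar_locally p_infty) l).

(** * Calculus of complex-valued functions *)

Lemma norm_C (z : C) : norm (V := C_R_NormedModule) z = Cmod z.
Proof. symmetry; apply Cmod_norm. Qed.

Lemma filterlim_Cmod {T : Type} (F : (T -> Prop) -> Prop) {FF : Filter F}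
    (f : T -> C) (l : C) :
  filterlim f F (locally (T := C_UniformSpace) l) <->
  (forall eps : R, 0 < eps -> F (fun x => Cmod (f x - l)%C < eps)).
Proof.
  split.
  - intros H eps Heps.
    apply (proj1 (filterlim_locally_ball_norm (K := C_AbsRing)
      (U := C_NormedModule) f l) H (mkposreal eps Heps)).
  - intros H.
    apply (filterlim_locally_ball_norm (K := C_AbsRing) (U := C_NormedModule) f l).
    intros [eps Heps]; apply (H eps Heps).
Qed.

(** Stated over any field of scalars because it is used twice: for the real derivative of a
    convolution in [t], and for the complex derivative in [s]. *)
Lemma is_derive_quadratic {K : AbsRing} {V : NormedModule K} (f : K -> V)
    (x : K) (d : V) (M r : R) :
  0 < r ->
  (forall y : K, abs (minus y x) < r ->
     norm (minus (minus (f y) (f x)) (scal (minus y x) d)) <= M * abs (minus y x) ^ 2) ->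
  is_derive f x d.
Proof.
  intros Hr H; split.
  - apply is_linear_scal_l.
  - intros x' Hx'.
    rewrite <- (is_filter_lim_locally_unique _ _ Hx'); clear x' Hx'.
    intros [eps Heps]; simpl.
    (* The sign of [M] is unknown, hence [Rabs M + 1] in the radius. *)
    assert (Hd : 0 < Rmin r (eps / (Rabs M + 1))).
    { apply Rmin_pos; [exact Hr|].
      apply Rdiv_lt_0_compat; [exact Heps|].
      pose proof (Rabs_pos M); lra. }
    exists (mkposreal _ Hd); simpl; intros y Hy.
    change (abs (minus y x) < Rmin r (eps / (Rabs M + 1))) in Hy.
    pose proof (Rmin_l r (eps / (Rabs M + 1))).
    pose proof (Rmin_r r (eps / (Rabs M + 1))).
    eapply Rle_trans; [apply H; lra|].
    change (norm (minus y x)) with (abs (minus y x)).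
    assert (Ha : 0 <= abs (minus y x)) by apply abs_ge_0.
    set (u := abs (minus y x)) in *.
    assert (Hu : (Rabs M + 1) * u <= eps).
    { pose proof (Rabs_pos M).
      apply Rle_trans with ((Rabs M + 1) * (eps / (Rabs M + 1))).
      - apply Rmult_le_compat_l; lra.
      - right; field; lra. }
    pose proof (Rle_abs M).
    assert (M * u <= eps) by nra.
    replace (M * u ^ 2) with ((M * u) * u) by ring.
    apply Rmult_le_compat_r; lra.
Qed.

Lemma is_derive_Re (f : R -> C) (x : R) (l : C) :
  deriv f x l -> is_derive (fun y => Re (f y)) x (Re l).
Proof.
  intros H.
  apply (filterdiff_comp' (K := R_AbsRing) (U := R_NormedModule)
    (V := C_R_NormedModule) (W := R_NormedModule) f Re x _ Re H).
  apply filterdiff_linear.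
  apply (is_linear_fst (K := R_AbsRing) (U := R_NormedModule) (V := R_NormedModule)).
Qed.

Lemma is_derive_Im (f : R -> C) (x : R) (l : C) :
  deriv f x l -> is_derive (fun y => Im (f y)) x (Im l).
Proof.
  intros H.
  apply (filterdiff_comp' (K := R_AbsRing) (U := R_NormedModule)
    (V := C_R_NormedModule) (W := R_NormedModule) f Im x _ Im H).
  apply filterdiff_linear.
  apply (is_linear_snd (K := R_AbsRing) (U := R_NormedModule) (V := R_NormedModule)).
Qed.

Lemma is_derive_C (f : R -> C) (x : R) (l : C) :
  is_derive (fun y => Re (f y)) x (Re l) ->
  is_derive (fun y => Im (f y)) x (Im l) -> deriv f x l.
Proof.
  intros H1 H2.
  apply (is_derive_ext (V := C_R_NormedModule) (fun y => (Re (f y), Im (f y)))).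
  { intros t; symmetry; apply surjective_pairing. }
  pose proof (filterdiff_comp'_2 (K := R_AbsRing) (T := R_NormedModule)
    (U := R_NormedModule) (V := R_NormedModule) (W := C_R_NormedModule)
    (fun y => Re (f y)) (fun y => Im (f y)) (fun a b => (a, b)) x
    (fun y => scal y (Re l)) (fun y => scal y (Im l)) (fun a b => (a, b)) H1 H2) as H.
  unfold is_derive.
  apply H.
  apply (filterdiff_ext_lin (K := R_AbsRing)
    (U := prod_NormedModule R_AbsRing R_NormedModule R_NormedModule)
    (V := C_R_NormedModule) _ (fun t => t)).
  - apply (filterdiff_ext (K := R_AbsRing)
      (U := prod_NormedModule R_AbsRing R_NormedModule R_NormedModule)
      (V := C_R_NormedModule) (fun t => t)).
    + intros t; apply surjective_pairing.
    + apply filterdiff_id.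
  - intros t; apply surjective_pairing.
Qed.

Lemma continuous_C (f : R -> C) (x : R) :
  continuous (fun y => Re (f y)) x -> continuous (fun y => Im (f y)) x -> cont f x.
Proof.
  intros H1 H2.
  apply (continuous_ext (fun y => (Re (f y), Im (f y)))).
  { intros t; symmetry; apply surjective_pairing. }
  apply (continuous_comp_2 (U := R_UniformSpace) (V := R_UniformSpace)
    (W := R_UniformSpace) (X := C_UniformSpace)
    (fun y => Re (f y)) (fun y => Im (f y)) (fun a b => (a, b)) x H1 H2).
  apply (continuous_ext (T := C_UniformSpace) (U := C_UniformSpace) (fun t => t)).
  - intros t; apply surjective_pairing.
  - apply continuous_id.
Qed.

Lemma continuous_Re (f : R -> C) (x : R) :
  cont f x -> continuous (fun y => Re (f y)) x.
Proof.
  intros H; apply (continuous_comp f fst); [exact H|].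
  rewrite (surjective_pairing (f x)); apply continuous_fst.
Qed.

Lemma continuous_Im (f : R -> C) (x : R) :
  cont f x -> continuous (fun y => Im (f y)) x.
Proof.
  intros H; apply (continuous_comp f snd); [exact H|].
  rewrite (surjective_pairing (f x)); apply continuous_snd.
Qed.

Lemma continuous_Cmult (f g : R -> C) (x : R) :
  cont f x -> cont g x -> cont (fun y => f y * g y)%C x.
Proof.
  intros Hf Hg.
  pose proof (continuous_Re _ _ Hf); pose proof (continuous_Im _ _ Hf).
  pose proof (continuous_Re _ _ Hg); pose proof (continuous_Im _ _ Hg).
  apply continuous_C; simpl.
  - apply (continuous_minus (V := R_NormedModule)
      (fun y => Re (f y) * Re (g y)) (fun y => Im (f y) * Im (g y)));
      apply (continuous_mult (K := R_AbsRing)); assumption.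
  - apply (continuous_plus (V := R_NormedModule)
      (fun y => Re (f y) * Im (g y)) (fun y => Im (f y) * Re (g y)));
      apply (continuous_mult (K := R_AbsRing)); assumption.
Qed.

Lemma continuous_RtoC (f : R -> R) (x : R) :
  continuous f x -> cont (fun y => RtoC (f y)) x.
Proof.
  intros H; apply continuous_C; simpl; [exact H|apply continuous_const].
Qed.

Lemma continuous_Cplus (f g : R -> C) (x : R) :
  cont f x -> cont g x -> cont (fun y => f y + g y)%C x.
Proof. apply (continuous_plus (V := C_R_NormedModule)). Qed.

Lemma continuous_Cminus (f g : R -> C) (x : R) :
  cont f x -> cont g x -> cont (fun y => f y - g y)%C x.
Proof. apply (continuous_minus (V := C_R_NormedModule)). Qed.

Lemma continuous_Cscal (c : C) (f : R -> C) (x : R) :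
  cont f x -> cont (fun y => c * f y)%C x.
Proof. intros H; apply continuous_Cmult; [apply continuous_const|exact H]. Qed.

Lemma is_derive_Cmult (f g : R -> C) (x : R) (df dg : C) :
  deriv f x df -> deriv g x dg ->
  deriv (fun y => f y * g y)%C x (df * g x + f x * dg)%C.
Proof.
  intros Hf Hg.
  pose proof (is_derive_Re _ _ _ Hf) as F1; pose proof (is_derive_Im _ _ _ Hf) as F2.
  pose proof (is_derive_Re _ _ _ Hg) as G1; pose proof (is_derive_Im _ _ _ Hg) as G2.
  apply is_derive_C; simpl.
  - evar_last.
    + apply (is_derive_minus (V := R_NormedModule)
        (fun y => Re (f y) * Re (g y)) (fun y => Im (f y) * Im (g y)));
      [exact (is_derive_mult (K := R_AbsRing) _ _ _ _ _ F1 G1 Rmult_comm)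
      |exact (is_derive_mult (K := R_AbsRing) _ _ _ _ _ F2 G2 Rmult_comm)].
    + unfold minus, plus, opp, mult; simpl; unfold Re, Im; ring.
  - evar_last.
    + apply (is_derive_plus (V := R_NormedModule)
        (fun y => Re (f y) * Im (g y)) (fun y => Im (f y) * Re (g y)));
      [exact (is_derive_mult (K := R_AbsRing) _ _ _ _ _ F1 G2 Rmult_comm)
      |exact (is_derive_mult (K := R_AbsRing) _ _ _ _ _ F2 G1 Rmult_comm)].
    + unfold minus, plus, opp, mult; simpl; unfold Re, Im; ring.
Qed.

Lemma is_derive_RtoC (f : R -> R) (x df : R) :
  is_derive f x df -> deriv (fun y => RtoC (f y)) x (RtoC df).
Proof.
  intros H; apply is_derive_C; simpl; [exact H|].
  apply (is_derive_const (K := R_AbsRing) (V := R_NormedModule) 0 x).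
Qed.

Lemma is_derive_Cscal (c : C) (f : R -> C) (x : R) (df : C) :
  deriv f x df -> deriv (fun y => c * f y)%C x (c * df)%C.
Proof.
  intros H; evar_last.
  - apply is_derive_Cmult; [|exact H].
    apply (is_derive_const (K := R_AbsRing) (V := C_R_NormedModule) c x).
  - change (zero : C_R_NormedModule) with (RtoC 0); simpl; ring.
Qed.

Lemma is_derive_Cplus (f g : R -> C) (x : R) (df dg : C) :
  deriv f x df -> deriv g x dg -> deriv (fun y => f y + g y)%C x (df + dg)%C.
Proof. apply (is_derive_plus (V := C_R_NormedModule)). Qed.

Lemma is_derive_Cminus (f g : R -> C) (x : R) (df dg : C) :
  deriv f x df -> deriv g x dg -> deriv (fun y => f y - g y)%C x (df - dg)%C.
Proof. apply (is_derive_minus (V := C_R_NormedModule)). Qed.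

Lemma scal_R_C (r : R) (z : C) : scal (V := C_R_NormedModule) r z = (RtoC r * z)%C.
Proof.
  destruct z as [a b]; unfold scal; simpl; unfold prod_scal, scal; simpl.
  unfold mult, Cmult; simpl; f_equal; ring.
Qed.

Lemma is_derive_Ccomp (f : R -> C) (g : R -> R) (x : R) (df : C) (dg : R) :
  deriv f (g x) df -> is_derive g x dg ->
  deriv (fun y => f (g y)) x (RtoC dg * df)%C.
Proof.
  intros Hf Hg; rewrite <- scal_R_C.
  apply (is_derive_comp (K := R_AbsRing) (V := C_R_NormedModule)); assumption.
Qed.

Lemma deriv_cont (f : R -> C) (x : R) (l : C) : deriv f x l -> cont f x.
Proof.
  intros H; apply (ex_derive_continuous (V := C_R_NormedModule)); now exists l.
Qed.

Lemma deriv_unique (f : R -> C) (x : R) (l l' : C) :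
  deriv f x l -> deriv f x l' -> l = l'.
Proof.
  intros H H'.
  apply injective_projections.
  - pose proof (is_derive_unique _ _ _ (is_derive_Re _ _ _ H)) as A.
    pose proof (is_derive_unique _ _ _ (is_derive_Re _ _ _ H')) as B.
    unfold Re in *; rewrite <- A, <- B; reflexivity.
  - pose proof (is_derive_unique _ _ _ (is_derive_Im _ _ _ H)) as A.
    pose proof (is_derive_unique _ _ _ (is_derive_Im _ _ _ H')) as B.
    unfold Im in *; rewrite <- A, <- B; reflexivity.
Qed.

Lemma is_RInt_Cscal (c : C) (f : R -> C) (a b : R) (l : C) :
  is_RInt (V := C_R_NormedModule) f a b l ->
  is_RInt (V := C_R_NormedModule) (fun x => c * f x)%C a b (c * l)%C.
Proof.
  intros H.
  pose proof (is_RInt_fct_extend_fst f a b l H) as H1.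
  pose proof (is_RInt_fct_extend_snd f a b l H) as H2.
  apply (is_RInt_fct_extend_pair (U := R_NormedModule) (V := R_NormedModule)
    (fun x => c * f x)%C); simpl.
  - apply (is_RInt_minus (V := R_NormedModule)
      (fun x => Re c * fst (f x)) (fun x => Im c * snd (f x)));
      apply (is_RInt_scal (V := R_NormedModule)); assumption.
  - apply (is_RInt_plus (V := R_NormedModule)
      (fun x => Re c * snd (f x)) (fun x => Im c * fst (f x)));
      apply (is_RInt_scal (V := R_NormedModule)); assumption.
Qed.

Lemma is_RInt_gen_Cscal {Fa Fb : (R -> Prop) -> Prop} {FFa : Filter Fa}
    {FFb : Filter Fb} (c : C) (f : R -> C) (l : C) :
  is_RInt_gen (V := C_R_NormedModule) f Fa Fb l ->
  is_RInt_gen (V := C_R_NormedModule) (fun x => c * f x)%C Fa Fb (c * l)%C.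
Proof.
  intros H P HP.
  assert (HP' : locally (T := C_UniformSpace) l (fun z => P (c * z)%C)).
  { exact (filterlim_scal_r (K := C_AbsRing) (V := C_NormedModule) c l P HP). }
  specialize (H _ HP'); revert H; unfold filtermapi; apply filter_imp.
  intros [a b] [y [Hy Py]]; exists (c * y)%C; split; [|exact Py].
  now apply is_RInt_Cscal.
Qed.

(** Complex-valued functions obey no mean value equality; the increment is bounded as the integral
    of the derivative. *)
Lemma deriv_bound (F dF : R -> C) (a b M : R) :
  a <= b ->
  (forall x, a <= x <= b -> deriv F x (dF x)) ->
  (forall x, a <= x <= b -> cont dF x) ->
  (forall x, a <= x <= b -> Cmod (dF x) <= M) ->
  Cmod (F b - F a)%C <= M * (b - a).
Proof.
  intros Hab HF HdF HM.
  rewrite <- norm_C.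
  replace (M * (b - a)) with (scal (V := R_NormedModule) (b - a) M)
    by (unfold scal; simpl; unfold mult; simpl; ring).
  apply (norm_RInt_le (V := C_R_NormedModule) dF (fun _ => M) a b); trivial.
  - intros x Hx; rewrite norm_C; now apply HM.
  - apply (is_RInt_derive (V := C_R_CompleteNormedModule));
      rewrite Rmin_left, Rmax_right by lra; assumption.
  - apply (is_RInt_const (V := R_NormedModule)).
Qed.

Lemma deriv_bound_abs (F dF : R -> C) (a b M : R) :
  (forall x, Rmin a b <= x <= Rmax a b -> deriv F x (dF x)) ->
  (forall x, Rmin a b <= x <= Rmax a b -> cont dF x) ->
  (forall x, Rmin a b <= x <= Rmax a b -> Cmod (dF x) <= M) ->
  Cmod (F b - F a)%C <= M * Rabs (b - a).
Proof.
  intros HF HdF HM.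
  destruct (Rle_dec a b) as [H|H].
  - rewrite Rmin_left, Rmax_right in * by lra.
    rewrite Rabs_right by lra; now apply deriv_bound with dF.
  - rewrite Rmin_right, Rmax_left in * by lra.
    rewrite Rabs_left by lra.
    replace (F b - F a)%C with (- (F a - F b))%C by ring.
    rewrite Cmod_opp.
    replace (- (b - a)) with (a - b) by ring.
    apply deriv_bound with dF; trivial; lra.
Qed.

(** The mean value inequality is applied twice, first to [F x - x * dF a] and then to [dF]; this
    costs the factor 1/2 of the sharp remainder. *)
Lemma deriv_taylor (F dF ddF : R -> C) (a b M : R) :
  (forall x, Rmin a b <= x <= Rmax a b -> deriv F x (dF x)) ->
  (forall x, Rmin a b <= x <= Rmax a b -> deriv dF x (ddF x)) ->
  (forall x, Rmin a b <= x <= Rmax a b -> cont ddF x) ->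
  (forall x, Rmin a b <= x <= Rmax a b -> Cmod (ddF x) <= M) ->
  Cmod (F b - F a - RtoC (b - a) * dF a)%C <= M * (b - a) ^ 2.
Proof.
  intros HF HdF Hc HM.
  replace (F b - F a - RtoC (b - a) * dF a)%C with
    ((F b - RtoC b * dF a) - (F a - RtoC a * dF a))%C
    by (rewrite RtoC_minus; ring).
  replace (M * (b - a) ^ 2) with (M * Rabs (b - a) * Rabs (b - a))
    by (rewrite <- (pow2_abs (b - a)); ring).
  apply (deriv_bound_abs (fun x => F x - RtoC x * dF a)%C (fun x => dF x - dF a)%C).
  - intros x Hx; apply is_derive_Cminus; [now apply HF|].
    evar_last.
    + apply is_derive_Cmult; [apply is_derive_RtoC; apply (is_derive_id (K := R_AbsRing))|].
      apply (is_derive_const (K := R_AbsRing) (V := C_R_NormedModule)).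
    + change (zero : C_R_NormedModule) with (RtoC 0).
      change (one : R_AbsRing) with 1; simpl; ring.
  - intros x Hx; apply continuous_Cminus; [|apply continuous_const].
    apply (deriv_cont _ _ _ (HdF x Hx)).
  - intros x Hx.
    assert (Hsub : forall y, Rmin a x <= y <= Rmax a x -> Rmin a b <= y <= Rmax a b).
    { intros y; revert Hx; unfold Rmin, Rmax; repeat destruct Rle_dec; lra. }
    apply Rle_trans with (M * Rabs (x - a)).
    + apply deriv_bound_abs with ddF; auto.
    + apply Rmult_le_compat_l.
      * apply Rle_trans with (Cmod (ddF x)); [apply Cmod_ge_0|now apply HM].
      * revert Hx; unfold Rmin, Rmax, Rabs; repeat destruct Rle_dec;
          repeat destruct Rcase_abs; lra.
Qed.

(** * Integrals over the positive half line *)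

Lemma is_RInt_gen_primitive {V : CompleteNormedModule R_AbsRing}
    {Fa Fb : (R -> Prop) -> Prop} {FFa : Filter Fa} {FFb : Filter Fb}
    (p F : R -> V) (la lb : V) :
  filter_prod Fa Fb (fun ab : R * R =>
    forall x, Rmin (fst ab) (snd ab) <= x <= Rmax (fst ab) (snd ab) ->
      is_derive F x (p x) /\ continuous p x) ->
  filterlim F Fa (locally la) -> filterlim F Fb (locally lb) ->
  is_RInt_gen p Fa Fb (minus lb la).
Proof.
  intros H Ha Hb.
  apply (filterlimi_lim_ext_loc (fun ab : R * R => minus (F (snd ab)) (F (fst ab)))).
  - revert H; apply filter_imp; intros [a b] H; simpl in *.
    apply is_RInt_derive; intros x Hx; now apply H.
  - assert (H1 : filterlim (fun ab : R * R => F (snd ab)) (filter_prod Fa Fb) (locally lb)).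
    { eapply filterlim_comp; [apply filterlim_snd|exact Hb]. }
    assert (H2 : filterlim (fun ab : R * R => opp (F (fst ab)))
      (filter_prod Fa Fb) (locally (opp la))).
    { eapply filterlim_comp; [eapply filterlim_comp; [apply filterlim_fst|exact Ha]|].
      apply (filterlim_opp (V := V)). }
    exact (filterlim_comp_2 _ _ plus H1 H2 (filterlim_plus lb (opp la))).
Qed.

Lemma Rbar_locally_p_infty_gt (M : R) : Rbar_locally p_infty (fun x => M < x).
Proof. now exists M. Qed.

Lemma at_right_0_lt (d : R) : 0 < d -> at_right 0 (fun x => 0 < x < d).
Proof.
  intros Hd; exists (mkposreal d Hd); intros y Hy H0; split; [exact H0|].
  unfold ball in Hy; simpl in Hy; unfold AbsRing_ball, abs, minus, plus, opp in Hy.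
  simpl in Hy; revert Hy; unfold Rabs; destruct Rcase_abs; lra.
Qed.

Lemma positive_half_line (P : R -> Prop) :
  (forall x, 0 < x -> P x) ->
  filter_prod (at_right 0) (Rbar_locally p_infty) (fun ab : R * R =>
    forall x, Rmin (fst ab) (snd ab) <= x <= Rmax (fst ab) (snd ab) -> P x).
Proof.
  intros H; apply Filter_prod with (fun a => 0 < a < 1) (fun b => 0 < b).
  - apply at_right_0_lt; lra.
  - apply Rbar_locally_p_infty_gt.
  - intros a b Ha Hb x Hx; simpl in Hx; apply H.
    revert Hx; unfold Rmin; destruct Rle_dec; lra.
Qed.

Lemma is_HInt_primitive (p F : R -> C) (l0 l1 : C) :
  (forall x, 0 < x -> deriv F x (p x)) -> (forall x, 0 < x -> cont p x) ->
  filterlim F (at_right 0) (locally (T := C_UniformSpace) l0) ->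
  filterlim F (Rbar_locally p_infty) (locally (T := C_UniformSpace) l1) ->
  is_HInt p (l1 - l0)%C.
Proof.
  intros HF Hp H0 H1.
  apply (is_RInt_gen_primitive (V := C_R_CompleteNormedModule) p F); trivial.
  apply (positive_half_line (fun x => deriv F x (p x) /\ cont p x)); auto.
Qed.

Definition HInt (p : R -> C) : C :=
  RInt_gen (V := C_R_CompleteNormedModule) p (at_right 0) (Rbar_locally p_infty).

Lemma is_HInt_unique (p : R -> C) (l : C) : is_HInt p l -> HInt p = l.
Proof. apply (is_RInt_gen_unique (V := C_R_CompleteNormedModule)). Qed.

Lemma is_HInt_ext (p q : R -> C) (l : C) :
  (forall x, 0 < x -> p x = q x) -> is_HInt p l -> is_HInt q l.
Proof.
  intros H; apply (is_RInt_gen_ext (V := C_R_NormedModule)).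
  generalize (positive_half_line _ H); apply filter_imp.
  intros ab Hab x Hx; apply Hab; lra.
Qed.

(** The rate 1/4 is what remains when a weight growing like [exp (x / 4)] meets a decay
    [exp (- x / 2)]. Its integral is the source of the factor 4 in later constants. *)
Definition dominated (K : R) (p : R -> C) : Prop :=
  forall x, 0 < x -> cont p x /\ Cmod (p x) <= K * exp (- x / 4).

Lemma exp_decay_primitive (K x : R) :
  is_derive (fun x => - 4 * K * exp (- x / 4)) x (K * exp (- x / 4)).
Proof. auto_derive; [trivial|]; simpl; unfold Rdiv; field. Qed.

Section Dominated.

Context (K : R) (p : R -> C) (Hp : dominated K p).

(** The base point is 1 because [p] may fail to be continuous at 0. *)
Let F (x : R) : C := RInt (V := C_R_CompleteNormedModule) p 1 x.
Let G (x : R) : R := - 4 * K * exp (- x / 4).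

Lemma dominated_ex_RInt (a b : R) : 0 < a -> 0 < b ->
  ex_RInt (V := C_R_CompleteNormedModule) p a b.
Proof.
  intros Ha Hb; apply (ex_RInt_continuous (V := C_R_CompleteNormedModule)).
  intros x Hx; apply Hp; revert Hx; unfold Rmin; destruct Rle_dec; lra.
Qed.

Lemma dominated_primitive (x : R) : 0 < x -> deriv F x (p x).
Proof.
  intros Hx.
  apply (is_derive_RInt (V := C_R_CompleteNormedModule) p F 1 x).
  - exists (mkposreal x Hx); intros y Hy.
    unfold ball in Hy; simpl in Hy; unfold AbsRing_ball, abs, minus, plus, opp in Hy.
    simpl in Hy.
    apply (RInt_correct (V := C_R_CompleteNormedModule)), dominated_ex_RInt; [lra|].
    revert Hy; unfold Rabs; destruct Rcase_abs; lra.
  - now apply Hp.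
Qed.

Lemma dominated_increment (x y : R) : 0 < x -> x <= y ->
  Cmod (F y - F x)%C <= G y - G x.
Proof.
  intros Hx Hxy; rewrite <- norm_C.
  apply (norm_RInt_le (V := C_R_NormedModule) p (fun x => K * exp (- x / 4)) x y);
    trivial.
  - intros t Ht; rewrite norm_C; apply Hp; lra.
  - apply (is_RInt_derive (V := C_R_CompleteNormedModule) F);
      rewrite Rmin_left, Rmax_right by lra; intros t Ht.
    + apply dominated_primitive; lra.
    + apply Hp; lra.
  - apply (is_RInt_derive (V := R_CompleteNormedModule) G); intros t Ht.
    + apply exp_decay_primitive.
    + apply (ex_derive_continuous (V := R_NormedModule)); auto_derive; trivial.
Qed.

Lemma dominated_increment_abs (x y : R) : 0 < x -> 0 < y ->
  Cmod (F y - F x)%C <= Rabs (G y - G x).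
Proof.
  intros Hx Hy; destruct (Rle_dec x y) as [H|H].
  - eapply Rle_trans; [now apply dominated_increment|apply Rle_abs].
  - replace (F y - F x)%C with (- (F x - F y))%C by ring.
    rewrite Cmod_opp, Rabs_minus_sym.
    eapply Rle_trans; [apply dominated_increment; lra|apply Rle_abs].
Qed.

(** Increments of [F] are bounded by those of the real primitive [G], so [F] is Cauchy wherever [G]
    converges. One argument thus serves both ends of the half line. *)
Lemma dominated_lim (Fl : (R -> Prop) -> Prop) {FF : ProperFilter Fl} (l : R) :
  Fl (fun x => 0 < x) -> filterlim G Fl (locally l) ->
  exists L : C, filterlim F Fl (locally (T := C_UniformSpace) L).
Proof.
  intros Hpos HG.
  apply (filterlim_locally_cauchy (U := C_R_CompleteNormedModule)).
  intros [eps Heps].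
  assert (He : 0 < eps / 2) by lra.
  pose proof (proj1 (filterlim_locally_ball_norm (K := R_AbsRing)
    (U := R_NormedModule) G l) HG (mkposreal _ He)) as H.
  exists (fun x => 0 < x /\ Rabs (G x - l) < eps / 2); split.
  - apply filter_and; [exact Hpos|exact H].
  - intros u v [Hu Hu'] [Hv Hv'].
    apply (norm_compat1 (V := C_R_NormedModule)); rewrite norm_C.
    change (Cmod (F v - F u)%C < eps).
    eapply Rle_lt_trans; [now apply dominated_increment_abs|].
    replace (G v - G u) with ((G v - l) - (G u - l)) by ring.
    eapply Rle_lt_trans; [apply Rabs_triang|]; rewrite Rabs_Ropp; lra.
Qed.

Lemma decay_lim_0 : filterlim G (at_right 0) (locally (- 4 * K)).
Proof.
  replace (- 4 * K) with (G 0)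
    by (unfold G; replace (- 0 / 4) with 0 by field; rewrite exp_0; ring).
  apply (filterlim_filter_le_1 (F := locally 0) (G := at_right 0)).
  - apply filter_le_within.
  - apply (ex_derive_continuous (V := R_NormedModule)); unfold G; auto_derive; trivial.
Qed.

Lemma decay_lim_infty : filterlim G (Rbar_locally p_infty) (locally 0).
Proof.
  change (is_lim G p_infty 0).
  replace (Finite 0) with (Rbar_mult (- 4 * K) 0) by (simpl; f_equal; ring).
  apply (is_lim_scal_l (fun x => exp (- x / 4)) (- 4 * K) p_infty 0).
  apply (is_lim_comp exp (fun x => - x / 4) p_infty 0 m_infty).
  - apply is_lim_exp_m.
  - apply (is_lim_ext (fun x => (- / 4) * x)); [intros; field|].
    replace m_infty with (Rbar_mult (- / 4) p_infty).
    + apply is_lim_scal_l, is_lim_id.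
    + simpl; destruct Rle_dec as [H|H]; [exfalso; lra|reflexivity].
  - now exists 0.
Qed.

Lemma dominated_limits : exists l0 l1 : C,
  filterlim F (at_right 0) (locally (T := C_UniformSpace) l0) /\
  filterlim F (Rbar_locally p_infty) (locally (T := C_UniformSpace) l1).
Proof.
  destruct (dominated_lim (at_right 0) (- 4 * K)) as [l0 H0].
  - generalize (at_right_0_lt 1 Rlt_0_1); apply filter_imp; intros x Hx; lra.
  - apply decay_lim_0.
  - destruct (dominated_lim (Rbar_locally p_infty) 0) as [l1 H1].
    + apply Rbar_locally_p_infty_gt.
    + apply decay_lim_infty.
    + exists l0, l1; now split.
Qed.

Lemma dominated_is_HInt : is_HInt p (HInt p).
Proof.
  destruct dominated_limits as (l0 & l1 & H0 & H1).
  assert (H : is_HInt p (l1 - l0)%C).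
  { apply is_HInt_primitive with F; trivial.
    - exact dominated_primitive.
    - apply Hp. }
  now rewrite (is_HInt_unique _ _ H).
Qed.

Lemma dominated_bound : Cmod (HInt p) <= 4 * K.
Proof.
  rewrite <- norm_C.
  apply (RInt_gen_norm (V := C_R_CompleteNormedModule)
    (Fa := at_right 0) (Fb := Rbar_locally p_infty) p (fun x => K * exp (- x / 4))).
  - apply Filter_prod with (fun a => 0 < a < 1) (fun b => 1 < b).
    + apply at_right_0_lt; lra.
    + apply Rbar_locally_p_infty_gt.
    + simpl; intros; lra.
  - apply Filter_prod with (fun a => 0 < a < 1) (fun b => 1 < b).
    + apply at_right_0_lt; lra.
    + apply Rbar_locally_p_infty_gt.
    + simpl; intros a b Ha Hb x Hx; rewrite norm_C; apply Hp; lra.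
  - exact dominated_is_HInt.
  - replace (4 * K) with (minus (G := R_AbelianGroup) 0 (- 4 * K))
      by (unfold minus, plus, opp; simpl; ring).
    apply (is_RInt_gen_primitive (V := R_CompleteNormedModule) _ G).
    + apply (positive_half_line (fun x => is_derive G x (K * exp (- x / 4)) /\
        continuous (fun x => K * exp (- x / 4)) x)).
      intros x Hx; split; [apply exp_decay_primitive|].
      apply (ex_derive_continuous (V := R_NormedModule)); auto_derive; trivial.
    + exact decay_lim_0.
    + exact decay_lim_infty.
Qed.

(** Truncated integrals with their limit: the form in which the principal value is defined. *)
Lemma dominated_tail : exists I : R -> C,
  (forall e, 0 < e -> is_RInt_gen (V := C_R_NormedModule) p
     (at_point e) (Rbar_locally p_infty) (I e)) /\
  filterlim I (at_right 0) (locally (T := C_UniformSpace) (HInt p)).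
Proof.
  destruct dominated_limits as (l0 & l1 & H0 & H1).
  assert (H : is_HInt p (l1 - l0)%C).
  { apply is_HInt_primitive with F; trivial.
    - exact dominated_primitive.
    - apply Hp. }
  exists (fun e => l1 - F e)%C; split.
  - intros e He.
    apply (is_RInt_gen_primitive (V := C_R_CompleteNormedModule) p F); trivial.
    + apply Filter_prod with (fun a => a = e) (fun b => e < b).
      * reflexivity.
      * apply Rbar_locally_p_infty_gt.
      * simpl; intros a b -> Hb x; rewrite Rmin_left, Rmax_right by lra.
        intros Hx; split; [apply dominated_primitive; lra|apply Hp; lra].
    + intros P HP; apply (locally_singleton (T := C_UniformSpace) (F e) P HP).
  - rewrite (is_HInt_unique _ _ H).
    apply filterlim_Cmod; [typeclasses eauto|].
    intros eps Heps.
    generalize (proj1 (filterlim_Cmod (at_right 0) F l0) H0 eps Heps).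
    apply filter_imp; intros x Hx.
    replace (l1 - F x - (l1 - l0))%C with (- (F x - l0))%C by ring.
    now rewrite Cmod_opp.
Qed.

End Dominated.

Lemma is_HInt_plus (p q : R -> C) (l m : C) :
  is_HInt p l -> is_HInt q m -> is_HInt (fun x => p x + q x)%C (l + m)%C.
Proof. apply (is_RInt_gen_plus (V := C_R_NormedModule)). Qed.

Lemma is_HInt_minus (p q : R -> C) (l m : C) :
  is_HInt p l -> is_HInt q m -> is_HInt (fun x => p x - q x)%C (l - m)%C.
Proof. apply (is_RInt_gen_minus (V := C_R_NormedModule)). Qed.

Lemma is_HInt_scal (c : C) (p : R -> C) (l : C) :
  is_HInt p l -> is_HInt (fun x => c * p x)%C (c * l)%C.
Proof. apply is_RInt_gen_Cscal. Qed.

(** The interval [[1, 2]] is there to allow a strict bound: [c = exp (- 2)] gives positivity of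
    Gamma on the reals, while [c = 0] is plain monotonicity. *)
Lemma is_HInt_Re_ge (p : R -> C) (l : C) (c : R) :
  (forall x, 0 < x -> 0 <= Re (p x)) -> (forall x, 1 <= x <= 2 -> c <= Re (p x)) ->
  is_HInt p l -> c <= Re l.
Proof.
  intros Hpos Hc H.
  (* If [Re l < c], some truncation to an interval containing [[1, 2]] already has real part below
     [c], which cutting at 1 and 2 refutes. *)
  apply Rnot_lt_le; intros Hlt.
  assert (He : 0 < c - Re l) by lra.
  pose proof (proj1 (filterlimi_locally (U := C_R_NormedModule) _ _) H
    (mkposreal _ He)) as H'.
  assert (H2 : filter_prod (at_right 0) (Rbar_locally p_infty)
    (fun ab : R * R => 0 < fst ab < 1 /\ 2 < snd ab)).
  { apply Filter_prod with (fun a => 0 < a < 1) (fun b => 2 < b).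
    - apply at_right_0_lt; lra.
    - apply Rbar_locally_p_infty_gt.
    - simpl; intros; lra. }
  destruct (filter_ex _ (filter_and _ _ H' H2)) as ([a b] & (z & Hz & Hb) & Ha1 & Hb2).
  simpl in *.
  destruct Hb as [Hb _]; simpl in Hb.
  unfold ball in Hb; simpl in Hb; unfold AbsRing_ball, abs, minus, plus, opp in Hb.
  simpl in Hb.
  change (Rabs (Re z + - Re l) < c - Re l) in Hb.
  assert (Re z < c) by (revert Hb; unfold Rabs; destruct Rcase_abs; lra).
  pose proof (is_RInt_fct_extend_fst p a b z Hz) as Hr.
  assert (E : forall u v, a <= u -> u <= v -> v <= b ->
    ex_RInt (V := R_CompleteNormedModule) (fun t => fst (p t)) u v).
  { intros u v Hu Huv Hv.
    apply (ex_RInt_Chasles_1 (V := R_CompleteNormedModule)) with b; [lra|].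
    apply (ex_RInt_Chasles_2 (V := R_CompleteNormedModule)) with a; [lra|].
    now exists (Re z). }
  assert (R1 : 0 <= RInt (fun t => fst (p t)) a 1).
  { apply RInt_ge_0; [lra|apply E; lra|intros; apply Hpos; lra]. }
  assert (R3 : 0 <= RInt (fun t => fst (p t)) 2 b).
  { apply RInt_ge_0; [lra|apply E; lra|intros; apply Hpos; lra]. }
  assert (R2 : c <= RInt (fun t => fst (p t)) 1 2).
  { apply Rle_trans with (RInt (fun _ => c) 1 2).
    - rewrite RInt_const; unfold scal; simpl; unfold mult; simpl; lra.
    - apply RInt_le; [lra|apply ex_RInt_const|apply E; lra|].
      intros; apply Hc; lra. }
  pose proof (RInt_Chasles (V := R_CompleteNormedModule) (fun t => fst (p t)) a 1 2
    (E a 1 ltac:(lra) ltac:(lra) ltac:(lra)) (E 1 2 ltac:(lra) ltac:(lra) ltac:(lra))) as C1.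
  pose proof (RInt_Chasles (V := R_CompleteNormedModule) (fun t => fst (p t)) a 2 b
    (E a 2 ltac:(lra) ltac:(lra) ltac:(lra)) (E 2 b ltac:(lra) ltac:(lra) ltac:(lra))) as C2.
  pose proof (is_RInt_unique (V := R_CompleteNormedModule) _ _ _ _ Hr) as C3.
  unfold plus in *; simpl in *; unfold Re in *; lra.
Qed.

Lemma is_RInt_gen_reflect (h : R -> C) (e : R) (l : C) :
  is_RInt_gen (V := C_R_NormedModule) (fun t => h (- t))
    (at_point e) (Rbar_locally p_infty) l ->
  is_RInt_gen (V := C_R_NormedModule) h (Rbar_locally m_infty) (at_point (- e)) l.
Proof.
  intros H P HP; specialize (H P HP); unfold filtermapi in *.
  destruct H as [Q S HQ HS H].
  apply Filter_prod with (fun a => S (- a)) (fun b => Q (- b)).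
  - destruct HS as [M HM]; exists (- M); intros x Hx; apply HM; lra.
  - unfold at_point; now rewrite Ropp_involutive.
  - intros a b Sa Qb; simpl.
    destruct (H (- b) (- a) Qb Sa) as (y & Hy & Py); exists y; split; [|exact Py].
    simpl in Hy.
    (* Reflection contributes one sign and the exchange of the endpoints another; the double
       opposite makes room for both. *)
    apply (is_RInt_ext (V := C_R_NormedModule)
      (fun x => opp (opp (h (- (- x)))))).
    { intros x _; rewrite (opp_opp (G := C_AbelianGroup)), Ropp_involutive; reflexivity. }
    apply (is_RInt_comp_opp (V := C_R_NormedModule) (fun x => opp (h (- x)))).
    rewrite <- (opp_opp (G := C_AbelianGroup) y).
    apply (is_RInt_opp (V := C_R_NormedModule)).
    now apply (is_RInt_swap (V := C_R_NormedModule)).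
Qed.

(** * Complex powers as weights *)

Lemma Cexp_plus (z w : C) : Cexp (z + w) = (Cexp z * Cexp w)%C.
Proof.
  destruct z as [a b], w as [c d]; unfold Cexp; simpl.
  rewrite exp_plus, cos_plus, sin_plus.
  unfold Cmult, RtoC; simpl; f_equal; ring.
Qed.

Lemma Cexp_RtoC (r : R) : Cexp (RtoC r) = RtoC (exp r).
Proof.
  unfold Cexp; simpl; rewrite cos_0, sin_0.
  unfold Cmult, RtoC; simpl; f_equal; ring.
Qed.

Lemma Cexp_0 : Cexp (RtoC 0) = RtoC 1.
Proof. now rewrite Cexp_RtoC, exp_0. Qed.

Lemma Cmod_Cexp (z : C) : Cmod (Cexp z) = exp (Re z).
Proof.
  unfold Cexp; rewrite Cmod_mult, Cmod_R, Rabs_right by (left; apply exp_pos).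
  replace (Cmod (cos (Im z), sin (Im z))) with 1; [ring|].
  unfold Cmod; simpl.
  rewrite <- sqrt_1 at 1; f_equal.
  pose proof (sin2_cos2 (Im z)) as H; unfold Rsqr in H; lra.
Qed.

Lemma is_derive_Cexp (z : C) (t : R) :
  deriv (fun t => Cexp (z * RtoC t)) t (z * Cexp (z * RtoC t))%C.
Proof.
  destruct z as [a b]; apply is_derive_C; unfold Cexp; simpl.
  - auto_derive; [trivial|].
    change (a * t + - (b * 0)) with (a * t - b * 0); ring.
  - auto_derive; [trivial|].
    change (a * t + - (b * 0)) with (a * t - b * 0); ring.
Qed.

(** Taylor's estimate along the segment [t |-> Cexp (w t)] from 0 to 1, where the second derivative
    is at most [|w|^2 exp (|Re w|)]. *)
Lemma Cexp_taylor (w : C) :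
  Cmod (Cexp w - 1 - w)%C <= Cmod w ^ 2 * exp (Rabs (Re w)).
Proof.
  pose proof (deriv_taylor (fun t => Cexp (w * RtoC t))
    (fun t => w * Cexp (w * RtoC t))%C
    (fun t => w * (w * Cexp (w * RtoC t)))%C 0 1 (Cmod w ^ 2 * exp (Rabs (Re w)))) as H.
  rewrite Rmin_left, Rmax_right in H by lra.
  replace (Cexp w - 1 - w)%C with
    (Cexp (w * RtoC 1) - Cexp (w * RtoC 0) -
      RtoC (1 - 0) * (w * Cexp (w * RtoC 0)))%C.
  - eapply Rle_trans; [apply H|right; ring].
    + intros; apply is_derive_Cexp.
    + intros; apply is_derive_Cscal, is_derive_Cexp.
    + intros; do 2 apply continuous_Cscal.
      apply (deriv_cont _ _ _ (is_derive_Cexp w x)).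
    + intros x Hx; rewrite !Cmod_mult, Cmod_Cexp.
      replace (Re (w * RtoC x)%C) with (x * Re w) by (simpl; unfold Re; ring).
      rewrite <- Rmult_assoc; replace (Cmod w * Cmod w) with (Cmod w ^ 2) by ring.
      apply Rmult_le_compat_l; [apply pow2_ge_0|].
      destruct (Rle_lt_or_eq_dec (x * Re w) (Rabs (Re w))) as [H1|H1].
      * unfold Rabs; destruct Rcase_abs; nra.
      * left; now apply exp_increasing.
      * rewrite H1; lra.
  - replace (1 - 0) with 1 by ring.
    rewrite Cmult_0_r, Cexp_0, Cmult_1_r; ring.
Qed.

Lemma Rcpow_plus (x : R) (z w : C) : Rcpow x (z + w) = (Rcpow x z * Rcpow x w)%C.
Proof. unfold Rcpow; rewrite <- Cexp_plus; f_equal; ring. Qed.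

Lemma Rcpow_mult (x y : R) (z : C) : 0 < x -> 0 < y ->
  Rcpow (x * y) z = (Rcpow x z * Rcpow y z)%C.
Proof.
  intros Hx Hy; unfold Rcpow; rewrite <- Cexp_plus, ln_mult, RtoC_plus by assumption.
  f_equal; ring.
Qed.

Lemma Rcpow_1_r (x : R) : 0 < x -> Rcpow x (RtoC 1) = RtoC x.
Proof.
  intros Hx; unfold Rcpow; rewrite Cmult_1_l, Cexp_RtoC, exp_ln; trivial.
Qed.

Lemma Rcpow_0_r (x : R) : Rcpow x (RtoC 0) = RtoC 1.
Proof. unfold Rcpow; now rewrite Cmult_0_l, Cexp_0. Qed.

Lemma Rcpow_S (x : R) (z : C) : 0 < x -> Rcpow x (z + 1) = (RtoC x * Rcpow x z)%C.
Proof. intros Hx; rewrite Rcpow_plus, Rcpow_1_r by trivial; ring. Qed.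

Lemma Cmod_Rcpow (x : R) (z : C) : Cmod (Rcpow x z) = exp (Re z * ln x).
Proof.
  unfold Rcpow; rewrite Cmod_Cexp; f_equal; simpl; unfold Re; ring.
Qed.

Lemma Rcpow_RtoC (x a : R) : Rcpow x (RtoC a) = RtoC (exp (a * ln x)).
Proof. unfold Rcpow; rewrite <- RtoC_mult; apply Cexp_RtoC. Qed.

Lemma Rcpow_neq_0 (x : R) (z : C) : Rcpow x z <> RtoC 0.
Proof.
  intros H; pose proof (Cmod_Rcpow x z) as E; rewrite H, Cmod_0 in E.
  pose proof (exp_pos (Re z * ln x)); lra.
Qed.

Lemma is_derive_Rcpow (x : R) (z : C) : 0 < x ->
  deriv (fun x => Rcpow x z) x (z * Rcpow x (z - 1))%C.
Proof.
  intros Hx; evar_last.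
  - apply (is_derive_Ccomp (fun t => Cexp (z * RtoC t)) ln).
    + apply is_derive_Cexp.
    + apply is_derive_ln, Hx.
  - fold (Rcpow x z); simpl.
    replace z with ((z - 1) + 1)%C at 2 by ring.
    rewrite Rcpow_S, RtoC_inv by lra.
    field; intros E; apply RtoC_inj in E; lra.
Qed.

Lemma continuous_Rcpow (x : R) (z : C) : 0 < x -> cont (fun x => Rcpow x z) x.
Proof. intros Hx; apply (deriv_cont _ _ _ (is_derive_Rcpow x z Hx)). Qed.

(** * Growth of powers and logarithms against exponentials *)

Lemma exp_le (x y : R) : x <= y -> exp x <= exp y.
Proof.
  intros [H| ->]; [left; now apply exp_increasing|right; reflexivity].
Qed.

Lemma exp_ge_succ (x : R) : 1 + x <= exp x.
Proof.
  destruct (Req_dec x 0) as [->|H]; [rewrite exp_0; lra|left; now apply exp_ineq1].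
Qed.

Lemma ln_le_pred (x : R) : 0 < x -> ln x <= x - 1.
Proof.
  intros Hx; pose proof (exp_ge_succ (ln x)) as H; rewrite exp_ln in H; lra.
Qed.

(** [b ln x - c x] is largest at [x = b / c]; the tangent of [ln] at that point gives the constant,
    up to a dropped factor [e^(-b)]. *)
Lemma power_le_exp (b c : R) : 0 <= b -> 0 < c ->
  exists K, 0 <= K /\ forall x, 0 < x -> exp (b * ln x) <= K * exp (c * x).
Proof.
  intros [Hb| <-] Hc0.
  - assert (Hc : 0 < b / c) by now apply Rdiv_lt_0_compat.
    exists (exp (b * ln (b / c))); split; [left; apply exp_pos|].
    intros x Hx; rewrite <- exp_plus; apply exp_le.
    pose proof (ln_le_pred (x / (b / c)) (Rdiv_lt_0_compat _ _ Hx Hc)) as H.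
    rewrite ln_div in H by assumption.
    apply (Rmult_le_compat_l b) in H; [|lra].
    replace (b * (x / (b / c) - 1)) with (c * x - b) in H by (field; lra).
    lra.
  - exists 1; split; [lra|]; intros x Hx.
    rewrite Rmult_0_l, exp_0, Rmult_1_l; rewrite <- exp_0; apply exp_le; nra.
Qed.

(** One bound covers both ends: it forbids a singularity at 0, which is why high orders [k] are
    taken, and keeps the growth below the decay [exp (- x / 2)]. *)
Definition weight (K : R) (w : R -> C) : Prop :=
  forall x, 0 < x -> cont w x /\ Cmod (w x) <= K * exp (x / 4).

Lemma power_le_exp4 (b : R) : 0 <= b ->
  exists K, 0 <= K /\ forall x, 0 < x -> exp (b * ln x) <= K * exp (x / 4).
Proof.
  intros Hb; destruct (power_le_exp b (/ 4) Hb) as (K & HK & H); [lra|].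
  exists K; split; [exact HK|]; intros x Hx.
  replace (x / 4) with (/ 4 * x) by field; now apply H.
Qed.

Lemma weight_Rcpow (z : C) : 1 <= Re z ->
  exists K, 0 <= K /\ weight K (fun x => Rcpow x (z - 1)).
Proof.
  intros Hz; destruct (power_le_exp4 (Re z - 1)) as (K & HK & H); [lra|].
  exists K; split; [exact HK|]; intros x Hx; split.
  - now apply continuous_Rcpow.
  - rewrite Cmod_Rcpow.
    replace (Re (z - 1)%C) with (Re z - 1) by (simpl; unfold Re; ring).
    now apply H.
Qed.

(* Both factors [x] and [/ x] lost to logarithms are absorbed by the exponent. *)
Lemma power_log_bound (a : R) : 2 <= a ->
  exists K, 0 <= K /\
    forall x, 0 < x -> exp ((a - 1) * ln x) * exp (Rabs (ln x)) <= K * exp (x / 4).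
Proof.
  intros Ha.
  destruct (power_le_exp4 a) as (K1 & HK1 & H1); [lra|].
  destruct (power_le_exp4 (a - 2)) as (K2 & HK2 & H2); [lra|].
  exists (K1 + K2); split; [lra|]; intros x Hx.
  specialize (H1 x Hx); specialize (H2 x Hx).
  rewrite <- exp_plus.
  pose proof (exp_pos (a * ln x)); pose proof (exp_pos ((a - 2) * ln x)).
  unfold Rabs; destruct Rcase_abs.
  - replace ((a - 1) * ln x + - ln x) with ((a - 2) * ln x) by ring; lra.
  - replace ((a - 1) * ln x + ln x) with (a * ln x) by ring; lra.
Qed.

(** This is the derivative of the weight in [z]. Since [|ln x| <= exp (|ln x|)] is [x] or [1/x], one
    spare power of [x] at the origin is enough, whence [2 <= Re z]. *)
Lemma weight_log_Rcpow (z : C) : 2 <= Re z ->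
  exists K, 0 <= K /\ weight K (fun x => RtoC (ln x) * Rcpow x (z - 1))%C.
Proof.
  intros Hz; destruct (power_log_bound (Re z) Hz) as (K & HK & H).
  exists K; split; [exact HK|]; intros x Hx; split.
  - apply continuous_Cmult; [|now apply continuous_Rcpow].
    apply continuous_RtoC, (ex_derive_continuous (V := R_NormedModule)).
    now auto_derive.
  - eapply Rle_trans; [|now apply H].
    rewrite Cmod_mult, Cmod_R, Cmod_Rcpow, Rmult_comm.
    replace (Re (z - 1)%C) with (Re z - 1) by (simpl; unfold Re; ring).
    apply Rmult_le_compat_l; [left; apply exp_pos|].
    pose proof (exp_ge_succ (Rabs (ln x))); lra.
Qed.

(** [Cexp_taylor] at [w = h ln x] leaves [(ln x)^2 exp (|h| |ln x|)]. With [|h| <= 1/2] half of the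
    available [exp (|ln x|)] pays for the exponential and the other half for the square. *)
Lemma weight_Rcpow_taylor (z : C) : 2 <= Re z ->
  exists K, 0 <= K /\ forall h : C, Cmod h <= 1 / 2 ->
    weight (K * Cmod h ^ 2)
      (fun x => Rcpow x (z + h - 1) - Rcpow x (z - 1)
         - h * (RtoC (ln x) * Rcpow x (z - 1)))%C.
Proof.
  intros Hz; destruct (power_log_bound (Re z) Hz) as (K & HK & H).
  exists (16 * K); split; [lra|]; intros h Hh x Hx; split.
  - apply continuous_Cminus; [apply continuous_Cminus; now apply continuous_Rcpow|].
    apply continuous_Cscal, continuous_Cmult; [|now apply continuous_Rcpow].
    apply continuous_RtoC, (ex_derive_continuous (V := R_NormedModule)).
    now auto_derive.
  - replace (z + h - 1)%C with ((z - 1) + h)%C by ring.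
    rewrite Rcpow_plus.
    replace (Rcpow x (z - 1) * Rcpow x h - Rcpow x (z - 1) -
      h * (RtoC (ln x) * Rcpow x (z - 1)))%C with
      (Rcpow x (z - 1) * (Cexp (h * RtoC (ln x)) - 1 - h * RtoC (ln x)))%C
      by (unfold Rcpow; ring).
    rewrite Cmod_mult, Cmod_Rcpow.
    replace (Re (z - 1)%C) with (Re z - 1) by (simpl; unfold Re; ring).
    set (L := ln x) in *; specialize (H x Hx); fold L in H.
    pose proof (exp_pos ((Re z - 1) * L)) as HP.
    assert (Ht : Cmod (Cexp (h * RtoC L) - 1 - h * RtoC L)%C <=
      Cmod h ^ 2 * (16 * exp (Rabs L))).
    { eapply Rle_trans; [apply Cexp_taylor|].
      rewrite Cmod_mult, Cmod_R, Rpow_mult_distr, Rmult_assoc.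
      apply Rmult_le_compat_l; [apply pow2_ge_0|].
      assert (H1 : Rabs (Re (h * RtoC L)%C) <= Rabs L / 2).
      { replace (Re (h * RtoC L)%C) with (Re h * L) by (simpl; unfold Re; ring).
        rewrite Rabs_mult.
        pose proof (re_le_Cmod h); pose proof (Rabs_pos L); nra. }
      (* The square of [u <= exp u] at [u = |L| / 4]. *)
      assert (H2 : Rabs L ^ 2 <= 16 * exp (Rabs L / 2)).
      { pose proof (exp_ge_succ (Rabs L / 4)) as E.
        replace (Rabs L / 2) with (Rabs L / 4 + Rabs L / 4) by field.
        rewrite exp_plus; pose proof (Rabs_pos L); nra. }
      apply exp_le in H1.
      replace (exp (Rabs L)) with (exp (Rabs L / 2 + Rabs L / 2)) by (f_equal; field).
      rewrite exp_plus.
      pose proof (exp_pos (Rabs (Re (h * RtoC L)%C))).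
      pose proof (pow2_ge_0 (Rabs L)); pose proof (exp_pos (Rabs L / 2)).
      apply Rle_trans with (Rabs L ^ 2 * exp (Rabs L / 2)).
      - now apply Rmult_le_compat_l.
      - rewrite <- Rmult_assoc; apply Rmult_le_compat_r; lra. }
    eapply Rle_trans; [apply Rmult_le_compat_l; [lra|exact Ht]|].
    pose proof (pow2_ge_0 (Cmod h)).
    replace (exp ((Re z - 1) * L) * (Cmod h ^ 2 * (16 * exp (Rabs L)))) with
      (16 * Cmod h ^ 2 * (exp ((Re z - 1) * L) * exp (Rabs L))) by ring.
    replace (16 * K * Cmod h ^ 2 * exp (x / 4)) with
      (16 * Cmod h ^ 2 * (K * exp (x / 4))) by ring.
    apply Rmult_le_compat_l; lra.
Qed.

(** * Convolution and principal value *)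

(** Decay is required only to the right; growth is allowed to the left, where the convolution of a
    compactly supported function with a power need not decay. The exponent 1/2 exceeds the growth
    1/4 of weights and is less than 1, the decay rate of [1/(e^t-1)]. *)
Definition tame (M : R) (g : R -> C) : Prop :=
  forall y, cont g y /\ Cmod (g y) <= M * exp (- y / 2).

Definition conv (w g : R -> C) (t : R) : C := HInt (fun x => w x * g (x + t)%R)%C.

Lemma exp_shift (a b c : R) : a = b + c -> exp a = exp b * exp c.
Proof. intros ->; apply exp_plus. Qed.

Lemma continuous_shift (g : R -> C) (t x : R) :
  cont g (x + t) -> cont (fun x => g (x + t)) x.
Proof.
  intros H; apply (continuous_comp (fun x => x + t) g); [|exact H].
  apply (ex_derive_continuous (V := R_NormedModule)); auto_derive; trivial.
Qed.

Lemma is_derive_shift (g : R -> C) (t x : R) (l : C) :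
  deriv g (x + t) l -> deriv (fun x => g (x + t)) x l.
Proof.
  intros H; evar_last.
  - apply (is_derive_Ccomp g (fun x => x + t) x l 1); [exact H|].
    auto_derive; trivial.
  - simpl; ring.
Qed.

Definition decays (M : R) (f : R -> C) : Prop :=
  forall x, 0 < x -> cont f x /\ Cmod (f x) <= M * exp (- x / 2).

Lemma weight_mult_dominated (K M : R) (w f : R -> C) :
  weight K w -> decays M f -> dominated (K * M) (fun x => w x * f x)%C.
Proof.
  intros Hw Hf x Hx; destruct (Hw x Hx) as [Cw Bw]; destruct (Hf x Hx) as [Cf Bf].
  split; [now apply continuous_Cmult|].
  rewrite Cmod_mult.
  eapply Rle_trans; [apply Rmult_le_compat; [apply Cmod_ge_0|apply Cmod_ge_0|exact Bw|exact Bf]|].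
  right; rewrite (exp_shift (- x / 4) (x / 4) (- x / 2)) by field; ring.
Qed.

Lemma tame_decays (M t : R) (g : R -> C) :
  tame M g -> decays (M * exp (- t / 2)) (fun x => g (x + t)).
Proof.
  intros H x Hx; split; [apply continuous_shift, H|].
  eapply Rle_trans; [apply H|]; right.
  rewrite (exp_shift (- (x + t) / 2) (- t / 2) (- x / 2)) by field; ring.
Qed.

Lemma conv_dominated (K M t : R) (w g : R -> C) :
  weight K w -> tame M g ->
  dominated (K * M * exp (- t / 2)) (fun x => w x * g (x + t)%R)%C.
Proof.
  intros Hw Hg; rewrite Rmult_assoc.
  exact (weight_mult_dominated _ _ _ _ Hw (tame_decays M t g Hg)).
Qed.

Lemma conv_is_HInt (K M t : R) (w g : R -> C) :
  weight K w -> tame M g -> is_HInt (fun x => w x * g (x + t)%R)%C (conv w g t).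
Proof. intros Hw Hg; exact (dominated_is_HInt _ _ (conv_dominated K M t w g Hw Hg)). Qed.

Lemma conv_bound (K M t : R) (w g : R -> C) :
  weight K w -> tame M g -> Cmod (conv w g t) <= 4 * K * M * exp (- t / 2).
Proof.
  intros Hw Hg.
  eapply Rle_trans; [exact (dominated_bound _ _ (conv_dominated K M t w g Hw Hg))|].
  right; ring.
Qed.

(** Differentiation under the integral sign: the bound on [g2] makes the pointwise Taylor remainder
    quadratic in the increment, and [dominated_bound] integrates it. *)
Lemma is_derive_conv (K M0 M1 M2 t : R) (w g0 g1 g2 : R -> C) :
  weight K w -> tame M0 g0 -> tame M1 g1 -> tame M2 g2 ->
  (forall y, deriv g0 y (g1 y)) -> (forall y, deriv g1 y (g2 y)) ->
  deriv (conv w g0) t (conv w g1 t).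
Proof.
  intros Hw T0 T1 T2 D0 D1.
  assert (HM : 0 <= M2).
  { destruct (T2 0) as [_ H]; pose proof (Cmod_ge_0 (g2 0)).
    replace (- 0 / 2) with 0 in H by field; rewrite exp_0 in H; lra. }
  (* For [|y - t| < 1] all intermediate points lie to the right of [x + t - 1], which accounts for
     [t - 1] in the constant. *)
  apply (is_derive_quadratic (V := C_R_NormedModule) _ _ _
    (4 * (K * M2 * exp (- (t - 1) / 2))) 1 Rlt_0_1).
  intros y Hy; rewrite norm_C.
  change (abs (minus y t)) with (Rabs (y - t)) in *.
  rewrite scal_R_C; change (minus (G := R_AbsRing) y t) with (y - t).
  change (Cmod (conv w g0 y - conv w g0 t - RtoC (y - t) * conv w g1 t)%C <=
    4 * (K * M2 * exp (- (t - 1) / 2)) * Rabs (y - t) ^ 2).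
  rewrite pow2_abs.
  set (q := fun x => (w x * (g0 (x + y)%R - g0 (x + t)%R - RtoC (y - t) * g1 (x + t)%R))%C).
  assert (E : is_HInt q (conv w g0 y - conv w g0 t - RtoC (y - t) * conv w g1 t)%C).
  { eapply is_HInt_ext; [|apply is_HInt_minus; [apply is_HInt_minus|apply is_HInt_scal];
      eapply conv_is_HInt; eassumption].
    intros x _; unfold q; simpl; ring. }
  rewrite <- (is_HInt_unique _ _ E).
  replace (4 * (K * M2 * exp (- (t - 1) / 2)) * (y - t) ^ 2) with
    (4 * (K * M2 * exp (- (t - 1) / 2) * (y - t) ^ 2)) by ring.
  apply dominated_bound; intros x Hx; destruct (Hw x Hx) as [Cw Bw]; split.
  - apply continuous_Cmult; [exact Cw|].
    apply continuous_Cminus; [apply continuous_Cminus; apply continuous_shift; apply T0|].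
    apply continuous_Cscal, continuous_shift, T1.
  - unfold q; rewrite Cmod_mult.
    apply Rle_trans with
      ((K * exp (x / 4)) * ((M2 * exp (- (x + t - 1) / 2)) * (y - t) ^ 2)).
    + apply Rmult_le_compat; [apply Cmod_ge_0|apply Cmod_ge_0|exact Bw|].
      replace (y - t) with ((x + y) - (x + t)) by ring.
      apply deriv_taylor with g2; intros u Hu; trivial; [apply T2|].
      eapply Rle_trans; [apply T2|].
      apply Rmult_le_compat_l; [exact HM|apply exp_le].
      revert Hu Hy; unfold Rmin, Rmax, Rabs; repeat destruct Rle_dec;
        destruct Rcase_abs; lra.
    + right; rewrite (exp_shift (- (x + t - 1) / 2) (- (t - 1) / 2) (- x / 2)) by field.
      rewrite (exp_shift (- x / 4) (x / 4) (- x / 2)) by field; ring.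
Qed.

(* Since [1/(e^(-t)-1) + 1/(e^t-1) = -1], folding the principal value integral
   over the origin produces an absolutely convergent one. *)
Definition fold_PV (psi : R -> C) (t : R) : C :=
  (RtoC (/ (exp t - 1)) * (psi (- t)%R - psi t) - psi t)%C.

Definition PV (psi : R -> C) : C := HInt (fold_PV psi).

Lemma exp_minus_1_pos (t : R) : 0 < t -> 0 < exp t - 1.
Proof. intros Ht; pose proof (exp_ineq1 t); lra. Qed.

(** The difference [psi (-t) - psi t] is of order [t] and cancels the simple pole of [1/(e^t-1)]. It
    accounts for 8 of the 9; the isolated term [- psi t] adds 1. *)
Lemma fold_PV_dominated (M : R) (psi dpsi : R -> C) :
  tame M psi -> tame M dpsi -> (forall t, deriv psi t (dpsi t)) ->
  dominated (9 * M) (fold_PV psi).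
Proof.
  intros T T' D t Ht; pose proof (exp_minus_1_pos t Ht) as He.
  assert (HM : 0 <= M).
  { destruct (T 0) as [_ H]; pose proof (Cmod_ge_0 (psi 0)).
    replace (- 0 / 2) with 0 in H by field; rewrite exp_0 in H; lra. }
  split.
  - apply continuous_Cminus; [|apply T].
    apply continuous_Cmult.
    + apply continuous_RtoC, (ex_derive_continuous (V := R_NormedModule)).
      auto_derive; lra.
    + apply continuous_Cminus; [|apply T].
      apply (continuous_comp (fun t => - t) psi); [|apply T].
      apply (ex_derive_continuous (V := R_NormedModule)); auto_derive; trivial.
  - assert (B1 : Cmod (psi (- t)%R - psi t)%C <= M * exp (t / 2) * (2 * t)).
    { replace (2 * t) with (Rabs (- t - t)) by (rewrite Rabs_left; lra).
      apply (deriv_bound_abs psi dpsi t (- t)).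
      - intros; apply D.
      - intros; apply T'.
      - rewrite Rmin_right, Rmax_left by lra; intros x Hx.
        eapply Rle_trans; [apply T'|].
        apply Rmult_le_compat_l; [exact HM|apply exp_le; lra]. }
    assert (B2 : Cmod (RtoC (/ (exp t - 1)) * (psi (- t)%R - psi t))%C <=
      8 * M * exp (- t / 4)).
    { rewrite Cmod_mult, Cmod_R, Rabs_right by (left; now apply Rinv_0_lt_compat).
      apply Rmult_le_reg_l with (exp t - 1); [exact He|].
      rewrite <- Rmult_assoc, Rinv_r, Rmult_1_l by lra.
      eapply Rle_trans; [exact B1|].
      (* In terms of [u] the claim is [u^3 t <= 4 (u^4 - 1)], which follows from [t <= 4 (u - 1)]
         and [1 <= u^3]. *)
      set (u := exp (t / 4)).
      assert (Hu : 1 + t / 4 <= u) by apply exp_ge_succ.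
      assert (Hinv : exp (- t / 4) * u = 1).
      { unfold u; rewrite <- exp_plus, <- exp_0; f_equal; field. }
      replace (exp t) with (u * u * u * u)
        by (unfold u; rewrite <- !exp_plus; f_equal; field).
      replace (exp (t / 2)) with (u * u * u * exp (- t / 4))
        by (unfold u; rewrite <- !exp_plus; f_equal; field).
      pose proof (exp_pos (- t / 4)) as Hp; set (v := exp (- t / 4)) in *.
      assert (Hut : t <= 4 * (u - 1)) by lra.
      assert (Hu3 : 0 < u * u * u) by (repeat apply Rmult_lt_0_compat; lra).
      assert (K1 : u * u * u * t <= 4 * (u * u * u * u - 1)).
      { apply Rle_trans with (u * u * u * (4 * (u - 1))).
        - apply Rmult_le_compat_l; lra.
        - assert (1 <= u * u * u) by nra; nra. }
      replace (M * (u * u * u * v) * (2 * t)) with (2 * M * v * (u * u * u * t)) by ring.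
      replace ((u * u * u * u - 1) * (8 * M * v)) with
        (2 * M * v * (4 * (u * u * u * u - 1))) by ring.
      apply Rmult_le_compat_l; [|exact K1]; apply Rmult_le_pos; lra. }
    assert (B3 : Cmod (psi t) <= M * exp (- t / 4)).
    { eapply Rle_trans; [apply T|]; apply Rmult_le_compat_l; [exact HM|].
      apply exp_le; lra. }
    unfold fold_PV, Cminus at 1.
    eapply Rle_trans; [apply Cmod_triangle|]; rewrite Cmod_opp; lra.
Qed.

Lemma PV_bound (M : R) (psi dpsi : R -> C) :
  tame M psi -> tame M dpsi -> (forall t, deriv psi t (dpsi t)) ->
  Cmod (PV psi) <= 36 * M.
Proof.
  intros T T' D.
  pose proof (dominated_bound _ _ (fold_PV_dominated M psi dpsi T T' D)).
  unfold PV; lra.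
Qed.

Lemma tail_integrable (K e : R) (p : R -> C) : 0 < e ->
  (forall x, e <= x -> cont p x /\ Cmod (p x) <= K * exp (- x / 4)) ->
  exists I, is_RInt_gen (V := C_R_NormedModule) p
    (at_point e) (Rbar_locally p_infty) I.
Proof.
  intros He H.
  assert (HK : 0 <= K).
  { destruct (H e (Rle_refl e)) as [_ B].
    pose proof (Cmod_ge_0 (p e)); pose proof (exp_pos (- e / 4)); nra. }
  (* Freezing [p] at its value in [e] to the left of [e] makes it continuous and bounded down to 0,
     as [dominated] demands, without touching the tail. *)
  destruct (dominated_tail K (fun x => p (Rmax e x))) as (I & HI & _).
  - intros x Hx; pose proof (Rmax_l e x) as Hl; pose proof (Rmax_r e x) as Hr.
    destruct (H _ Hl) as [C B]; split.
    + apply (continuous_comp (Rmax e) p); [|exact C].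
      apply (continuous_ext (fun y => (e + y + Rabs (e - y)) / 2)).
      { intros y; unfold Rmax, Rabs; destruct Rle_dec, Rcase_abs; lra. }
      apply (continuous_scal_l (K := R_AbsRing) (V := R_NormedModule)
        (fun y => e + y + Rabs (e - y)) (/ 2)).
      apply (continuous_plus (V := R_NormedModule) (fun y => e + y)
        (fun y => Rabs (e - y))).
      * apply (ex_derive_continuous (V := R_NormedModule)); auto_derive; trivial.
      * apply (continuous_comp (fun y => e - y) Rabs).
        -- apply (ex_derive_continuous (V := R_NormedModule)); auto_derive; trivial.
        -- apply (continuous_abs (K := R_AbsRing)).
    + eapply Rle_trans; [exact B|]; apply Rmult_le_compat_l; [exact HK|].
      apply exp_le; lra.
  - exists (I e).
    generalize (HI e He); apply (is_RInt_gen_ext (V := C_R_NormedModule)).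
    apply Filter_prod with (fun a => a = e) (fun b => e < b).
    + reflexivity.
    + apply Rbar_locally_p_infty_gt.
    + simpl; intros a b -> Hb x; rewrite Rmin_left, Rmax_right by lra; intros Hx.
      f_equal; apply Rmax_right; lra.
Qed.

(** The cut [eps < |t|] is symmetric, so after reflection of the negative ray the truncated integral
    is exactly the tail of the folded one; the limit is then mere convergence of an absolutely
    convergent integral. *)
Lemma PV_limit (M : R) (psi dpsi : R -> C) :
  tame M psi -> tame M dpsi -> (forall t, deriv psi t (dpsi t)) ->
  exists J : R -> C,
    (forall eps : R, 0 < eps ->
       is_RInt_outside eps (fun t => RtoC (/ (exp (- t) - 1)) * psi t)%C (J eps)) /\
    filterlim J (at_right 0) (locally (T := C_UniformSpace) (PV psi)).
Proof.
  intros T T' D.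
  assert (HM : 0 <= M).
  { destruct (T 0) as [_ H]; pose proof (Cmod_ge_0 (psi 0)).
    replace (- 0 / 2) with 0 in H by field; rewrite exp_0 in H; lra. }
  destruct (dominated_tail _ _ (fold_PV_dominated M psi dpsi T T' D)) as (J & HJ & HL).
  exists J; split; [|exact HL]; clear HL.
  intros e He.
  set (h := fun t => (RtoC (/ (exp (- t) - 1)) * psi t)%C).
  (* For [t >= e] the kernel is at most [1 / (1 - exp (- e))] in absolute value; on the reflected
     ray it carries a further factor [exp (- t)], which outweighs the growth [exp (t / 2)] of
     [psi]. *)
  assert (Hd : 0 < 1 - exp (- e)).
  { pose proof (exp_increasing (- e) 0); rewrite exp_0 in *; lra. }
  destruct (tail_integrable (M / (1 - exp (- e))) e h He) as [I2 H2].
  { intros x Hx.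
    assert (Hx1 : exp (- x) < 1) by (rewrite <- exp_0; apply exp_increasing; lra).
    split.
    - apply continuous_Cmult; [|apply T].
      apply continuous_RtoC, (ex_derive_continuous (V := R_NormedModule)).
      auto_derive; lra.
    - unfold h; rewrite Cmod_mult, Cmod_R, Rabs_inv, Rabs_left by lra.
      unfold Rdiv; rewrite (Rmult_comm M), Rmult_assoc.
      apply Rmult_le_compat; [|apply Cmod_ge_0| |].
      + left; apply Rinv_0_lt_compat; lra.
      + apply Rinv_le_contravar; [exact Hd|].
        assert (exp (- x) <= exp (- e)) by (apply exp_le; lra); lra.
      + eapply Rle_trans; [apply T|]; apply Rmult_le_compat_l; [exact HM|].
        apply exp_le; lra. }
  destruct (tail_integrable (M / (1 - exp (- e))) e (fun t => h (- t)) He) as [I1 H1].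
  { intros x Hx.
    assert (Hx1 : 0 < exp x - 1) by (apply exp_minus_1_pos; lra).
    split.
    - apply continuous_Cmult.
      + apply continuous_RtoC, (ex_derive_continuous (V := R_NormedModule)).
        auto_derive; rewrite Ropp_involutive; lra.
      + apply (continuous_comp (fun t => - t) psi); [|apply T].
        apply (ex_derive_continuous (V := R_NormedModule)); auto_derive; trivial.
    - unfold h; rewrite Ropp_involutive, Cmod_mult, Cmod_R, Rabs_inv, Rabs_right by lra.
      apply Rle_trans with ((/ (1 - exp (- e)) * exp (- x)) * (M * exp (x / 2))).
      + apply Rmult_le_compat; [|apply Cmod_ge_0| |].
        * left; apply Rinv_0_lt_compat; lra.
        * apply Rmult_le_reg_l with (exp x - 1); [lra|].
          rewrite Rinv_r by lra.
          replace ((exp x - 1) * (/ (1 - exp (- e)) * exp (- x))) with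
            (/ (1 - exp (- e)) * (exp x * exp (- x) - exp (- x))) by ring.
          rewrite <- exp_plus; replace (x + - x) with 0 by ring; rewrite exp_0.
          apply Rmult_le_reg_l with (1 - exp (- e)); [lra|].
          rewrite <- Rmult_assoc, Rinv_r, Rmult_1_l by lra.
          assert (exp (- x) <= exp (- e)) by (apply exp_le; lra); lra.
        * destruct (T (- x)) as [_ B]; now rewrite Ropp_involutive in B.
      + unfold Rdiv at 2.
        replace (/ (1 - exp (- e)) * exp (- x) * (M * exp (x / 2))) with
          (M * / (1 - exp (- e)) * (exp (- x) * exp (x / 2))) by ring.
        rewrite <- exp_plus; apply Rmult_le_compat_l.
        * apply Rmult_le_pos; [exact HM|left; apply Rinv_0_lt_compat; lra].
        * apply exp_le; lra. }
  exists I1, I2; split; [now apply is_RInt_gen_reflect|]; split; [exact H2|].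
  (* [J e] and [I1 + I2] are both integrals over [[e, oo)], so it suffices to compare the
     integrands. *)
  rewrite <- (is_RInt_gen_unique (V := C_R_CompleteNormedModule) _ _ (HJ e He)).
  apply (is_RInt_gen_unique (V := C_R_CompleteNormedModule)).
  generalize (is_RInt_gen_plus (V := C_R_NormedModule) _ _ _ _ H1 H2).
  apply (is_RInt_gen_ext (V := C_R_NormedModule)).
  apply Filter_prod with (fun a => a = e) (fun b => e < b).
  - reflexivity.
  - apply Rbar_locally_p_infty_gt.
  - simpl; intros a b -> Hb x; rewrite Rmin_left, Rmax_right by lra; intros Hx.
    unfold h, fold_PV; rewrite Ropp_involutive.
    pose proof (exp_minus_1_pos x ltac:(lra)) as Hx1.
    replace (/ (exp (- x) - 1)) with (- (1) - / (exp x - 1)).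
    + rewrite RtoC_minus, RtoC_opp.
      change (((RtoC (/ (exp x - 1)) * psi (- x)%R) +
        (- (1) - RtoC (/ (exp x - 1))) * psi x)%C =
        (RtoC (/ (exp x - 1)) * (psi (- x)%R - psi x) - psi x)%C).
      ring.
    + rewrite exp_Ropp; pose proof (exp_pos x); field; lra.
Qed.

Lemma PV_linear (M N : R) (c : C) (f df g dg : R -> C) :
  tame M f -> tame M df -> (forall t, deriv f t (df t)) ->
  tame N g -> tame N dg -> (forall t, deriv g t (dg t)) ->
  PV (fun t => c * f t + g t)%C = (c * PV f + PV g)%C.
Proof.
  intros F F' DF G G' DG; apply is_HInt_unique.
  eapply is_HInt_ext; [|apply is_HInt_plus; [apply is_HInt_scal|];
    eapply dominated_is_HInt, fold_PV_dominated; eassumption].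
  intros x _; unfold fold_PV; ring.
Qed.

(** * The Gamma function *)

Lemma RtoC_neq_0 (x : R) : x <> 0 -> RtoC x <> RtoC 0.
Proof. intros H E; now apply RtoC_inj in E. Qed.

Lemma mellin_by_parts (M : R) (z : C) (f df : R -> C) :
  0 < Re z -> decays M f -> decays M df -> (forall x, 0 < x -> deriv f x (df x)) ->
  is_HInt (fun x => Rcpow x (z - 1) * f x)%C
    (- HInt (fun x => Rcpow x z * df x) / z)%C.
Proof.
  intros Hz Hf Hdf D.
  destruct (weight_Rcpow (z + 1)) as (K & HK & Hw).
  { simpl; unfold Re in *; lra. }
  replace (z + 1 - 1)%C with z in Hw by ring.
  assert (HM : 0 <= M).
  { destruct (Hf 1 Rlt_0_1) as [_ H]; pose proof (Cmod_ge_0 (f 1)).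
    pose proof (exp_pos (- (1) / 2)); nra. }
  assert (I1 : is_HInt (fun x => z * Rcpow x (z - 1) * f x + Rcpow x z * df x)%C (0 - 0)%C).
  { apply is_HInt_primitive with (fun x => Rcpow x z * f x)%C.
    - intros x Hx; apply is_derive_Cmult; [now apply is_derive_Rcpow|now apply D].
    - intros x Hx; apply continuous_Cplus; apply continuous_Cmult;
        try apply continuous_Cscal; try apply continuous_Rcpow; trivial;
        [apply Hf|apply Hdf]; trivial.
    - apply filterlim_Cmod; [typeclasses eauto|]; intros eps Heps.
      (* The radius is [(eps / (M + 1))^(1 / Re z)], below which [x^(Re z)] is less than
         [eps / (M + 1)]. *)
      assert (Hd : 0 < exp (ln (eps / (M + 1)) / Re z)) by apply exp_pos.
      generalize (at_right_0_lt _ Hd); apply filter_imp; intros x [Hx Hxd].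
      replace (Rcpow x z * f x - 0)%C with (Rcpow x z * f x)%C by ring.
      rewrite Cmod_mult, Cmod_Rcpow.
      assert (H1 : Cmod (f x) <= M).
      { destruct (Hf x Hx) as [_ B]; eapply Rle_trans; [exact B|].
        rewrite <- (Rmult_1_r M) at 2; apply Rmult_le_compat_l; [exact HM|].
        rewrite <- exp_0; apply exp_le; lra. }
      apply ln_increasing in Hxd; [|exact Hx]; rewrite ln_exp in Hxd.
      apply (Rmult_lt_compat_l (Re z)) in Hxd; [|exact Hz].
      replace (Re z * (ln (eps / (M + 1)) / Re z)) with (ln (eps / (M + 1))) in Hxd
        by (field; lra).
      apply exp_increasing in Hxd.
      assert (H2 : 0 < eps / (M + 1)) by (apply Rdiv_lt_0_compat; lra).
      rewrite exp_ln in Hxd by exact H2.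
      pose proof (Cmod_ge_0 (f x)).
      apply Rle_lt_trans with (eps / (M + 1) * M).
      + apply Rmult_le_compat; trivial; [left; apply exp_pos|lra].
      + apply Rlt_le_trans with (eps / (M + 1) * (M + 1)); [nra|right; field; lra].
    - apply filterlim_Cmod; [typeclasses eauto|]; intros eps Heps.
      (* Since [x / 4 < exp (x / 4)], the bound [K M exp (- x / 4)] drops below [eps] once
         [x / 4 > K M / eps]. *)
      exists (Rmax 0 (4 * (K * M / eps))); intros x Hx.
      pose proof (Rmax_l 0 (4 * (K * M / eps))); pose proof (Rmax_r 0 (4 * (K * M / eps))).
      replace (Rcpow x z * f x - 0)%C with (Rcpow x z * f x)%C by ring.
      destruct (weight_mult_dominated _ _ _ _ Hw Hf x) as [_ B]; [lra|].
      eapply Rle_lt_trans; [exact B|].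
      replace (- x / 4) with (- (x / 4)) by field; rewrite exp_Ropp.
      pose proof (exp_pos (x / 4)) as Hp.
      apply Rmult_lt_reg_r with (exp (x / 4)); [exact Hp|].
      rewrite Rmult_assoc, Rinv_l, Rmult_1_r by lra.
      pose proof (exp_ge_succ (x / 4)) as Hs.
      apply Rlt_le_trans with (eps * (x / 4)); [|apply Rmult_le_compat_l; lra].
      apply Rle_lt_trans with (eps * (K * M / eps)); [right; field; lra|].
      apply Rmult_lt_compat_l; lra. }
  pose proof (dominated_is_HInt _ _ (weight_mult_dominated _ _ _ _ Hw Hdf)) as I2.
  assert (Hz0 : z <> RtoC 0).
  { intros E; rewrite E in Hz; simpl in Hz; lra. }
  replace (- HInt (fun x => Rcpow x z * df x) / z)%C with
    (/ z * ((0 - 0) - HInt (fun x => Rcpow x z * df x)))%C by (field; exact Hz0).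
  eapply is_HInt_ext; [|apply is_HInt_scal, is_HInt_minus; [exact I1|exact I2]].
  intros x _; simpl; field; exact Hz0.
Qed.

Lemma decays_exp : decays 1 (fun x => RtoC (exp (- x))).
Proof.
  intros x Hx; split.
  - apply continuous_RtoC, (ex_derive_continuous (V := R_NormedModule)).
    auto_derive; trivial.
  - rewrite Cmod_R, Rabs_right, Rmult_1_l by (left; apply exp_pos).
    apply exp_le; lra.
Qed.

(** Convergence of Euler's integral on the whole half plane and the functional equation are both
    read off from this one identity. *)
Lemma Gamma_parts (z : C) : 0 < Re z ->
  is_HInt (fun x => Rcpow x (z - 1) * RtoC (exp (- x)))%C (Gamma (z + 1) / z)%C.
Proof.
  intros Hz.
  assert (D2 : decays 1 (fun x => - (1) * RtoC (exp (- x)))%C).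
  { intros x Hx; destruct (decays_exp x Hx) as [A B]; split.
    - now apply continuous_Cscal.
    - now rewrite Cmod_mult, Cmod_m1, Rmult_1_l. }
  pose proof (mellin_by_parts 1 z _ _ Hz decays_exp D2) as H.
  replace (Gamma (z + 1)) with
    (- HInt (fun x => Rcpow x z * (- (1) * RtoC (exp (- x)))))%C.
  - apply H; intros x Hx.
    replace (- (1) * RtoC (exp (- x)))%C with (RtoC (- exp (- x)))
      by (rewrite RtoC_opp; ring).
    apply is_derive_RtoC; auto_derive; trivial; ring.
  - destruct (weight_Rcpow (z + 1)) as (K & HK & Hw).
    { simpl; unfold Re in *; lra. }
    pose proof (dominated_is_HInt _ _ (weight_mult_dominated _ _ _ _ Hw decays_exp)) as I.
    change (HInt (fun x => Rcpow x (z + 1 - 1) * RtoC (exp (- x))))%C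
      with (Gamma (z + 1)) in I.
    replace (Gamma (z + 1)) with (- (- (1) * Gamma (z + 1)))%C by ring.
    f_equal; apply is_HInt_unique.
    eapply is_HInt_ext; [|apply is_HInt_scal, I].
    intros x _; simpl.
    replace (z + 1 - 1)%C with z by ring; ring.
Qed.

Lemma Re_pos_neq_0 (z : C) : 0 < Re z -> z <> RtoC 0.
Proof. intros Hz E; rewrite E in Hz; simpl in Hz; lra. Qed.

Lemma Gamma_is_HInt (z : C) : 0 < Re z ->
  is_HInt (fun x => Rcpow x (z - 1) * RtoC (exp (- x)))%C (Gamma z).
Proof.
  intros Hz; pose proof (Gamma_parts z Hz) as H.
  now rewrite <- (is_HInt_unique _ _ H) in H.
Qed.

Lemma Gamma_succ (z : C) : 0 < Re z -> Gamma (z + 1) = (z * Gamma z)%C.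
Proof.
  intros Hz; rewrite <- (is_HInt_unique _ _ (Gamma_is_HInt z Hz)).
  rewrite (is_HInt_unique _ _ (Gamma_parts z Hz)).
  field; now apply Re_pos_neq_0.
Qed.

(** * Zeros of the Gamma function *)

Lemma one_minus_cos_le (w : R) : 1 - w ^ 2 / 2 <= cos w.
Proof.
  assert (H : Rabs (sin (w / 2)) <= Rabs (w / 2)).
  { replace (sin (w / 2)) with (sin (w / 2) - sin 0) by (rewrite sin_0; ring).
    replace (Rabs (w / 2)) with (1 * Rabs (w / 2 - 0)) by (rewrite Rminus_0_r; ring).
    apply bounded_variation with cos; intros t _; split.
    - apply is_derive_sin.
    - apply Rabs_le; pose proof (COS_bound t); lra. }
  replace w with (2 * (w / 2)) at 2 by field.
  rewrite cos_2a_sin.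
  apply Rsqr_le_abs_1 in H; unfold Rsqr in H; nra.
Qed.

(** For [u = ln (x / a)] the right-hand side is [x/a - 2 + a/x]. Against [x^(a-1) e^(-x)] it
    integrates to values of Gamma at [a + 1], [a] and [a - 1], which the square of the logarithm
    does not. *)
Lemma sqr_le_sinh (u : R) : u ^ 2 <= exp u - 2 + exp (- u).
Proof.
  (* The inequality [v <= sinh v]; squaring it at [v / 2] gives the claim. *)
  assert (P : forall v, 0 <= v -> 2 * v <= exp v - exp (- v)).
  { intros v Hv.
    destruct (MVT_gen (fun v => exp v - exp (- v) - 2 * v) 0 v
      (fun v => exp v + exp (- v) - 2)) as (c & Hc & E).
    - intros x _; auto_derive; trivial; ring.
    - intros x _; apply continuity_pt_filterlim.
      apply (ex_derive_continuous (V := R_NormedModule)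
        (fun v => exp v - exp (- v) - 2 * v)); auto_derive; trivial.
    - rewrite Ropp_0, exp_0 in E.
      pose proof (exp_ge_succ c); pose proof (exp_ge_succ (- c)); nra. }
  assert (Q : forall v, 0 <= v -> v ^ 2 <= exp v - 2 + exp (- v)).
  { intros v Hv; specialize (P (v / 2) ltac:(lra)).
    replace (exp v) with (exp (v / 2) * exp (v / 2))
      by (rewrite <- exp_plus; f_equal; field).
    replace (exp (- v)) with (exp (- (v / 2)) * exp (- (v / 2)))
      by (rewrite <- exp_plus; f_equal; field).
    assert (E : exp (v / 2) * exp (- (v / 2)) = 1).
    { rewrite <- exp_plus, <- exp_0; f_equal; field. }
    nra. }
  destruct (Rle_dec 0 u) as [H|H]; [now apply Q|].
  specialize (Q (- u) ltac:(lra)); rewrite Ropp_involutive in Q; nra.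
Qed.

Lemma Gamma_real_pos (a : R) : 1 <= a -> 0 < Re (Gamma (RtoC a)).
Proof.
  intros Ha; apply Rlt_le_trans with (exp (- 2)); [apply exp_pos|].
  apply (is_HInt_Re_ge _ _ _) with (3 := Gamma_is_HInt (RtoC a) ltac:(simpl; lra));
    intros x Hx; rewrite <- RtoC_minus, Rcpow_RtoC, <- RtoC_mult; simpl.
  - apply Rmult_le_pos; left; apply exp_pos.
  - assert (0 <= ln x) by (rewrite <- ln_1; apply ln_le; lra).
    rewrite <- (Rmult_1_l (exp (- 2))).
    apply Rmult_le_compat; [lra|left; apply exp_pos| |apply exp_le; lra].
    apply Rle_trans with (exp 0); [rewrite exp_0; lra|apply exp_le]; apply Rmult_le_pos; lra.
Qed.

(* The mass of [x^(a-1) e^(-x)] concentrates near [x = a], where the phase of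
   [x^(i y)] is that of [a^(i y)]. *)
Lemma Gamma_neq_0_large (a y : R) : 2 <= a -> y ^ 2 < a - 1 -> Gamma (a, y) <> RtoC 0.
Proof.
  intros Ha Hy E.
  set (z := ((a, y) : C)) in *.
  (* [b (x - 2a + a^2/x)] is [(y^2/2) (x/a - 2 + a/x)], a bound for [(y ln (x/a))^2 / 2]. The factor
     [c = a^(-iy)] turns the phase of [x^(iy)] into that of [(x/a)^(iy)]. *)
  set (b := y ^ 2 / (2 * a)).
  set (c := Rcpow a (0, - y)).
  assert (Iz := Gamma_is_HInt z ltac:(unfold z; simpl; lra)); rewrite E in Iz.
  assert (Ia := Gamma_is_HInt (RtoC a) ltac:(simpl; lra)).
  assert (Ia1 := Gamma_is_HInt (RtoC (a + 1)) ltac:(simpl; lra)).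
  assert (Ib := Gamma_is_HInt (RtoC (a - 1)) ltac:(simpl; lra)).
  assert (E1 : Gamma (RtoC (a + 1)) = (RtoC a * Gamma (RtoC a))%C).
  { rewrite RtoC_plus; apply Gamma_succ; simpl; lra. }
  assert (E2 : Gamma (RtoC a) = (RtoC (a - 1) * Gamma (RtoC (a - 1)))%C).
  { replace a with ((a - 1) + 1) at 1 by ring.
    rewrite RtoC_plus; apply Gamma_succ; simpl; lra. }
  assert (E3 : Gamma (RtoC (a - 1)) = (RtoC (/ (a - 1)) * Gamma (RtoC a))%C).
  { rewrite E2, Cmult_assoc, <- RtoC_mult, Rinv_l, Cmult_1_l by lra; reflexivity. }
  pose proof (is_HInt_scal c _ _ Iz) as J1.
  pose proof (is_HInt_plus _ _ _ _ (is_HInt_minus _ _ _ _ Ia1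
    (is_HInt_scal (RtoC (2 * a)) _ _ Ia)) (is_HInt_scal (RtoC (a ^ 2)) _ _ Ib)) as J2.
  pose proof (is_HInt_plus _ _ _ _ (is_HInt_minus _ _ _ _ J1 Ia)
    (is_HInt_scal (RtoC b) _ _ J2)) as J.
  (* Pointwise this is [cos (y u) >= 1 - (y u)^2 / 2] combined with [sqr_le_sinh] at
     [u = ln (x / a)], times the positive factor [x^(a-1) e^(-x)]. *)
  assert (G : forall x, 0 < x ->
      0 <= Re (c * (Rcpow x (z - 1) * RtoC (exp (- x))) -
        Rcpow x (RtoC a - 1) * RtoC (exp (- x)) +
        RtoC b * (Rcpow x (RtoC (a + 1) - 1) * RtoC (exp (- x)) -
          RtoC (2 * a) * (Rcpow x (RtoC a - 1) * RtoC (exp (- x))) +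
          RtoC (a ^ 2) * (Rcpow x (RtoC (a - 1) - 1) * RtoC (exp (- x)))))%C).
  {intros x Hx.
    set (A := exp ((a - 1) * ln x)).
    set (u := ln x - ln a).
    assert (Hc : (c * Rcpow x (z - 1))%C = (RtoC A * (cos (y * u), sin (y * u)))%C).
    { unfold c, A, Rcpow; rewrite <- Cexp_plus, <- Cexp_RtoC.
      replace ((cos (y * u), sin (y * u)) : C) with (Cexp (0, y * u)).
      - rewrite <- Cexp_plus; f_equal.
        unfold z, u, Cplus, Cminus, Copp, Cmult, RtoC; simpl; f_equal; ring.
      - unfold Cexp; simpl; rewrite exp_0; apply Cmult_1_l. }
    rewrite Cmult_assoc, Hc, <- !RtoC_minus, !Rcpow_RtoC.
    replace (exp ((a + 1 - 1) * ln x)) with (A * x).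
    2:{ unfold A; rewrite <- (exp_ln x) at 2 by trivial.
        rewrite <- exp_plus; f_equal; ring. }
    replace (exp ((a - 1 - 1) * ln x)) with (A * / x).
    2:{ unfold A; rewrite <- (exp_ln x) at 2 by trivial.
        rewrite <- exp_Ropp, <- exp_plus; f_equal; ring. }
    fold A; simpl.
    match goal with |- 0 <= ?g => replace g with
      (A * exp (- x) * (cos (y * u) - 1 + b * (x - 2 * a + a ^ 2 * / x))) by ring end.
    apply Rmult_le_pos; [apply Rmult_le_pos; left; apply exp_pos|].
    pose proof (one_minus_cos_le (y * u)) as H1.
    pose proof (sqr_le_sinh u) as H2.
    rewrite exp_Ropp in H2; unfold u in H2 at 2 3.
    replace (ln x - ln a) with (ln (x / a)) in H2 by (apply ln_div; lra).
    rewrite exp_ln in H2 by (apply Rdiv_lt_0_compat; lra).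
    assert (H3 : y ^ 2 / 2 * u ^ 2 <= y ^ 2 / 2 * (x / a - 2 + / (x / a))).
    { apply Rmult_le_compat_l; [pose proof (pow2_ge_0 y); lra|exact H2]. }
    replace (y ^ 2 / 2 * (x / a - 2 + / (x / a))) with
      (b * (x - 2 * a + a ^ 2 * / x)) in H3 by (unfold b; field; lra).
    replace ((y * u) ^ 2 / 2) with (y ^ 2 / 2 * u ^ 2) in H1 by field.
    lra. }
  apply (is_HInt_Re_ge _ _ 0) in J; [|intros x Hx; apply G; lra..].
  rewrite E3, E1 in J.
    replace (c * 0 - Gamma (RtoC a) + RtoC b * (RtoC a * Gamma (RtoC a) -
      RtoC (2 * a) * Gamma (RtoC a) + RtoC (a ^ 2) *
        (RtoC (/ (a - 1)) * Gamma (RtoC a))))%C with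
      (RtoC (- 1 + b * (a - 2 * a + a ^ 2 * / (a - 1))) * Gamma (RtoC a))%C in J.
    (* As [a - 2a + a^2/(a-1) = a/(a-1)], the integrated inequality says that
       [(y^2 / (2(a-1)) - 1) Gamma(a)] is nonnegative, contrary to [y^2 < a - 1]. *)
    + replace (- 1 + b * (a - 2 * a + a ^ 2 * / (a - 1))) with
        (- 1 + y ^ 2 / (2 * (a - 1))) in J by (unfold b; field; lra).
      pose proof (Gamma_real_pos a ltac:(lra)) as HG.
      assert (y ^ 2 / (2 * (a - 1)) < 1).
      { apply Rmult_lt_reg_r with (2 * (a - 1)); [lra|].
        unfold Rdiv; rewrite Rmult_assoc, Rinv_l by lra; lra. }
      replace (Re (RtoC (- 1 + y ^ 2 / (2 * (a - 1))) * Gamma (RtoC a))%C) with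
        ((- 1 + y ^ 2 / (2 * (a - 1))) * Re (Gamma (RtoC a))) in J
        by (simpl; unfold Re; ring).
      nra.
    + rewrite RtoC_plus, (RtoC_mult b), RtoC_plus, RtoC_minus, (RtoC_mult (a ^ 2)).
      change (- 1) with (- (1)); rewrite RtoC_opp; ring.
Qed.

(** * The distributions gamma_+ and li *)

Lemma RtoC_INR_S (n : nat) : RtoC (INR (S n)) = (RtoC (INR n) + 1)%C.
Proof. now rewrite S_INR, RtoC_plus. Qed.

Lemma Re_shift (z : C) (r : R) : Re (z + RtoC r)%C = Re z + r.
Proof. reflexivity. Qed.

Lemma Gamma_neq_0_shift (n : nat) (z : C) : 0 < Re z ->
  Gamma (z + RtoC (INR n)) <> RtoC 0 -> Gamma z <> RtoC 0.
Proof.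
  revert z; induction n as [|n IH]; intros z Hz H.
  - replace (z + RtoC (INR 0))%C with z in H by (simpl; ring); exact H.
  - rewrite RtoC_INR_S in H.
    replace (z + (RtoC (INR n) + 1))%C with ((z + 1) + RtoC (INR n))%C in H by ring.
    apply IH in H; [|rewrite Re_shift; lra].
    rewrite Gamma_succ in H by exact Hz.
    intros E; apply H; rewrite E; ring.
Qed.

Lemma Gamma_neq_0 (z : C) : 0 < Re z -> Gamma z <> RtoC 0.
Proof.
  intros Hz; destruct z as [a y].
  (* With [n + 1 > y^2 + 2], translation by [n + 1] brings the real part above both 2 and [y^2 + 1],
     as [Gamma_neq_0_large] asks. *)
  destruct (nfloor_ex (y ^ 2 + 2)) as [n [_ Hn]]; [pose proof (pow2_ge_0 y); lra|].
  simpl in Hz; apply (Gamma_neq_0_shift (S n)); [exact Hz|].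
  replace ((a, y) + RtoC (INR (S n)))%C with ((a + INR (S n), y) : C)
    by (unfold Cplus, RtoC; simpl fst; simpl snd; f_equal; ring).
  rewrite S_INR; pose proof (pow2_ge_0 y).
  apply Gamma_neq_0_large; lra.
Qed.

(** A function travels together with all its derivatives as an explicit sequence, so that [Derive_n]
    has to be met only when the definitions of the statement are matched. *)
Definition tower (F : nat -> R -> C) : Prop :=
  forall n x, deriv (F n) x (F (S n) x).

Lemma smooth_tower (f : R -> C) : smooth f -> tower (CDerive_n f).
Proof.
  intros H n x; destruct (H (S n) x) as [H1 H2].
  apply is_derive_C; simpl; now apply Derive_correct.
Qed.

Lemma tower_Derive_n (F : nat -> R -> C) : tower F -> forall n x,
  Derive_n (fun y => Re (F O y)) n x = Re (F n x) /\
  Derive_n (fun y => Im (F O y)) n x = Im (F n x).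
Proof.
  intros H; induction n as [|n IH]; intros x; [now split|]; simpl; split.
  - rewrite (Derive_ext _ (fun y => Re (F n y))) by (intros; apply IH).
    apply is_derive_unique, is_derive_Re, H.
  - rewrite (Derive_ext _ (fun y => Im (F n y))) by (intros; apply IH).
    apply is_derive_unique, is_derive_Im, H.
Qed.

Lemma tower_CDerive_n (F : nat -> R -> C) (n : nat) (x : R) :
  tower F -> CDerive_n (F O) n x = F n x.
Proof.
  intros H; unfold CDerive_n; destruct (tower_Derive_n F H n x) as [-> ->].
  symmetry; apply surjective_pairing.
Qed.

Lemma tower_smooth (F : nat -> R -> C) : tower F -> smooth (F O).
Proof.
  intros H [|n] x; simpl; [now split|]; split.
  - apply (ex_derive_ext (V := R_NormedModule) (fun y => Re (F n y))).
    { intros t; symmetry; now apply tower_Derive_n. }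
    exists (Re (F (S n) x)); apply is_derive_Re, H.
  - apply (ex_derive_ext (V := R_NormedModule) (fun y => Im (F n y))).
    { intros t; symmetry; now apply tower_Derive_n. }
    exists (Im (F (S n) x)); apply is_derive_Im, H.
Qed.

Definition tame_tower (F : nat -> R -> C) : Prop :=
  tower F /\ forall n, exists M, tame M (F n).

Lemma tame_le (M N : R) (g : R -> C) : M <= N -> tame M g -> tame N g.
Proof.
  intros HMN H y; destruct (H y) as [A B]; split; [exact A|].
  eapply Rle_trans; [exact B|].
  apply Rmult_le_compat_r; [left; apply exp_pos|exact HMN].
Qed.

Lemma tame_tower_common (F : nat -> R -> C) (n : nat) : tame_tower F ->
  exists M, 0 <= M /\ tame M (F n) /\ tame M (F (S n)) /\ tame M (F (S (S n))).
Proof.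
  intros [_ H].
  destruct (H n) as [A HA], (H (S n)) as [B HB], (H (S (S n))) as [D HD].
  exists (Rmax 0 (Rmax A (Rmax B D))).
  pose proof (Rmax_l A (Rmax B D)); pose proof (Rmax_r A (Rmax B D)).
  pose proof (Rmax_l B D); pose proof (Rmax_r B D).
  pose proof (Rmax_l 0 (Rmax A (Rmax B D))); pose proof (Rmax_r 0 (Rmax A (Rmax B D))).
  split; [lra|split; [|split]].
  - apply tame_le with A; [lra|exact HA].
  - apply tame_le with B; [lra|exact HB].
  - apply tame_le with D; [lra|exact HD].
Qed.

Definition gamma_plus (k : nat) (s : C) (F : nat -> R -> C) (t : R) : C :=
  (Cpow (- (1)) k / Gamma (s + INR k) *
    conv (fun x => Rcpow x (s + INR k - 1)) (F k) t)%C.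

(** One step from order [k] to order [k + 1]. It also yields convergence when [0 < Re s + k < 1], a
    case that [is_gamma_plus] includes. *)
Lemma is_HInt_gamma_plus (k : nat) (s : C) (F : nat -> R -> C) (t : R) :
  tame_tower F -> - INR k < Re s ->
  is_HInt (fun x => Rcpow x (s + INR k - 1) * F k (x + t)%R)%C
    (- conv (fun x => Rcpow x (s + INR (S k) - 1)) (F (S k)) t / (s + INR k))%C.
Proof.
  intros HF Hk; destruct (tame_tower_common F k HF) as (M & HM & T0 & T1 & _).
  replace (s + INR (S k) - 1)%C with (s + INR k)%C by (rewrite RtoC_INR_S; ring).
  apply (mellin_by_parts (M * exp (- t / 2))).
  - rewrite Re_shift; lra.
  - now apply tame_decays.
  - now apply tame_decays.
  - intros x _; apply is_derive_shift, HF.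
Qed.

(** The sign from integration by parts is absorbed by [(-1)^(k+1)], and the factor [1 / (s + k)] by
    the functional equation of Gamma. *)
Lemma gamma_plus_S (k : nat) (s : C) (F : nat -> R -> C) (t : R) :
  tame_tower F -> - INR k < Re s -> gamma_plus (S k) s F t = gamma_plus k s F t.
Proof.
  intros HF Hk; unfold gamma_plus at 2, conv.
  rewrite (is_HInt_unique _ _ (is_HInt_gamma_plus k s F t HF Hk)).
  unfold gamma_plus.
  replace (s + INR (S k))%C with (s + INR k + 1)%C by (rewrite RtoC_INR_S; ring).
  assert (Hz : 0 < Re (s + INR k)%C) by (rewrite Re_shift; lra).
  rewrite Gamma_succ by exact Hz; rewrite Cpow_S.
  field; split; [now apply Re_pos_neq_0|now apply Gamma_neq_0].
Qed.

Lemma gamma_plus_indep (k l : nat) (s : C) (F : nat -> R -> C) (t : R) :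
  tame_tower F -> - INR k < Re s -> - INR l < Re s ->
  gamma_plus k s F t = gamma_plus l s F t.
Proof.
  intros HF.
  assert (P : forall m n, - INR m < Re s ->
    gamma_plus (n + m) s F t = gamma_plus m s F t).
  { intros m n Hm; induction n as [|n IH]; [reflexivity|].
    rewrite <- IH; apply gamma_plus_S; [exact HF|].
    rewrite plus_INR; pose proof (pos_INR n); lra. }
  intros Hk Hl; destruct (Nat.le_ge_cases k l) as [H|H].
  - replace l with ((l - k) + k)%nat by lia; symmetry; now apply P.
  - replace k with ((k - l) + l)%nat by lia; now apply P.
Qed.

Lemma gamma_plus_correct (k : nat) (s : C) (F : nat -> R -> C) (t : R) :
  tame_tower F -> - INR k < Re s ->
  is_gamma_plus s (fun x => F O (x + t)) (gamma_plus k s F t).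
Proof.
  intros HF Hk l Hl; exists (conv (fun x => Rcpow x (s + INR l - 1)%C) (F l) t); split.
  - pose proof (is_HInt_gamma_plus l s F t HF Hl) as H.
    unfold conv; rewrite (is_HInt_unique _ _ H).
    eapply is_HInt_ext; [|exact H]; intros x _; simpl; f_equal.
    assert (HT : tower (fun n x => F n (x + t))).
    { intros n y; apply is_derive_shift, HF. }
    symmetry; exact (tower_CDerive_n _ l x HT).
  - now apply gamma_plus_indep.
Qed.

Definition shift_tower (F : nat -> R -> C) (n : nat) : R -> C := F (S n).

Lemma tame_tower_shift (F : nat -> R -> C) : tame_tower F -> tame_tower (shift_tower F).
Proof. intros [H T]; split; intros n; unfold shift_tower; [intros x; apply H|apply T]. Qed.

Lemma is_derive_gamma_plus (k : nat) (s : C) (F : nat -> R -> C) (t : R) :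
  tame_tower F -> 1 <= Re s + INR k ->
  deriv (gamma_plus k s F) t (gamma_plus k s (shift_tower F) t).
Proof.
  intros HF Hk; destruct (tame_tower_common F k HF) as (M & HM & T0 & T1 & T2).
  destruct (weight_Rcpow (s + INR k)) as (K & HK & Hw); [exact Hk|].
  apply is_derive_Cscal.
  eapply is_derive_conv; try eassumption; apply HF.
Qed.

Lemma gamma_plus_tame (k : nat) (s : C) : 1 <= Re s + INR k ->
  exists A, 0 <= A /\ forall F M, tame_tower F -> tame M (F k) ->
    tame (A * M) (gamma_plus k s F).
Proof.
  intros Hk; destruct (weight_Rcpow (s + INR k)) as (K & HK & Hw); [exact Hk|].
  exists (Cmod (Cpow (- (1)) k / Gamma (s + INR k)) * (4 * K)); split.
  - apply Rmult_le_pos; [apply Cmod_ge_0|lra].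
  - intros F M HF T y; split.
    + exact (deriv_cont _ _ _ (is_derive_gamma_plus k s F y HF Hk)).
    + unfold gamma_plus; rewrite Cmod_mult, !Rmult_assoc.
      apply Rmult_le_compat_l; [apply Cmod_ge_0|].
      eapply Rle_trans; [exact (conv_bound K M y _ _ Hw T)|right; ring].
Qed.

Lemma gamma_plus_PV_conditions (k : nat) (s : C) (F : nat -> R -> C) :
  tame_tower F -> 1 <= Re s + INR k ->
  exists M, tame M (gamma_plus k s F) /\ tame M (gamma_plus k s (shift_tower F)) /\
    forall t, deriv (gamma_plus k s F) t (gamma_plus k s (shift_tower F) t).
Proof.
  intros HF Hk; destruct (tame_tower_common F k HF) as (M & HM & T0 & T1 & _).
  destruct (gamma_plus_tame k s Hk) as (A & HA & H).
  exists (A * M); split; [|split].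
  - now apply H.
  - apply H; [now apply tame_tower_shift|exact T1].
  - intros; now apply is_derive_gamma_plus.
Qed.

(** The margin 2 leaves room for the logarithm in the derivative with respect to [s], and keeps the
    order admissible on the disc of radius 1 around [s]. *)
Definition li_order (s : C) : nat := Z.to_nat (up (2 - Re s)).

Lemma li_order_spec (s : C) : 2 < Re s + INR (li_order s).
Proof.
  unfold li_order; destruct (archimed (2 - Re s)) as [H _].
  destruct (Z.le_gt_cases 0 (up (2 - Re s))) as [H0|H0].
  - rewrite INR_IZR_INZ, Z2Nat.id by exact H0; lra.
  - assert (IZR (up (2 - Re s)) < 0) by (apply (IZR_lt _ 0); lia).
    pose proof (pos_INR (Z.to_nat (up (2 - Re s)))); lra.
Qed.

Definition li (s : C) (F : nat -> R -> C) : C := PV (gamma_plus (li_order s) s F).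

Lemma li_correct (s : C) (F : nat -> R -> C) :
  tame_tower F -> schwartz (F O) -> is_li s (F O) (li s F).
Proof.
  intros HF HS; split; [exact HS|].
  pose proof (li_order_spec s) as Hk.
  destruct (gamma_plus_PV_conditions (li_order s) s F HF) as (M & T & T' & D); [lra|].
  destruct (PV_limit M _ _ T T' D) as (J & HJ & HL).
  exists (gamma_plus (li_order s) s F), J; split; [|split].
  - intros t; apply gamma_plus_correct; [exact HF|lra].
  - exact HJ.
  - exact HL.
Qed.

Lemma PV_ext (M : R) (f df g : R -> C) :
  tame M f -> tame M df -> (forall t, deriv f t (df t)) ->
  (forall t, f t = g t) -> PV g = PV f.
Proof.
  intros T T' D E; apply is_HInt_unique.
  eapply is_HInt_ext; [|eapply dominated_is_HInt, fold_PV_dominated; eassumption].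
  intros x _; unfold fold_PV; now rewrite !E.
Qed.

(** [li_order] jumps as [s] varies; holomorphy can be seen only with the order frozen near a
    point. *)
Lemma li_indep (s : C) (k : nat) (F : nat -> R -> C) :
  tame_tower F -> 1 <= Re s + INR k -> li s F = PV (gamma_plus k s F).
Proof.
  intros HF Hk; pose proof (li_order_spec s) as Ho.
  destruct (gamma_plus_PV_conditions k s F HF Hk) as (M & T & T' & D).
  apply (PV_ext M _ _ _ T T' D); intros t.
  apply gamma_plus_indep; [exact HF|lra|lra].
Qed.

Lemma conv_linear_r (K M N t : R) (c : C) (w f g : R -> C) :
  weight K w -> tame M f -> tame N g ->
  conv w (fun x => c * f x + g x)%C t = (c * conv w f t + conv w g t)%C.
Proof.
  intros Hw Hf Hg; apply is_HInt_unique.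
  eapply is_HInt_ext; [|apply is_HInt_plus; [apply is_HInt_scal|]; eapply conv_is_HInt; eassumption].
  intros x _; simpl; ring.
Qed.

Lemma tame_linear (M N : R) (c : C) (f g : R -> C) :
  tame M f -> tame N g -> tame (Cmod c * M + N) (fun x => c * f x + g x)%C.
Proof.
  intros Hf Hg x; destruct (Hf x) as [Cf Bf], (Hg x) as [Cg Bg]; split.
  - apply continuous_Cplus; [now apply continuous_Cscal|exact Cg].
  - eapply Rle_trans; [apply Cmod_triangle|]; rewrite Cmod_mult.
    pose proof (Rmult_le_compat_l _ _ _ (Cmod_ge_0 c) Bf); lra.
Qed.

Lemma tame_tower_linear (c : C) (F G : nat -> R -> C) :
  tame_tower F -> tame_tower G -> tame_tower (fun n x => c * F n x + G n x)%C.
Proof.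
  intros [HF TF] [HG TG]; split.
  - intros n x; apply is_derive_Cplus; [apply is_derive_Cscal, HF|apply HG].
  - intros n; destruct (TF n) as [M HM], (TG n) as [N HN].
    exists (Cmod c * M + N); now apply tame_linear.
Qed.

Lemma li_linear (s c : C) (F G : nat -> R -> C) :
  tame_tower F -> tame_tower G ->
  li s (fun n x => c * F n x + G n x)%C = (c * li s F + li s G)%C.
Proof.
  intros HF HG; pose proof (li_order_spec s) as Hk; unfold li.
  destruct (gamma_plus_PV_conditions (li_order s) s F HF ltac:(lra)) as (M & T1 & T2 & D).
  destruct (gamma_plus_PV_conditions (li_order s) s G HG ltac:(lra)) as (N & S1 & S2 & E).
  rewrite <- (PV_linear M N c _ _ _ _ T1 T2 D S1 S2 E).
  destruct (gamma_plus_PV_conditions (li_order s) s _ (tame_tower_linear c F G HF HG)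
    ltac:(lra)) as (L & U1 & U2 & H).
  symmetry; apply (PV_ext L _ _ _ U1 U2 H); intros t; unfold gamma_plus.
  destruct (weight_Rcpow (s + INR (li_order s))) as (K & HK & Hw);
    [rewrite Re_shift; lra|].
  destruct (proj2 HF (li_order s)) as [A HA], (proj2 HG (li_order s)) as [B HB].
  rewrite (conv_linear_r _ _ _ _ _ _ _ _ Hw HA HB); ring.
Qed.

(** Two consecutive derivatives enter because the principal value is controlled by [psi] together
    with its derivative. That [A] precedes [F] is what makes this a continuity estimate. *)
Lemma li_bound (s : C) : exists A, 0 <= A /\ forall F M, tame_tower F ->
  tame M (F (li_order s)) -> tame M (F (S (li_order s))) -> Cmod (li s F) <= A * M.
Proof.
  pose proof (li_order_spec s) as Hk.
  destruct (gamma_plus_tame (li_order s) s) as (A & HA & H); [lra|].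
  exists (36 * A); split; [lra|]; intros F M HF T0 T1.
  rewrite Rmult_assoc; apply PV_bound with (gamma_plus (li_order s) s (shift_tower F)).
  - now apply H.
  - apply H; [now apply tame_tower_shift|exact T1].
  - intros t; apply is_derive_gamma_plus; [exact HF|lra].
Qed.

(** * Holomorphy in the parameter *)

(* Differentiability with a quadratic remainder: this form survives dominated
   integration in a parameter without any limit interchange. *)
Definition qdiff (f : C -> C) (z : C) : Prop :=
  exists (D : C) (M r : R), 0 < r /\ 0 <= M /\
    forall h, Cmod h < r -> Cmod (f (z + h) - f z - h * D)%C <= M * Cmod h ^ 2.

Lemma qdiff_ex_derive (f : C -> C) (z : C) :
  qdiff f z -> ex_derive (K := C_AbsRing) (V := C_NormedModule) f z.
Proof.
  intros (D & M & r & Hr & _ & H); exists D.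
  apply (is_derive_quadratic (V := C_NormedModule) f z D M r Hr).
  intros y Hy; specialize (H (y - z)%C Hy).
  assert (E : forall a b : C, (a + (b - a))%C = b) by (intros; ring).
  now rewrite E in H.
Qed.

Lemma qdiff_ext (f g : C -> C) (z : C) (r : R) : 0 < r ->
  (forall h, Cmod h < r -> f (z + h)%C = g (z + h)%C) -> qdiff f z -> qdiff g z.
Proof.
  intros Hr E (D & M & r' & Hr' & HM & H).
  exists D, M, (Rmin r r'); split; [now apply Rmin_pos|split; [exact HM|]].
  intros h Hh; pose proof (Rmin_l r r'); pose proof (Rmin_r r r').
  rewrite <- E by lra.
  assert (E0 : f z = g z).
  { specialize (E (RtoC 0)); replace (z + 0)%C with z in E by ring.
    apply E; rewrite Cmod_0; exact Hr. }
  rewrite <- E0; apply H; lra.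
Qed.

Lemma qdiff_mult (f g : C -> C) (z : C) :
  qdiff f z -> qdiff g z -> qdiff (fun z => f z * g z)%C z.
Proof.
  intros (D & M & r & Hr & HM & H) (E & N & q & Hq & HN & G).
  set (B := Cmod (g z) + Cmod E + N).
  exists (D * g z + f z * E)%C, (Cmod D * Cmod E + M * B + N * (Cmod (f z) + Cmod D)),
    (Rmin 1 (Rmin r q)).
  pose proof (Cmod_ge_0 D); pose proof (Cmod_ge_0 E); pose proof (Cmod_ge_0 (f z));
    pose proof (Cmod_ge_0 (g z)).
  assert (HB : 0 <= B) by (unfold B; lra).
  split; [repeat apply Rmin_pos; lra|split].
  { repeat apply Rplus_le_le_0_compat; apply Rmult_le_pos; lra. }
  intros h Hh; pose proof (Rmin_l 1 (Rmin r q)); pose proof (Rmin_r 1 (Rmin r q)).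
  pose proof (Rmin_l r q); pose proof (Rmin_r r q).
  specialize (H h ltac:(lra)); specialize (G h ltac:(lra)).
  pose proof (Cmod_ge_0 h) as Hh0.
  set (R1 := (f (z + h) - f z - h * D)%C) in *.
  set (R2 := (g (z + h) - g z - h * E)%C) in *.
  assert (Hg : Cmod (g (z + h)%C) <= B).
  { replace (g (z + h)%C) with (g z + h * E + R2)%C by (unfold R2; ring).
    eapply Rle_trans; [apply Cmod_triangle|].
    eapply Rle_trans; [apply Rplus_le_compat_r, Cmod_triangle|].
    assert (Cmod h * Cmod E <= 1 * Cmod E) by (apply Rmult_le_compat_r; lra).
    assert (N * Cmod h ^ 2 <= N * 1) by (apply Rmult_le_compat_l; nra).
    rewrite Cmod_mult; unfold B; lra. }
  replace (f (z + h) * g (z + h) - f z * g z - h * (D * g z + f z * E))%C with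
    (h * h * D * E + R1 * g (z + h) + R2 * (f z + h * D))%C by (unfold R1, R2; ring).
  eapply Rle_trans; [apply Cmod_triangle|].
  eapply Rle_trans; [apply Rplus_le_compat_r, Cmod_triangle|].
  rewrite !Cmod_mult, !Rmult_plus_distr_r.
  apply Rplus_le_compat; [apply Rplus_le_compat|].
  - right; ring.
  - replace (M * B * Cmod h ^ 2) with (M * Cmod h ^ 2 * B) by ring.
    apply Rmult_le_compat; trivial; apply Cmod_ge_0.
  - replace (N * (Cmod (f z) + Cmod D) * Cmod h ^ 2) with
      (N * Cmod h ^ 2 * (Cmod (f z) + Cmod D)) by ring.
    apply Rmult_le_compat; trivial; try apply Cmod_ge_0.
    eapply Rle_trans; [apply Cmod_triangle|]; rewrite Cmod_mult; nra.
Qed.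

Lemma qdiff_inv (g : C -> C) (z : C) :
  g z <> RtoC 0 -> qdiff g z -> qdiff (fun z => / g z)%C z.
Proof.
  intros Hg0 (E & N & q & Hq & HN & G).
  assert (Hm : 0 < Cmod (g z)) by now apply Cmod_gt_0.
  set (m := Cmod (g z)) in *.
  pose proof (Cmod_ge_0 E) as HE.
  (* The last bound forces [|h| (|E| + N + 1) <= m / 2], so that [|g (z + h)|] stays above
     [m / 2]. *)
  set (r := Rmin (Rmin 1 q) (m / (2 * (Cmod E + N + 1)))).
  assert (Hr : 0 < r).
  { repeat apply Rmin_pos; try lra; apply Rdiv_lt_0_compat; lra. }
  set (A := m * N + Cmod E ^ 2 + Cmod E * N).
  assert (HA : 0 <= A).
  { unfold A; pose proof (pow2_ge_0 (Cmod E)).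
    repeat apply Rplus_le_le_0_compat; trivial; apply Rmult_le_pos; lra. }
  exists (- E / (g z * g z))%C, (A / (m * m * (m / 2))), r.
  split; [exact Hr|split].
  { apply Rmult_le_pos; [exact HA|]; left; apply Rinv_0_lt_compat.
    repeat apply Rmult_lt_0_compat; lra. }
  intros h Hh.
  assert (Hh1 : Cmod h < 1 /\ Cmod h < q /\ Cmod h < m / (2 * (Cmod E + N + 1))).
  { revert Hh; unfold r; intros Hh.
    pose proof (Rmin_l (Rmin 1 q) (m / (2 * (Cmod E + N + 1)))).
    pose proof (Rmin_r (Rmin 1 q) (m / (2 * (Cmod E + N + 1)))).
    pose proof (Rmin_l 1 q); pose proof (Rmin_r 1 q); lra. }
  destruct Hh1 as (Hh1 & Hh2 & Hh3).
  specialize (G h Hh2); pose proof (Cmod_ge_0 h) as Hh0.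
  set (R2 := (g (z + h) - g z - h * E)%C) in *.
  assert (HG : m / 2 <= Cmod (g (z + h)%C)).
  { assert (H1 : Cmod (h * E + R2)%C <= m / 2).
    { eapply Rle_trans; [apply Cmod_triangle|]; rewrite Cmod_mult.
      assert (N * Cmod h ^ 2 <= N * Cmod h) by (apply Rmult_le_compat_l; nra).
      apply Rle_trans with (Cmod h * (Cmod E + N + 1)); [lra|].
      apply Rle_trans with (m / (2 * (Cmod E + N + 1)) * (Cmod E + N + 1)).
      - apply Rmult_le_compat_r; lra.
      - right; field; lra. }
    assert (H2 : m <= Cmod (g (z + h)%C) + Cmod (h * E + R2)%C).
    { unfold m; replace (g z) with (g (z + h) + - (h * E + R2))%C
        by (unfold R2; ring).
      eapply Rle_trans; [apply Cmod_triangle|]; rewrite Cmod_opp; lra. }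
    lra. }
  assert (HG0 : g (z + h)%C <> RtoC 0).
  { intros E0; rewrite E0, Cmod_0 in HG; lra. }
  (* Every term of the new numerator is of second order in [h]; [A] collects their coefficients. *)
  replace (/ g (z + h) - / g z - h * (- E / (g z * g z)))%C with
    ((h * h * E * E + h * E * R2 - g z * R2) / (g z * g z * g (z + h)))%C.
  2:{ replace R2 with (g (z + h) - g z - h * E)%C by reflexivity; field; now split. }
  rewrite Cmod_div.
  2:{ repeat apply Cmult_neq_0; trivial. }
  rewrite !Cmod_mult; fold m.
  unfold Rdiv; rewrite (Rmult_assoc A), (Rmult_comm (/ _) (Cmod h ^ 2)), <- Rmult_assoc.
  apply Rmult_le_compat; [apply Cmod_ge_0| | |].
  - left; apply Rinv_0_lt_compat; repeat apply Rmult_lt_0_compat; lra.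
  - unfold Cminus; eapply Rle_trans; [apply Cmod_triangle|].
    rewrite Cmod_opp.
    eapply Rle_trans; [apply Rplus_le_compat_r, Cmod_triangle|].
    rewrite !Cmod_mult; fold m.
    assert (H1 : Cmod h * Cmod E * Cmod R2 <= Cmod E * N * Cmod h ^ 2).
    { apply Rle_trans with (1 * Cmod E * (N * Cmod h ^ 2)); [|right; ring].
      apply Rmult_le_compat; [apply Rmult_le_pos; lra|apply Cmod_ge_0| |exact G].
      apply Rmult_le_compat_r; lra. }
    assert (H2 : m * Cmod R2 <= m * (N * Cmod h ^ 2)) by (apply Rmult_le_compat_l; lra).
    unfold A; lra.
  - apply Rinv_le_contravar; [repeat apply Rmult_lt_0_compat; lra|].
    apply Rmult_le_compat_l; [apply Rmult_le_pos; lra|exact HG].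
Qed.

Lemma qdiff_Gamma (z : C) : 2 <= Re z -> qdiff Gamma z.
Proof.
  intros Hz; destruct (weight_Rcpow_taylor z Hz) as (K & HK & H).
  destruct (weight_log_Rcpow z Hz) as (L & HL & Hlog).
  pose proof (dominated_is_HInt _ _ (weight_mult_dominated _ _ _ _ Hlog decays_exp)) as I.
  exists (HInt (fun x => RtoC (ln x) * Rcpow x (z - 1) * RtoC (exp (- x)))%C),
    (4 * K), (1 / 2); split; [lra|split; [lra|]].
  intros h Hh; specialize (H h ltac:(lra)).
  assert (Hzh : 0 < Re (z + h)%C).
  { change (0 < Re z + Re h); pose proof (re_le_Cmod h) as B.
    apply Rabs_le_between in B; lra. }
  pose proof (weight_mult_dominated _ _ _ _ H decays_exp) as Hd.
  replace (Gamma (z + h) - Gamma z -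
    h * HInt (fun x => RtoC (ln x) * Rcpow x (z - 1) * RtoC (exp (- x))))%C with
    (HInt (fun x => (Rcpow x (z + h - 1) - Rcpow x (z - 1) -
      h * (RtoC (ln x) * Rcpow x (z - 1))) * RtoC (exp (- x))))%C.
  - eapply Rle_trans; [exact (dominated_bound _ _ Hd)|right; ring].
  - apply is_HInt_unique.
    eapply is_HInt_ext; [|apply is_HInt_minus; [apply is_HInt_minus|apply is_HInt_scal, I];
      apply Gamma_is_HInt; [exact Hzh|lra]].
    intros x _; simpl; ring.
Qed.

Lemma conv_combination (K1 K2 K3 M t : R) (h : C) (w1 w2 w3 g : R -> C) :
  weight K1 w1 -> weight K2 w2 -> weight K3 w3 -> tame M g ->
  conv (fun x => w1 x - w2 x - h * w3 x)%C g t =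
    (conv w1 g t - conv w2 g t - h * conv w3 g t)%C.
Proof.
  intros H1 H2 H3 Hg; apply is_HInt_unique.
  eapply is_HInt_ext; [|exact (is_HInt_minus _ _ _ _ (is_HInt_minus _ _ _ _
    (conv_is_HInt K1 M t w1 g H1 Hg) (conv_is_HInt K2 M t w2 g H2 Hg))
    (is_HInt_scal h _ _ (conv_is_HInt K3 M t w3 g H3 Hg)))].
  intros x _; simpl; ring.
Qed.

Lemma conv_tame (K M0 M1 M2 : R) (w g0 g1 g2 : R -> C) :
  weight K w -> tame M0 g0 -> tame M1 g1 -> tame M2 g2 ->
  (forall y, deriv g0 y (g1 y)) -> (forall y, deriv g1 y (g2 y)) ->
  tame (4 * K * M0) (conv w g0).
Proof.
  intros Hw T0 T1 T2 D0 D1 y; split.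
  - exact (deriv_cont _ _ _ (is_derive_conv K M0 M1 M2 y w g0 g1 g2 Hw T0 T1 T2 D0 D1)).
  - now apply conv_bound.
Qed.

Lemma PV_conv_is_HInt (K : R) (w : R -> C) (F : nat -> R -> C) (k : nat) :
  weight K w -> tame_tower F ->
  exists M, tame M (conv w (F k)) /\ tame M (conv w (F (S k))) /\
    (forall t, deriv (conv w (F k)) t (conv w (F (S k)) t)).
Proof.
  intros Hw HF; destruct (tame_tower_common F k HF) as (M & HM & T0 & T1 & T2).
  destruct (proj2 HF (S (S (S k)))) as [N HN].
  pose proof (proj1 HF k) as D0; pose proof (proj1 HF (S k)) as D1.
  pose proof (proj1 HF (S (S k))) as D2.
  exists (4 * K * M); split; [|split].
  - exact (conv_tame K M M M w _ _ _ Hw T0 T1 T2 D0 D1).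
  - exact (conv_tame K M M N w _ _ _ Hw T1 T2 HN D1 D2).
  - intros t; exact (is_derive_conv K M M M t w _ _ _ Hw T0 T1 T2 D0 D1).
Qed.

(** The map from the weight to [PV (conv w (F k))] is linear and bounded by the constant of the
    weight, so the quadratic remainder of [weight_Rcpow_taylor] passes straight through both
    integrals. *)
Lemma qdiff_PV_conv (z : C) (F : nat -> R -> C) (k : nat) :
  2 <= Re z -> tame_tower F ->
  qdiff (fun z => PV (conv (fun x => Rcpow x (z - 1))%C (F k))) z.
Proof.
  intros Hz HF; destruct (weight_Rcpow_taylor z Hz) as (K & HK & H).
  destruct (weight_log_Rcpow z Hz) as (L & HL & Hlog).
  destruct (weight_Rcpow z) as (K2 & HK2 & Hw2); [lra|].
  destruct (tame_tower_common F k HF) as (M & HM & T0 & T1 & T2).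
  (* Three further derivatives: the principal value uses one, and bounding the derivative of that
     convolution uses two more. *)
  destruct (proj2 HF (S (S (S k)))) as [N HN].
  pose proof (proj1 HF k) as D0; pose proof (proj1 HF (S k)) as D1.
  pose proof (proj1 HF (S (S k))) as D2.
  exists (PV (conv (fun x => RtoC (ln x) * Rcpow x (z - 1))%C (F k))),
    (36 * (4 * K * M)), (1 / 2); split; [lra|split].
  { repeat apply Rmult_le_pos; lra. }
  intros h Hh; specialize (H h ltac:(lra)).
  assert (Hzh : 1 <= Re (z + h)%C).
  { change (1 <= Re z + Re h); pose proof (re_le_Cmod h) as B.
    apply Rabs_le_between in B; lra. }
  destruct (weight_Rcpow _ Hzh) as (K1 & HK1 & Hw1).
  destruct (PV_conv_is_HInt _ _ F k Hw1 HF) as (M1 & A1 & A2 & A3).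
  destruct (PV_conv_is_HInt _ _ F k Hw2 HF) as (M2 & B1 & B2 & B3).
  destruct (PV_conv_is_HInt _ _ F k Hlog HF) as (M3 & C1 & C2 & C3).
  set (w := fun x => (Rcpow x (z + h - 1) - Rcpow x (z - 1) -
    h * (RtoC (ln x) * Rcpow x (z - 1)))%C) in H.
  match goal with |- Cmod ?g <= _ => replace g with (PV (conv w (F k))) end.
  - replace (36 * (4 * K * M) * Cmod h ^ 2) with (36 * (4 * (K * Cmod h ^ 2) * M)) by ring.
    apply PV_bound with (conv w (F (S k))).
    + exact (conv_tame _ M M M w _ _ _ H T0 T1 T2 D0 D1).
    + exact (conv_tame _ M M N w _ _ _ H T1 T2 HN D1 D2).
    + intros t; exact (is_derive_conv _ M M M t w _ _ _ H T0 T1 T2 D0 D1).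
  - apply is_HInt_unique.
    pose proof (dominated_is_HInt _ _ (fold_PV_dominated _ _ _ A1 A2 A3)) as I1.
    pose proof (dominated_is_HInt _ _ (fold_PV_dominated _ _ _ B1 B2 B3)) as I2.
    pose proof (dominated_is_HInt _ _ (fold_PV_dominated _ _ _ C1 C2 C3)) as I3.
    eapply is_HInt_ext; [|exact (is_HInt_minus _ _ _ _ (is_HInt_minus _ _ _ _ I1 I2)
      (is_HInt_scal h _ _ I3))].
    intros x _; unfold fold_PV, w.
    rewrite !(conv_combination _ _ _ _ _ h _ _ _ _ Hw1 Hw2 Hlog T0).
    simpl; ring.
Qed.

Lemma PV_scal (M : R) (c : C) (f df : R -> C) :
  tame M f -> tame M df -> (forall t, deriv f t (df t)) ->
  PV (fun t => c * f t)%C = (c * PV f)%C.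
Proof.
  intros T T' D; apply is_HInt_unique.
  eapply is_HInt_ext; [|apply is_HInt_scal; eapply dominated_is_HInt, fold_PV_dominated;
    eassumption].
  intros x _; unfold fold_PV; ring.
Qed.

Lemma li_formula (s : C) (k : nat) (F : nat -> R -> C) :
  tame_tower F -> 1 <= Re s + INR k ->
  li s F = (Cpow (- (1)) k * / Gamma (s + INR k) *
    PV (conv (fun x => Rcpow x (s + INR k - 1)) (F k)))%C.
Proof.
  intros HF Hk; rewrite (li_indep s k F HF Hk).
  destruct (weight_Rcpow (s + INR k)) as (K & HK & Hw); [rewrite Re_shift; lra|].
  destruct (PV_conv_is_HInt _ _ F k Hw HF) as (M & A1 & A2 & A3).
  now rewrite <- (PV_scal M _ _ _ A1 A2 A3).
Qed.

Lemma qdiff_shift (f : C -> C) (z a : C) :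
  qdiff f (z + a)%C -> qdiff (fun s => f (s + a)%C) z.
Proof.
  intros (D & M & r & Hr & HM & H); exists D, M, r; split; [exact Hr|split; [exact HM|]].
  intros h Hh; specialize (H h Hh).
  now replace (z + h + a)%C with (z + a + h)%C by ring.
Qed.

Lemma qdiff_const (c z : C) : qdiff (fun _ => c) z.
Proof.
  exists (RtoC 0), 0, 1; split; [lra|split; [lra|]]; intros h _.
  replace (c - c - h * 0)%C with (RtoC 0) by ring; rewrite Cmod_0; lra.
Qed.

Lemma li_entire (F : nat -> R -> C) : tame_tower F -> entire (fun s => li s F).
Proof.
  intros HF s; apply qdiff_ex_derive.
  pose proof (li_order_spec s) as Hk; set (k := li_order s) in *.
  (* The order belonging to the centre [s] is kept on the unit disc, where [li_formula] still
     applies. *)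
  apply (qdiff_ext (fun s => Cpow (- (1)) k * / Gamma (s + INR k) *
    PV (conv (fun x => Rcpow x (s + INR k - 1)) (F k)))%C _ s 1 Rlt_0_1).
  { intros h Hh; symmetry; apply li_formula; [exact HF|].
    change (1 <= Re s + Re h + INR k); pose proof (re_le_Cmod h) as B.
    apply Rabs_le_between in B; lra. }
  assert (Hz : 2 <= Re (s + INR k)%C) by (rewrite Re_shift; lra).
  apply qdiff_mult; [apply qdiff_mult; [apply qdiff_const|]|].
  - apply (qdiff_inv (fun s => Gamma (s + INR k))); [apply Gamma_neq_0; lra|].
    now apply qdiff_shift, qdiff_Gamma.
  - apply (qdiff_shift (fun z => PV (conv (fun x => Rcpow x (z - 1))%C (F k)))).
    now apply qdiff_PV_conv.
Qed.

(** * Exponential change of variable *)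

(* [CDerive_n f 0] is only propositionally equal to [f]. *)
Definition derivs (f : R -> C) (n : nat) : R -> C :=
  match n with O => f | S _ => CDerive_n f n end.

Lemma derivs_CDerive_n (f : R -> C) (n : nat) (x : R) : derivs f n x = CDerive_n f n x.
Proof. destruct n; [apply surjective_pairing|reflexivity]. Qed.

Lemma derivs_tower (f : R -> C) : smooth f -> tower (derivs f).
Proof.
  intros H n x; pose proof (smooth_tower f H n x) as D; rewrite derivs_CDerive_n.
  revert D; apply (is_derive_ext (V := C_R_NormedModule)).
  intros t; symmetry; apply derivs_CDerive_n.
Qed.

Lemma derivs_linear (c : C) (f g : R -> C) : smooth f -> smooth g ->
  derivs (fun x => c * f x + g x)%C = (fun n x => c * derivs f n x + derivs g n x)%C.
Proof.
  intros Hf Hg; apply functional_extensionality; intros n.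
  apply functional_extensionality; intros x; rewrite derivs_CDerive_n.
  apply (tower_CDerive_n (fun n x => c * derivs f n x + derivs g n x)%C).
  intros m y; apply is_derive_Cplus; [apply is_derive_Cscal|]; now apply derivs_tower.
Qed.

Definition tower_support (a b : R) (F : nat -> R -> C) : Prop :=
  forall n, supported_in a b (F n).

Lemma tower_support_0 (a b : R) (F : nat -> R -> C) :
  tower F -> supported_in a b (F O) -> tower_support a b F.
Proof.
  intros HF H0 n; induction n as [|n IH]; [exact H0|]; intros x Hx.
  apply (deriv_unique (F n) x); [apply HF|].
  apply (is_derive_ext_loc (V := C_R_NormedModule) (fun _ => zero)).
  2: apply (is_derive_const (K := R_AbsRing) (V := C_R_NormedModule)).
  assert (L : locally x (fun t => ~ (a <= t <= b))).
  { destruct (Rlt_dec x a) as [H|H].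
    - apply (filter_imp (fun t => t < a)); [intros; lra|now apply open_lt].
    - apply (filter_imp (fun t => b < t)); [intros; lra|apply open_gt; lra]. }
  revert L; apply filter_imp; intros t Ht; symmetry; now apply IH.
Qed.

Lemma supported_bounded (a b : R) (g : R -> C) :
  (forall x, cont g x) -> supported_in a b g -> exists M, forall x, Cmod (g x) <= M.
Proof.
  intros Hc Hs.
  destruct (Rle_dec a b) as [Hab|Hab].
  - destruct (continuity_ab_maj (fun x => Cmod (g x)) a b Hab) as (m & Hm & _).
    { intros x _; apply continuity_pt_filterlim.
      apply (continuous_ext (fun x => norm (V := C_R_NormedModule) (g x))).
      { intros; apply norm_C. }
      apply (continuous_comp g (norm (V := C_R_NormedModule))); [apply Hc|].
      apply (filterlim_norm (V := C_R_NormedModule)). }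
    exists (Rmax 0 (Cmod (g m))); intros x.
    destruct (Rle_dec a x), (Rle_dec x b);
      try (rewrite Hs, Cmod_0 by lra; apply Rmax_l).
    eapply Rle_trans; [apply Hm; lra|apply Rmax_r].
  - exists 0; intros x; rewrite Hs, Cmod_0; lra.
Qed.

Lemma tower_bounded (a b : R) (F : nat -> R -> C) (n : nat) :
  tower F -> tower_support a b F ->
  exists M, forall j x, (j <= n)%nat -> Cmod (F j x) <= M.
Proof.
  intros HF HS; induction n as [|n [M IH]].
  - destruct (supported_bounded a b (F O)) as [M HM]; [|apply HS|].
    + intros x; exact (deriv_cont _ _ _ (HF O x)).
    + exists M; intros j x Hj; now replace j with O by lia.
  - destruct (supported_bounded a b (F (S n))) as [N HN]; [|apply HS|].
    + intros x; exact (deriv_cont _ _ _ (HF (S n) x)).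
    + exists (Rmax M N); intros j x Hj.
      destruct (Nat.eq_dec j (S n)) as [->|Hne].
      * eapply Rle_trans; [apply HN|apply Rmax_r].
      * eapply Rle_trans; [apply IH; lia|apply Rmax_l].
Qed.

(* The derivatives of [f + x f']; this operator is conjugate to [d/dx] under
   [f |-> e^x f(e^x)]. *)
Definition theta (F : nat -> R -> C) (j : nat) (x : R) : C :=
  (RtoC (INR (S j)) * F j x + RtoC x * F (S j) x)%C.

Definition exp_tower (F : nat -> R -> C) (n : nat) (x : R) : C :=
  (RtoC (exp x) * Nat.iter n theta F O (exp x))%C.

Lemma tower_theta (F : nat -> R -> C) : tower F -> tower (theta F).
Proof.
  intros HF j x; unfold theta; evar_last.
  - apply is_derive_Cplus; [apply is_derive_Cscal, HF|].
    apply is_derive_Cmult; [|apply HF].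
    apply is_derive_RtoC, (is_derive_id (K := R_AbsRing)).
  - change (one : R_AbsRing) with 1; rewrite (RtoC_INR_S (S j)); ring.
Qed.

Lemma tower_iter_theta (n : nat) (F : nat -> R -> C) :
  tower F -> tower (Nat.iter n theta F).
Proof. intros HF; induction n as [|n IH]; [exact HF|now apply tower_theta]. Qed.

Lemma tower_exp_tower (F : nat -> R -> C) : tower F -> tower (exp_tower F).
Proof.
  intros HF n x; unfold exp_tower; evar_last.
  - apply is_derive_Cmult.
    + apply is_derive_RtoC, is_derive_exp.
    + apply (is_derive_Ccomp (Nat.iter n theta F O) exp); [|apply is_derive_exp].
      apply (tower_iter_theta n F HF).
  - rewrite Nat.iter_succ; unfold theta at 3; simpl; ring.
Qed.

Lemma exp_tower_linear (c : C) (F G : nat -> R -> C) :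
  exp_tower (fun n x => c * F n x + G n x)%C =
    (fun n x => c * exp_tower F n x + exp_tower G n x)%C.
Proof.
  apply functional_extensionality; intros n; apply functional_extensionality; intros x.
  assert (H : forall m j y, Nat.iter m theta (fun n x => c * F n x + G n x)%C j y =
    (c * Nat.iter m theta F j y + Nat.iter m theta G j y)%C).
  { induction m as [|m IH]; intros j y; [reflexivity|].
    rewrite !Nat.iter_succ; unfold theta at 1 3 5; rewrite !IH; ring. }
  unfold exp_tower; rewrite H; ring.
Qed.

Lemma iter_theta_support (a b : R) (n : nat) (F : nat -> R -> C) :
  tower_support a b F -> tower_support a b (Nat.iter n theta F).
Proof.
  intros HF; induction n as [|n IH]; [exact HF|]; intros j x Hx.
  rewrite Nat.iter_succ; unfold theta; rewrite !IH by exact Hx; ring.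
Qed.

(** Each [theta] consumes one more derivative, so the range [N] must vary in the induction. The
    factor [x] is bounded by [|a| + |b|] on the support. *)
Lemma iter_theta_bound (a b : R) (n : nat) : forall N, exists A, 0 <= A /\
  forall F M, tower_support a b F ->
    (forall j x, (j <= n + N)%nat -> Cmod (F j x) <= M) ->
    forall j x, (j <= N)%nat -> Cmod (Nat.iter n theta F j x) <= A * M.
Proof.
  induction n as [|n IH]; intros N.
  - exists 1; split; [lra|]; intros F M _ H j x Hj; rewrite Rmult_1_l; now apply H.
  - destruct (IH (S N)) as (A & HA & H).
    exists ((INR (S N) + (Rabs a + Rabs b)) * A); split.
    { pose proof (pos_INR (S N)); pose proof (Rabs_pos a); pose proof (Rabs_pos b).
      apply Rmult_le_pos; lra. }
    intros F M HF HM j x Hj.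
    assert (B : forall j x, (j <= S N)%nat -> Cmod (Nat.iter n theta F j x) <= A * M).
    { apply H; [exact HF|]; intros i y Hi; apply HM; lia. }
    assert (HB : 0 <= A * M).
    { eapply Rle_trans; [apply Cmod_ge_0|apply (B O 0); lia]. }
    pose proof (pos_INR (S N)); pose proof (Rabs_pos a); pose proof (Rabs_pos b).
    assert (Hpos : 0 <= (INR (S N) + (Rabs a + Rabs b)) * A * M).
    { rewrite Rmult_assoc; apply Rmult_le_pos; lra. }
    destruct (Rle_dec a x) as [Hax|Hax], (Rle_dec x b) as [Hxb|Hxb];
      try (rewrite (iter_theta_support a b (S n) F HF), Cmod_0 by lra; exact Hpos).
    rewrite Nat.iter_succ; unfold theta.
    eapply Rle_trans; [apply Cmod_triangle|].
    rewrite !Cmod_mult, !Cmod_R, Rabs_right by (apply Rle_ge, pos_INR).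
    rewrite Rmult_assoc, Rmult_plus_distr_r.
    apply Rplus_le_compat; apply Rmult_le_compat; try apply Cmod_ge_0;
      try apply Rabs_pos; try apply pos_INR; try (apply B; lia).
    + apply le_INR; lia.
    + unfold Rabs; repeat destruct Rcase_abs; lra.
Qed.

Lemma exp_tower_support (a b : R) (F : nat -> R -> C) : 0 < a ->
  tower_support a b F -> tower_support (ln a) (ln b) (exp_tower F).
Proof.
  intros Ha HF n x Hx; unfold exp_tower.
  rewrite (iter_theta_support a b n F HF), Cmult_0_r; [reflexivity|].
  intros [H1 H2]; apply Hx; pose proof (exp_pos x); split.
  - rewrite <- (ln_exp x); apply ln_le; lra.
  - rewrite <- (ln_exp x); apply ln_le; lra.
Qed.

(** Compact support turns sup norms into the weighted bound: where the function is nonzero,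
    [exp x <= B] and [1 <= exp (ln B / 2) exp (- x / 2)]. The constant depends on the support and
    the order only, as continuity requires. *)
Lemma exp_tower_tame (a b : R) (n : nat) : 0 < a -> exists A, 0 <= A /\
  forall F M, tower F -> tower_support a b F ->
    (forall j x, (j <= n)%nat -> Cmod (F j x) <= M) -> tame (A * M) (exp_tower F n).
Proof.
  intros Ha; destruct (iter_theta_bound a b n O) as (A & HA & H).
  (* Nothing forces [a <= b], so [b] might not be positive; the maximum keeps the logarithm
     meaningful. *)
  set (B := Rmax 1 b).
  assert (HB : 1 <= B) by apply Rmax_l.
  assert (HB2 : b <= B) by apply Rmax_r.
  exists (B * A * exp (ln B / 2)); split.
  { repeat apply Rmult_le_pos; try lra; left; apply exp_pos. }
  intros F M HF HS HM x; split.
  { exact (deriv_cont _ _ _ (tower_exp_tower F HF n x)). }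
  assert (HAM : Cmod (Nat.iter n theta F O (exp x)) <= A * M).
  { apply H; [exact HS| |lia]; intros j y Hj; apply HM; lia. }
  assert (HP : 0 <= A * M) by (eapply Rle_trans; [apply Cmod_ge_0|exact HAM]).
  destruct (Rle_dec (exp x) b) as [Hx|Hx].
  - unfold exp_tower; rewrite Cmod_mult, Cmod_R, Rabs_right by (left; apply exp_pos).
    assert (HxB : x <= ln B).
    { rewrite <- (ln_exp x); apply ln_le; [apply exp_pos|lra]. }
    assert (E : 1 <= exp (ln B / 2) * exp (- x / 2)).
    { rewrite <- exp_plus, <- exp_0; apply exp_le; lra. }
    replace (B * A * exp (ln B / 2) * M * exp (- x / 2)) with
      (B * (A * M) * (exp (ln B / 2) * exp (- x / 2))) by ring.
    apply Rle_trans with (B * (A * M) * 1).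
    + rewrite Rmult_1_r; apply Rmult_le_compat; try apply Cmod_ge_0; trivial;
        [left; apply exp_pos|lra].
    + apply Rmult_le_compat_l; [apply Rmult_le_pos; lra|exact E].
  - unfold exp_tower; rewrite (iter_theta_support a b n F HS) by lra.
    rewrite Cmult_0_r, Cmod_0.
    replace (B * A * exp (ln B / 2) * M * exp (- x / 2)) with
      (B * (A * M) * (exp (ln B / 2) * exp (- x / 2))) by ring.
    apply Rmult_le_pos; [apply Rmult_le_pos; lra|].
    apply Rmult_le_pos; left; apply exp_pos.
Qed.

Lemma exp_tower_tame_tower (a b : R) (F : nat -> R -> C) : 0 < a ->
  tower F -> tower_support a b F -> tame_tower (exp_tower F).
Proof.
  intros Ha HF HS; split; [now apply tower_exp_tower|]; intros n.
  destruct (exp_tower_tame a b n Ha) as (A & HA & H).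
  destruct (tower_bounded a b F n HF HS) as [M HM].
  exists (A * M); now apply H.
Qed.

Lemma tower_schwartz (a b : R) (F : nat -> R -> C) :
  tower F -> tower_support a b F -> schwartz (F O).
Proof.
  intros HF HS; split; [now apply tower_smooth|]; intros n k.
  destruct (supported_bounded a b (fun x => RtoC (x ^ n) * F k x)%C) as [M HM].
  - intros x; apply continuous_Cmult; [|exact (deriv_cont _ _ _ (HF k x))].
    apply continuous_RtoC, (ex_derive_continuous (V := R_NormedModule)).
    auto_derive; trivial.
  - intros x Hx; rewrite HS by exact Hx; ring.
  - exists M; intros x; rewrite tower_CDerive_n by exact HF.
    specialize (HM x); now rewrite Cmod_mult, Cmod_R, <- RPow_abs in HM.
Qed.

Definition Li (s : C) (f : R -> C) : C := li s (exp_tower (derivs f)).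

Lemma test_function_support (f : R -> C) (hi : Rbar) : test_function 0 hi f ->
  exists a b : R, 0 < a /\ Rbar_lt b hi /\ supported_in a b f /\
    tower (derivs f) /\ tower_support a b (derivs f).
Proof.
  intros (Hf & a & b & Ha & Hb & HS); exists a, b.
  pose proof (derivs_tower f Hf) as HT.
  exact (conj Ha (conj Hb (conj HS (conj HT (tower_support_0 a b _ HT HS))))). 
Qed.

Lemma Li_tame (f : R -> C) (hi : Rbar) :
  test_function 0 hi f -> tame_tower (exp_tower (derivs f)).
Proof.
  intros H; destruct (test_function_support f hi H) as (a & b & Ha & _ & _ & HT & HS).
  now apply exp_tower_tame_tower with a b.
Qed.

Lemma Li_is_li (s : C) (f : R -> C) : test_function 0 p_infty f ->
  is_li s (fun x => RtoC (exp x) * f (exp x))%C (Li s f).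
Proof.
  intros H; destruct (test_function_support f _ H) as (a & b & Ha & _ & _ & HT & HS).
  apply (li_correct s (exp_tower (derivs f))).
  - now apply Li_tame with p_infty.
  - apply tower_schwartz with (ln a) (ln b).
    + now apply tower_exp_tower.
    + now apply exp_tower_support.
Qed.

Lemma Li_entire_distribution : entire_distribution 0 p_infty Li.
Proof.
  split.
  - intros s; split.
    + intros c f g Hf Hg; unfold Li.
      rewrite derivs_linear, exp_tower_linear by (apply Hf || apply Hg).
      apply li_linear; now apply Li_tame with p_infty.
    + intros a b Ha _; simpl in Ha.
      destruct (li_bound s) as (A & HA & H).
      destruct (exp_tower_tame a b (li_order s) Ha) as (B0 & HB0 & H0).
      destruct (exp_tower_tame a b (S (li_order s)) Ha) as (B1 & HB1 & H1).
      (* The distribution order exceeds [li_order s] by one because of the derivative taken in the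
         principal value. *)
      exists (A * (B0 + B1)), (S (li_order s)); intros f M Hf HS HM.
      pose proof (derivs_tower f Hf) as HT.
      pose proof (tower_support_0 a b _ HT HS) as HTS.
      assert (HM0 : 0 <= M).
      { eapply Rle_trans; [apply Cmod_ge_0|apply (HM O 0); lia]. }
      assert (HB : forall j x, (j <= S (li_order s))%nat -> Cmod (derivs f j x) <= M).
      { intros j x Hj; rewrite derivs_CDerive_n; now apply HM. }
      rewrite Rmult_assoc; apply H.
      * now apply exp_tower_tame_tower with a b.
      * apply tame_le with (B0 * M); [nra|]; apply H0; trivial.
        intros j x Hj; apply HB; lia.
      * apply tame_le with (B1 * M); [nra|]; now apply H1.
  - intros f Hf; apply li_entire; now apply Li_tame with p_infty.
Qed.

(** * Moments and the Laplace transform *)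

Lemma HInt_0 (p : R -> C) : (forall x, 0 < x -> p x = RtoC 0) -> HInt p = RtoC 0.
Proof.
  intros H.
  assert (D : dominated 0 (fun _ => RtoC 0)).
  { intros x _; split; [apply continuous_const|rewrite Cmod_0; lra]. }
  assert (E : HInt (fun _ => RtoC 0) = RtoC 0).
  { apply Cmod_eq_0; pose proof (dominated_bound _ _ D) as B.
    pose proof (Cmod_ge_0 (HInt (fun _ => RtoC 0))); lra. }
  apply is_HInt_unique, (is_HInt_ext (fun _ => RtoC 0)).
  - intros; symmetry; auto.
  - pose proof (dominated_is_HInt _ _ D) as I; now rewrite E in I.
Qed.

(** The kernel lives on the positive axis, so the value at [t] depends only on [F] to the right of
    [t]. For support in the negative axis this removes the singularity at 0 from the principal
    value. *)
Lemma gamma_plus_0 (k : nat) (s : C) (F : nat -> R -> C) (a b t : R) :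
  tower_support a b F -> b <= t -> gamma_plus k s F t = RtoC 0.
Proof.
  intros HF Ht; unfold gamma_plus, conv; rewrite HInt_0; [ring|].
  intros x Hx; rewrite HF by lra; ring.
Qed.

Lemma is_HInt_scale (c : R) (p : R -> C) (l : C) : 0 < c ->
  is_HInt p l -> is_HInt (fun x => RtoC c * p (c * x)%R)%C l.
Proof.
  intros Hc H P HP; specialize (H P HP); unfold filtermapi in *.
  destruct H as [Q S HQ HS H].
  apply Filter_prod with (fun a => Q (c * a)) (fun b => S (c * b)).
  - destruct HQ as [e He]; assert (He' : 0 < e / c).
    { apply Rdiv_lt_0_compat; [apply cond_pos|exact Hc]. }
    generalize (at_right_0_lt _ He'); apply filter_imp; intros x [Hx1 Hx2].
    apply (Rmult_lt_compat_l c) in Hx2; [|exact Hc].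
    replace (c * (e / c)) with (pos e) in Hx2 by (field; lra).
    assert (0 < c * x) by now apply Rmult_lt_0_compat.
    apply He; [|lra].
    unfold ball; simpl; unfold AbsRing_ball, abs, minus, plus, opp; simpl.
    rewrite Rabs_right; lra.
  - destruct HS as [M HM]; exists (M / c); intros x Hx; apply HM.
    apply (Rmult_lt_compat_l c) in Hx; [|exact Hc].
    replace (c * (M / c)) with M in Hx by (field; lra); exact Hx.
  - intros a b Qa Sb; simpl; destruct (H _ _ Qa Sb) as (y & Hy & Py).
    exists y; split; [|exact Py].
    apply (is_RInt_ext (V := C_R_NormedModule) (fun x => scal c (p (c * x + 0)))).
    { intros x _; rewrite scal_R_C, Rplus_0_r; reflexivity. }
    apply (is_RInt_comp_lin (V := C_R_NormedModule)).
    now rewrite !Rplus_0_r.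
Qed.

Lemma Rcpow_INR (x : R) (k : nat) : 0 < x ->
  Rcpow x (RtoC (INR k)) = Cpow (RtoC x) k.
Proof.
  intros Hx; induction k as [|k IH]; [apply Rcpow_0_r|].
  now rewrite RtoC_INR_S, Rcpow_S, IH by exact Hx.
Qed.

(** The origin of [n^(-s)] in the polylogarithm: Euler's integral dilated by [n]. *)
Lemma Gamma_scaled (c : R) (z : C) : 0 < c -> 0 < Re z ->
  is_HInt (fun x => Rcpow x (z - 1) * RtoC (exp (- (c * x))))%C (Gamma z / Rcpow c z)%C.
Proof.
  intros Hc Hz.
  pose proof (is_HInt_scal (/ Rcpow c z) _ _ (is_HInt_scale c _ _ Hc (Gamma_is_HInt z Hz))) as H.
  replace (Gamma z / Rcpow c z)%C with (/ Rcpow c z * Gamma z)%C by (unfold Cdiv; ring).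
  revert H; apply is_HInt_ext; intros x Hx; simpl.
  rewrite Rcpow_mult by assumption.
  replace (Rcpow c z) with (RtoC c * Rcpow c (z - 1))%C.
  - field; split; [apply Rcpow_neq_0|apply RtoC_neq_0; lra].
  - rewrite <- Rcpow_S by exact Hc; f_equal; ring.
Qed.

Lemma is_derive_exp_linear (c t : R) :
  is_derive (fun t => exp (- (c * t))) t (- c * exp (- (c * t))).
Proof. auto_derive; [trivial|ring]. Qed.

Section Moment.

Context (f : R -> C) (a b : R) (Ha : 0 < a) (Hb : 1 / 2 <= b < 1) (Hf : smooth f)
  (HS : supported_in a b f).

Let F := exp_tower (derivs f).

Lemma smooth_cont (x : R) : cont f x.
Proof. exact (deriv_cont _ _ _ (derivs_tower f Hf O x)). Qed.

Lemma F_support : tower_support (ln a) (ln b) F.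
Proof.
  apply exp_tower_support; [exact Ha|].
  apply tower_support_0; [now apply derivs_tower|exact HS].
Qed.

Lemma F_tame : tame_tower F.
Proof.
  apply exp_tower_tame_tower with a b; [exact Ha|now apply derivs_tower|].
  apply tower_support_0; [now apply derivs_tower|exact HS].
Qed.

(** The upper end is variable because this primitive solves the differential equation of
    [resolvent]. With [g(x) = e^x f(e^x)], the substitution [u = e^x] makes [moment n 1] the
    integral of [e^(nx) g(x)] when the support lies in [(0,1)]. *)
Definition moment (n : nat) (t : R) : C :=
  RInt (V := C_R_CompleteNormedModule) (fun u => RtoC (u ^ n) * f u)%C 0 t.

Lemma moment_integrand_cont (n : nat) (x : R) : cont (fun u => RtoC (u ^ n) * f u)%C x.
Proof.
  apply continuous_Cmult; [|apply smooth_cont].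
  apply continuous_RtoC, (ex_derive_continuous (V := R_NormedModule)).
  auto_derive; trivial.
Qed.

Lemma moment_ex_RInt (n : nat) (x y : R) :
  ex_RInt (V := C_R_CompleteNormedModule) (fun u => RtoC (u ^ n) * f u)%C x y.
Proof.
  apply (ex_RInt_continuous (V := C_R_CompleteNormedModule)).
  intros; apply moment_integrand_cont.
Qed.

Lemma is_derive_moment (n : nat) (t : R) :
  deriv (moment n) t (RtoC (t ^ n) * f t)%C.
Proof.
  apply (is_derive_RInt (V := C_R_CompleteNormedModule)
    (fun u => RtoC (u ^ n) * f u)%C (moment n) 0 t).
  - apply filter_forall; intros u.
    apply (RInt_correct (V := C_R_CompleteNormedModule)), moment_ex_RInt.
  - apply moment_integrand_cont.
Qed.

Lemma moment_flat (n : nat) (x y : R) : x <= y ->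
  (forall u, x < u < y -> f u = RtoC 0) -> moment n y = moment n x.
Proof.
  intros Hxy H; unfold moment.
  rewrite <- (RInt_Chasles (V := C_R_CompleteNormedModule) _ 0 x y)
    by apply moment_ex_RInt.
  rewrite (RInt_ext (V := C_R_CompleteNormedModule) _ (fun _ => RtoC 0) x y).
  - rewrite (RInt_const (V := C_R_CompleteNormedModule)).
    rewrite scal_R_C.
    rewrite Cmult_0_r; apply Cplus_0_r.
  - rewrite Rmin_left, Rmax_right by exact Hxy; intros u Hu.
    rewrite H by exact Hu; apply Cmult_0_r.
Qed.

Lemma moment_0 (n : nat) (t : R) : 0 <= t <= a -> moment n t = RtoC 0.
Proof.
  intros Ht; rewrite (moment_flat n 0 t).
  - unfold moment; apply (RInt_point (V := C_R_CompleteNormedModule)).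
  - lra.
  - intros u Hu; apply HS; lra.
Qed.

Lemma moment_1 (n : nat) (t : R) : b <= t -> moment n t = moment n 1.
Proof.
  intros Ht; rewrite (moment_flat n b t), (moment_flat n b 1); try lra.
  - reflexivity.
  - intros u Hu; apply HS; lra.
  - intros u Hu; apply HS; lra.
Qed.

Lemma moment_bound (n : nat) : exists M, 0 <= M /\ forall t, 0 <= t -> Cmod (moment n t) <= M.
Proof.
  destruct (supported_bounded a b (fun u => RtoC (u ^ n) * f u)%C) as [M HM].
  - intros x; apply moment_integrand_cont.
  - intros x Hx; rewrite HS by exact Hx; ring.
  - assert (HM0 : 0 <= M) by (eapply Rle_trans; [apply Cmod_ge_0|apply (HM 0)]).
    assert (B : forall t, 0 <= t <= 1 -> Cmod (moment n t) <= M).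
    { intros t Ht.
      pose proof (deriv_bound (moment n) _ 0 t M (proj1 Ht)
        (fun x _ => is_derive_moment n x) (fun x _ => moment_integrand_cont n x)
        (fun x _ => HM x)) as H.
      rewrite (moment_0 n 0) in H by lra.
      replace (moment n t - 0)%C with (moment n t) in H by ring.
      eapply Rle_trans; [exact H|].
      rewrite <- (Rmult_1_r M) at 2; apply Rmult_le_compat_l; lra. }
    exists M; split; [exact HM0|]; intros t Ht.
    destruct (Rle_dec t 1); [apply B; lra|].
    rewrite moment_1 by lra; apply B; lra.
Qed.

(* The solution of [q' = - n q + F 0] that vanishes near minus infinity, with its
   derivatives. It reduces the Laplace transform of [gamma_plus] to Euler's
   integral without exchanging integrals. *)
Fixpoint resolvent (n j : nat) (y : R) : C :=
  match j with
  | O => RtoC (exp (- (INR n * y))) * moment n (exp y)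
  | S i => RtoC (- INR n) * resolvent n i y + F i y
  end%C.

Lemma exp_INR_mult (n : nat) (y : R) : exp (INR n * y) = exp y ^ n.
Proof.
  induction n as [|n IH]; [simpl; now rewrite Rmult_0_l, exp_0|].
  rewrite S_INR; simpl; rewrite <- IH, <- exp_plus; f_equal; ring.
Qed.

Lemma resolvent_tower (n : nat) : tower (resolvent n).
Proof.
  intros j; induction j as [|j IH]; intros y.
  - evar_last.
    + apply is_derive_Cmult.
      * apply is_derive_RtoC, is_derive_exp_linear.
      * apply (is_derive_Ccomp (moment n) exp); [apply is_derive_moment|].
        apply is_derive_exp.
    + simpl resolvent.
      replace (F 0%nat y) with (RtoC (exp y) * f (exp y))%C by reflexivity.
      assert (E : (RtoC (exp (- (INR n * y))) * RtoC (exp y ^ n))%C = RtoC 1).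
      { rewrite <- RtoC_mult, <- exp_INR_mult, <- exp_plus; f_equal.
        rewrite <- exp_0; f_equal; ring. }
      replace (RtoC (exp (- (INR n * y))) *
        (RtoC (exp y) * (RtoC (exp y ^ n) * f (exp y))))%C with
        ((RtoC (exp (- (INR n * y))) * RtoC (exp y ^ n)) *
          (RtoC (exp y) * f (exp y)))%C by ring.
      rewrite E, RtoC_mult; ring.
  - apply is_derive_Cplus; [apply is_derive_Cscal, IH|apply F_tame].
Qed.

(** The index starts at 1: to the right of the support the function behaves like [e^(-(n+1)y)],
    which is below [e^(-y/2)]; index 0 would leave a constant. *)
Lemma resolvent_tame (n : nat) : tame_tower (resolvent (S n)).
Proof.
  split; [apply resolvent_tower|]; intros j; induction j as [|j [M IH]].
  - destruct (moment_bound (S n)) as (M & HM0 & HM).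
    (* The function vanishes for [y < ln a]; beyond that point the excess decay, of rate
       [n + 1 - 1/2], is largest in size at [y = ln a]. *)
    exists (M * exp (- ((INR (S n) - 1 / 2) * ln a))); intros y; split.
    { exact (deriv_cont _ _ _ (resolvent_tower (S n) O y)). }
    unfold resolvent; rewrite Cmod_mult, Cmod_R, Rabs_right by (left; apply exp_pos).
    destruct (Rle_dec (exp y) a) as [Hy|Hy].
    + rewrite moment_0, Cmod_0, Rmult_0_r by (pose proof (exp_pos y); lra).
      apply Rmult_le_pos; [apply Rmult_le_pos; [exact HM0|]|]; left; apply exp_pos.
    + assert (Hya : ln a <= y).
      { rewrite <- (ln_exp y); apply ln_le; lra. }
      rewrite Rmult_comm, Rmult_assoc, <- exp_plus.
      apply Rmult_le_compat; [apply Cmod_ge_0|left; apply exp_pos| |].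
      * apply HM; left; apply exp_pos.
      * apply exp_le; rewrite S_INR; pose proof (pos_INR n); nra.
  - destruct (proj2 F_tame j) as [N HN].
    exists (Cmod (RtoC (- INR (S n))) * M + N); now apply tame_linear.
Qed.

(** Beyond the support the equation is homogeneous, so only a multiple of its exponential solution
    is left. *)
Lemma resolvent_right (n j : nat) (y : R) : ln b < y ->
  resolvent n j y =
    (Cpow (RtoC (- INR n)) j * moment n 1 * RtoC (exp (- (INR n * y))))%C.
Proof.
  intros Hy; induction j as [|j IH]; simpl.
  - rewrite moment_1; [ring|].
    rewrite <- (exp_ln b) by lra; left; now apply exp_increasing.
  - rewrite IH, F_support by lra; ring.
Qed.

Context (s : C).
Let k := li_order s.

(** As [ln b < 0], the pairing at [t = 0] sees only the region where the resolvent is a pure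
    exponential, and becomes a dilated Euler integral. *)
Lemma resolvent_value (n : nat) :
  gamma_plus k s (resolvent (S n)) 0 = (moment (S n) 1 / Rcpow (INR (S n)) s)%C.
Proof.
  assert (Hn : 0 < INR (S n)) by (apply lt_0_INR; lia).
  assert (Hz : 0 < Re (s + INR k)%C).
  { rewrite Re_shift; pose proof (li_order_spec s); unfold k; lra. }
  unfold gamma_plus, conv.
  assert (E : HInt (fun x => Rcpow x (s + INR k - 1) * resolvent (S n) k (x + 0)%R)%C =
    (Cpow (RtoC (- INR (S n))) k * moment (S n) 1 *
      (Gamma (s + INR k) / Rcpow (INR (S n)) (s + INR k)))%C).
  { apply is_HInt_unique; eapply is_HInt_ext;
      [|apply is_HInt_scal, (Gamma_scaled (INR (S n)) _ Hn Hz)].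
    intros x Hx; cbv beta; rewrite resolvent_right, Rplus_0_r.
    - ring.
    - rewrite Rplus_0_r; apply Rlt_trans with 0; [|exact Hx].
      rewrite <- ln_1; apply ln_increasing; lra. }
  rewrite E, Rcpow_plus, Rcpow_INR by exact Hn.
  assert (E2 : Cpow (RtoC (- INR (S n))) k =
    (Cpow (- (1)) k * Cpow (RtoC (INR (S n))) k)%C).
  { rewrite <- Cpow_mult_l; f_equal; rewrite RtoC_opp; ring. }
  assert (E3 : (Cpow (- (1)) k * Cpow (- (1)) k)%C = RtoC 1).
  { rewrite <- Cpow_mult_l; replace (- (1) * - (1))%C with (RtoC 1) by ring.
    apply Cpow_1_l. }
  rewrite E2.
  (* The sign [(-1)^k] occurs twice, in [gamma_plus] and in the [k]-th derivative of the
     exponential; [n^k] from that derivative cancels against [n^(s+k)]. *)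
  match goal with |- ?l = ?r => replace l with
    ((Cpow (- (1)) k * Cpow (- (1)) k) * r)%C; [rewrite E3; ring|] end.
  field; repeat split.
  - apply Cpow_nz, RtoC_neq_0; lra.
  - apply Rcpow_neq_0.
  - now apply Gamma_neq_0.
Qed.

Let psi := gamma_plus k s F.

(** Convolution commutes with differentiation, so [G = gamma_plus k s (resolvent (S n))] satisfies
    [G' = - (n+1) G + psi]. The integrand then has a primitive given by [G], and the integral is
    [G 0]. *)
Lemma laplace_gamma_plus (n : nat) :
  is_HInt (fun t => RtoC (exp (- (INR (S n) * t))) * psi (- t)%R)%C
    (moment (S n) 1 / Rcpow (INR (S n)) s)%C.
Proof.
  pose proof (li_order_spec s) as Hk; fold k in Hk.
  pose proof (resolvent_tame n) as HQ.
  set (Q := resolvent (S n)) in *.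
  destruct (gamma_plus_PV_conditions k s Q HQ ltac:(lra)) as (M & T & _ & D).
  assert (D' : forall t, deriv (gamma_plus k s Q) t
    (RtoC (- INR (S n)) * gamma_plus k s Q t + psi t)%C).
  { intros t; evar_last; [apply D|].
    destruct (weight_Rcpow (s + INR k)) as (K & HK & Hw); [rewrite Re_shift; lra|].
    destruct (proj2 HQ k) as [A HA], (proj2 F_tame k) as [B HB].
    unfold psi, gamma_plus.
    change (shift_tower Q k) with (fun x => RtoC (- INR (S n)) * Q k x + F k x)%C.
    rewrite (conv_linear_r _ _ _ _ _ _ _ _ Hw HA HB); ring. }
  assert (HM : 0 <= M).
  { destruct (T 0) as [_ B]; pose proof (Cmod_ge_0 (gamma_plus k s Q 0)).
    pose proof (exp_pos (- 0 / 2)); nra. }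
  rewrite <- resolvent_value; fold Q.
  replace (gamma_plus k s Q 0) with (0 - (- gamma_plus k s Q 0))%C by ring.
  (* In [H'] the two terms containing [G] cancel. At infinity [H] vanishes because [G (- t)] grows
     at most like [e^(t/2)], against a decay of rate at least 1. *)
  set (H := fun t => (- (RtoC (exp (- (INR (S n) * t))) * gamma_plus k s Q (- t)%R))%C).
  assert (DH : forall t, deriv H t (RtoC (exp (- (INR (S n) * t))) * psi (- t)%R)%C).
  { intros t; unfold H.
    apply (is_derive_ext (V := C_R_NormedModule)
      (fun t => - (1) * (RtoC (exp (- (INR (S n) * t))) * gamma_plus k s Q (- t)%R))%C).
    { intros u; simpl; ring. }
    evar_last.
    - apply is_derive_Cscal, is_derive_Cmult.
      + apply is_derive_RtoC, is_derive_exp_linear.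
      + assert (Hopp : is_derive (fun t => - t) t (- (1))) by (auto_derive; trivial).
        exact (is_derive_Ccomp (gamma_plus k s Q) _ t _ _ (D' (- t)) Hopp).
    - rewrite RtoC_mult, !RtoC_opp; ring. }
  apply is_HInt_primitive with H.
  - intros t _; apply DH.
  - intros t _; apply continuous_Cmult.
    + apply continuous_RtoC, (ex_derive_continuous (V := R_NormedModule)).
      auto_derive; trivial.
    + apply (continuous_comp (fun t => - t) psi).
      * apply (ex_derive_continuous (V := R_NormedModule)); auto_derive; trivial.
      * apply (deriv_cont _ _ _ (is_derive_gamma_plus k s F _ F_tame ltac:(lra))).
  - replace (- gamma_plus k s Q 0)%C with (H 0).
    + apply (filterlim_filter_le_1 (F := locally 0) (G := at_right 0)).
      * apply filter_le_within.
      * exact (deriv_cont _ _ _ (DH 0)).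
    + unfold H; rewrite Rmult_0_r, Ropp_0, exp_0; ring.
  - apply filterlim_Cmod; [typeclasses eauto|]; intros eps Heps.
    exists (Rmax 0 (2 * (M / eps))); intros t Ht.
    pose proof (Rmax_l 0 (2 * (M / eps))); pose proof (Rmax_r 0 (2 * (M / eps))).
    unfold H; match goal with |- Cmod (- ?u - _)%C < _ =>
      replace (- u - 0)%C with (- u)%C by ring end.
    rewrite Cmod_opp, Cmod_mult, Cmod_R, Rabs_right by (left; apply exp_pos).
    destruct (T (- t)) as [_ B].
    apply Rle_lt_trans with (exp (- t) * (M * exp (- - t / 2))).
    + apply Rmult_le_compat; [left; apply exp_pos|apply Cmod_ge_0| |exact B].
      apply exp_le; rewrite S_INR; pose proof (pos_INR n); nra.
    + replace (exp (- t) * (M * exp (- - t / 2))) with (M * / exp (t / 2)).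
      * pose proof (exp_ge_succ (t / 2)); pose proof (exp_pos (t / 2)) as Hp.
        apply Rmult_lt_reg_r with (exp (t / 2)); [exact Hp|].
        rewrite Rmult_assoc, Rinv_l, Rmult_1_r by lra.
        apply Rle_lt_trans with (eps * (M / eps)); [right; field; lra|].
        apply Rmult_lt_compat_l; lra.
      * rewrite <- exp_Ropp, (exp_shift (- (t / 2)) (- t) (- - t / 2)) by field; ring.
Qed.

Definition moment_term (n : nat) : C := (moment (S n) 1 / Rcpow (INR (S n)) s)%C.

(* [1/(e^t-1)] is expanded into [sum e^(-n t)]; the remainder is [e^(-N t)] times
   the original integrand, which vanishes for [t < - ln b]. *)
Lemma moment_series :
  filterlim (fun N => sum_n (G := C_AbelianGroup) moment_term N) eventually
    (locally (T := C_UniformSpace) (Li s f)).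
Proof.
  pose proof (li_order_spec s) as Hk; fold k in Hk.
  destruct (gamma_plus_PV_conditions k s F F_tame ltac:(lra)) as (M & T & T' & D).
  pose proof (fold_PV_dominated M psi _ T T' D) as HD.
  assert (HM : 0 <= M).
  { destruct (T 0) as [_ B]; pose proof (Cmod_ge_0 (gamma_plus k s F 0)).
    pose proof (exp_pos (- 0 / 2)); nra. }
  assert (Hlb : ln b < 0) by (rewrite <- ln_1; apply ln_increasing; lra).
  set (p := fold_PV psi) in *.
  assert (Hp : forall t, 0 < t -> p t = (RtoC (/ (exp t - 1)) * psi (- t)%R)%C).
  { intros t Ht; unfold p, fold_PV.
    rewrite (gamma_plus_0 k s F _ _ t F_support ltac:(lra) : psi t = RtoC 0); ring. }
  assert (I : forall N, is_HInt (fun t => RtoC (exp (- (INR (S N) * t))) * p t)%C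
    (Li s f - sum_n (G := C_AbelianGroup) moment_term N)%C).
  (* Telescoping: [e^(-Nt)/(e^t-1) - e^(-(N+1)t) = e^(-(N+1)t)/(e^t-1)]. *)
  { assert (step : forall N l,
      is_HInt (fun t => RtoC (exp (- (INR N * t))) * p t)%C l ->
      is_HInt (fun t => RtoC (exp (- (INR (S N) * t))) * p t)%C (l - moment_term N)%C).
    { intros N l Hl.
      generalize (is_HInt_minus _ _ _ _ Hl (laplace_gamma_plus N)).
      apply is_HInt_ext; intros t Ht; rewrite Hp by exact Ht.
      pose proof (exp_minus_1_pos t Ht).
      rewrite !Cmult_assoc, <- !RtoC_mult.
      match goal with |- (RtoC ?u * ?v - RtoC ?w * ?v)%C = _ =>
        replace (RtoC u * v - RtoC w * v)%C with (RtoC (u - w) * v)%C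
          by (rewrite RtoC_minus; ring) end.
      f_equal; f_equal.
      rewrite (exp_shift (- (INR N * t)) (- (INR (S N) * t)) t) by (rewrite S_INR; ring).
      field; lra. }
    intros N; induction N as [|N IH].
    - rewrite sum_O; apply step.
      generalize (dominated_is_HInt _ _ HD : is_HInt p (Li s f)); apply is_HInt_ext.
      intros t _; simpl INR; rewrite Rmult_0_l, Ropp_0, exp_0; ring.
    - rewrite sum_Sn; apply step in IH.
      match type of IH with is_RInt_gen _ _ _ (?u - ?v - ?w)%C =>
        replace (u - v - w)%C with (u - (v + w))%C in IH by ring end.
      exact IH. }
  apply filterlim_Cmod; [typeclasses eauto|]; intros eps Heps.
  (* On [t >= - ln b] the factor [e^(-(N+1)t)] is at most [b^(N+1)], so the remainder tends to 0
     geometrically. *)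
  assert (B : forall N, Cmod (sum_n (G := C_AbelianGroup) moment_term N - Li s f)%C <=
    4 * (exp (INR (S N) * ln b) * (9 * M))).
  { intros N.
    replace (sum_n (G := C_AbelianGroup) moment_term N - Li s f)%C with
      (- (Li s f - sum_n (G := C_AbelianGroup) moment_term N))%C by ring.
    rewrite Cmod_opp, <- (is_HInt_unique _ _ (I N)).
    apply dominated_bound; intros t Ht; destruct (HD t Ht) as [Cp Bp]; split.
    - apply continuous_Cmult; [|exact Cp].
      apply continuous_RtoC, (ex_derive_continuous (V := R_NormedModule)).
      auto_derive; trivial.
    - rewrite Cmod_mult, Cmod_R, Rabs_right, Rmult_assoc by (left; apply exp_pos).
      destruct (Rle_dec (- ln b) t) as [Hb'|Hb'].
      + apply Rmult_le_compat; [left; apply exp_pos|apply Cmod_ge_0| |exact Bp].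
        apply exp_le; pose proof (pos_INR (S N)); nra.
      + rewrite Hp by exact Ht.
        rewrite (gamma_plus_0 k s F _ _ (- t) F_support ltac:(lra) : psi (- t)%R = RtoC 0).
        rewrite Cmult_0_r, Cmod_0, Rmult_0_r.
        repeat apply Rmult_le_pos; try lra; left; apply exp_pos. }
  (* By [u < exp u], the error [36 M b^(N+1)] is below [eps] once [36 M < eps (N+1) (- ln b)]. *)
  destruct (nfloor_ex (36 * M / (eps * - ln b))) as [N0 [_ HN0]].
  { apply Rmult_le_pos; [lra|left; apply Rinv_0_lt_compat, Rmult_lt_0_compat; lra]. }
  exists N0; intros N HN; eapply Rle_lt_trans; [apply B|].
  assert (HN1 : 36 * M / (eps * - ln b) < INR (S N)).
  { rewrite S_INR; apply le_INR in HN; lra. }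
  apply (Rmult_lt_compat_r (eps * - ln b)) in HN1; [|apply Rmult_lt_0_compat; lra].
  replace (36 * M / (eps * - ln b) * (eps * - ln b)) with (36 * M) in HN1
    by (field; split; lra).
  replace (INR (S N) * ln b) with (- (INR (S N) * - ln b)) by ring.
  rewrite exp_Ropp.
  pose proof (exp_ge_succ (INR (S N) * - ln b)) as He.
  pose proof (exp_pos (INR (S N) * - ln b)) as Hpos.
  apply Rmult_lt_reg_r with (exp (INR (S N) * - ln b)); [exact Hpos|].
  replace (4 * (/ exp (INR (S N) * - ln b) * (9 * M)) * exp (INR (S N) * - ln b))
    with (36 * M) by (field; lra).
  apply Rlt_le_trans with (INR (S N) * (eps * - ln b)); [exact HN1|].
  replace (INR (S N) * (eps * - ln b)) with (eps * (INR (S N) * - ln b)) by ring.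
  apply Rmult_le_compat_l; lra.
Qed.

End Moment.

(** * The polylogarithm *)

Definition polylog_term (s : C) (t : R) (n : nat) : C :=
  (Cpow (RtoC t) (S n) / Rcpow (INR (S n)) s)%C.

Definition polylog_sum (s : C) (t : R) (N : nat) : C :=
  sum_n (G := C_AbelianGroup) (polylog_term s t) N.

(** Half of the decay of [b^n] is spent on absorbing [n^(- Re s)], of either sign of exponent; the
    other half leaves the ratio [r = sqrt b], uniformly in [t <= b]. *)
Lemma polylog_term_bound (s : C) (b : R) : 0 < b < 1 -> exists K r, 0 <= K /\ 0 < r < 1 /\
  forall t n, 0 < t <= b -> Cmod (polylog_term s t n) <= K * r ^ n.
Proof.
  intros Hb.
  assert (Hlb : ln b < 0) by (rewrite <- ln_1; apply ln_increasing; lra).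
  destruct (power_le_exp (Rabs (Re s)) (- ln b / 2)) as (K & HK & H);
    [apply Rabs_pos|lra|].
  exists K, (exp (ln b / 2)); split; [exact HK|split].
  { split; [apply exp_pos|]; rewrite <- exp_0; apply exp_increasing; lra. }
  intros t n Ht.
  assert (Hn : 1 <= INR (S n)) by (rewrite S_INR; pose proof (pos_INR n); lra).
  unfold polylog_term; rewrite Cmod_div, Cmod_pow, Cmod_R, Cmod_Rcpow, Rabs_right
    by (apply Rcpow_neq_0 || lra).
  unfold Rdiv; rewrite <- exp_Ropp.
  assert (H1 : exp (- (Re s * ln (INR (S n)))) <= K * exp (- ln b / 2 * INR (S n))).
  { eapply Rle_trans; [|apply H; lra]; apply exp_le.
    assert (0 <= ln (INR (S n))) by (rewrite <- ln_1; apply ln_le; lra).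
    pose proof (Rle_abs (- Re s)); rewrite Rabs_Ropp in *; nra. }
  assert (H2 : t ^ S n <= exp (ln b * INR (S n))).
  { rewrite Rmult_comm, exp_INR_mult, exp_ln by lra; apply pow_incr; lra. }
  apply Rle_trans with (exp (ln b * INR (S n)) * (K * exp (- ln b / 2 * INR (S n)))).
  { apply Rmult_le_compat; trivial; [apply pow_le; lra|left; apply exp_pos]. }
  rewrite <- exp_INR_mult.
  replace (exp (ln b * INR (S n)) * (K * exp (- ln b / 2 * INR (S n)))) with
    (K * (exp (ln b * INR (S n)) * exp (- ln b / 2 * INR (S n)))) by ring.
  apply Rmult_le_compat_l; [exact HK|]; rewrite <- exp_plus; apply exp_le.
  rewrite S_INR; lra.
Qed.

(** The difference of powers on the right makes the induction on [j] close, and gives both the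
    Cauchy property and the tail estimate. *)
Lemma polylog_sum_increment (s : C) (t K r : R) : 0 < r < 1 ->
  (forall n, Cmod (polylog_term s t n) <= K * r ^ n) -> forall N j,
  Cmod (polylog_sum s t (j + N) - polylog_sum s t N)%C <= K / (1 - r) * (r ^ N - r ^ (j + N)).
Proof.
  intros Hr H N j; induction j as [|j IH].
  - simpl; replace (polylog_sum s t N - polylog_sum s t N)%C with (RtoC 0) by ring.
    rewrite Cmod_0; lra.
  - assert (HK : 0 <= K).
    { pose proof (H O) as B; pose proof (Cmod_ge_0 (polylog_term s t O)).
      simpl in B; lra. }
    assert (HrN : 0 <= r ^ (j + N)) by (apply pow_le; lra).
    change (S j + N)%nat with (S (j + N)); unfold polylog_sum at 1; rewrite sum_Sn.
    fold (polylog_sum s t (j + N)).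
    change (Cmod (polylog_sum s t (j + N) + polylog_term s t (S (j + N)) -
      polylog_sum s t N)%C <= K / (1 - r) * (r ^ N - r ^ S (j + N))).
    replace (polylog_sum s t (j + N) + polylog_term s t (S (j + N)) - polylog_sum s t N)%C
      with ((polylog_sum s t (j + N) - polylog_sum s t N) + polylog_term s t (S (j + N)))%C
      by ring.
    eapply Rle_trans; [apply Cmod_triangle|].
    eapply Rle_trans; [apply Rplus_le_compat; [exact IH|apply H]|].
    simpl.
    apply Rle_trans with (K / (1 - r) * (r ^ N - r ^ (j + N)) + K * r ^ (j + N)).
    + apply Rplus_le_compat_l, Rmult_le_compat_l; [exact HK|nra].
    + right; field; lra.
Qed.

Lemma pow_lt_eventually (r K eps : R) : 0 < r < 1 -> 0 < eps ->
  exists N, forall n, (N <= n)%nat -> K * r ^ n < eps.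
Proof.
  intros Hr Heps.
  destruct (pow_lt_1_zero r ltac:(rewrite Rabs_right; lra) (eps / (Rabs K + 1)))
    as [N HN].
  { pose proof (Rabs_pos K); apply Rdiv_lt_0_compat; lra. }
  exists N; intros n Hn; specialize (HN n Hn).
  assert (Hp : 0 <= r ^ n) by (apply pow_le; lra).
  rewrite Rabs_right in HN by lra.
  pose proof (Rabs_pos K); pose proof (Rle_abs K).
  apply (Rmult_lt_compat_r (Rabs K + 1)) in HN; [|lra].
  unfold Rdiv in HN; rewrite Rmult_assoc, Rinv_l in HN by lra; nra.
Qed.

Lemma polylog_converges (s : C) (t : R) : 0 < t < 1 -> exists l, is_polylog s (RtoC t) l.
Proof.
  intros Ht; destruct (polylog_term_bound s t Ht) as (K & r & HK & Hr & H).
  assert (Ht' : forall n, Cmod (polylog_term s t n) <= K * r ^ n) by (intros; apply H; lra).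
  apply (filterlim_locally_cauchy (U := C_R_CompleteNormedModule) (F := eventually)
    (polylog_sum s t)).
  intros [eps Heps].
  destruct (pow_lt_eventually r (K / (1 - r)) (eps / 2) Hr ltac:(lra)) as [N HN].
  exists (fun n => (N <= n)%nat); split; [now exists N|].
  assert (B : forall n, (N <= n)%nat -> Cmod (polylog_sum s t n - polylog_sum s t N)%C < eps / 2).
  { intros n Hn; replace n with ((n - N) + N)%nat by lia.
    eapply Rle_lt_trans; [apply (polylog_sum_increment s t K r Hr Ht')|].
    eapply Rle_lt_trans; [|apply (HN N); lia].
    apply Rmult_le_compat_l.
    - apply Rmult_le_pos; [exact HK|left; apply Rinv_0_lt_compat; lra].
    - assert (0 <= r ^ (n - N + N)) by (apply pow_le; lra); lra. }
  intros u v Hu Hv; apply (norm_compat1 (V := C_R_NormedModule)); rewrite norm_C.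
  change (Cmod (polylog_sum s t v - polylog_sum s t u)%C < eps).
  replace (polylog_sum s t v - polylog_sum s t u)%C with
    ((polylog_sum s t v - polylog_sum s t N) + - (polylog_sum s t u - polylog_sum s t N))%C
    by ring.
  eapply Rle_lt_trans; [apply Cmod_triangle|]; rewrite Cmod_opp.
  pose proof (B u Hu); pose proof (B v Hv); lra.
Qed.

Lemma polylog_tail (s : C) (t K r : R) (l : C) : 0 < r < 1 ->
  (forall n, Cmod (polylog_term s t n) <= K * r ^ n) -> is_polylog s (RtoC t) l ->
  forall N, Cmod (polylog_sum s t N - l)%C <= K / (1 - r) * r ^ N.
Proof.
  intros Hr H Hl N; apply Rnot_lt_le; intros Hlt.
  pose proof (proj1 (filterlim_Cmod eventually (polylog_sum s t) l) Hl
    (Cmod (polylog_sum s t N - l)%C - K / (1 - r) * r ^ N) ltac:(lra)) as [M HM].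
  specialize (HM (M + N)%nat ltac:(lia)).
  pose proof (polylog_sum_increment s t K r Hr H N M) as B.
  assert (HK : 0 <= K).
  { pose proof (H O) as B0; pose proof (Cmod_ge_0 (polylog_term s t O)).
    simpl in B0; lra. }
  assert (0 <= K / (1 - r) * r ^ (M + N)).
  { apply Rmult_le_pos; [|apply pow_le; lra].
    apply Rmult_le_pos; [exact HK|left; apply Rinv_0_lt_compat; lra]. }
  assert (T : Cmod (polylog_sum s t N - l)%C <=
    Cmod (polylog_sum s t (M + N) - polylog_sum s t N)%C +
    Cmod (polylog_sum s t (M + N) - l)%C).
  { replace (polylog_sum s t N - l)%C with
      (- (polylog_sum s t (M + N) - polylog_sum s t N) + (polylog_sum s t (M + N) - l))%C
      by ring.
    eapply Rle_trans; [apply Cmod_triangle|]; rewrite Cmod_opp; lra. }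
  lra.
Qed.

Lemma is_RInt_polylog_sum (s : C) (f : R -> C) (N : nat) : smooth f ->
  is_RInt (V := C_R_NormedModule) (fun t => polylog_sum s t N * f t)%C 0 1
    (sum_n (G := C_AbelianGroup) (moment_term f s) N).
Proof.
  intros Hf.
  assert (T : forall n, is_RInt (V := C_R_NormedModule)
    (fun t => polylog_term s t n * f t)%C 0 1 (moment_term f s n)).
  { intros n; unfold moment_term, Cdiv; rewrite Cmult_comm.
    assert (E : forall t, (/ Rcpow (INR (S n)) s * (RtoC (t ^ S n) * f t))%C =
      (polylog_term s t n * f t)%C).
    { intros t; unfold polylog_term, Cdiv; rewrite RtoC_pow; ring. }
    apply (is_RInt_ext (V := C_R_NormedModule) _ _ _ _ _ (fun t _ => E t)).
    apply is_RInt_Cscal.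
    apply (RInt_correct (V := C_R_CompleteNormedModule)), (moment_ex_RInt f Hf). }
  induction N as [|N IH].
  - rewrite sum_O.
    apply (is_RInt_ext (V := C_R_NormedModule) (fun t => polylog_term s t 0 * f t)%C).
    { intros t _; unfold polylog_sum; now rewrite sum_O. }
    apply T.
  - rewrite sum_Sn.
    apply (is_RInt_ext (V := C_R_NormedModule)
      (fun t => plus (polylog_sum s t N * f t)%C (polylog_term s t (S N) * f t)%C)).
    { intros t _; unfold polylog_sum; rewrite sum_Sn.
      symmetry; apply Cmult_plus_distr_r. }
    exact (is_RInt_plus (V := C_R_NormedModule) _ _ _ _ _ _ IH (T (S N))).
Qed.

(** Convergence is uniform on the support, which stays away from 1, so the limit passes under the
    integral; the limit of the integrated partial sums is already known from [moment_series]. *)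
Lemma polylog_pairing (s : C) (L : R -> C) (f : R -> C) :
  (forall t, 0 < t < 1 -> is_polylog s (RtoC t) (L t)) -> test_function 0 1 f ->
  is_RInt (V := C_R_NormedModule) (fun t => L t * f t)%C 0 1 (Li s f).
Proof.
  intros HL Htest; destruct (test_function_support f 1 Htest) as
    (a & b0 & Ha & Hb0 & HS0 & HT & _); change (b0 < 1) in Hb0.
  pose proof (proj1 Htest) as Hf.
  (* Enlarging the support makes [b] positive, so that [ln b] is a true logarithm, while keeping
     [b < 1]. *)
  set (b := Rmax (1 / 2) b0).
  assert (Hb : 1 / 2 <= b < 1).
  { split; [apply Rmax_l|apply Rmax_lub_lt; lra]. }
  assert (HS : supported_in a b f).
  { intros x Hx; apply HS0; intros Hx0; apply Hx.
    pose proof (Rmax_r (1 / 2) b0 : b0 <= b); lra. }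
  destruct (supported_bounded a b f) as [M HM]; [apply smooth_cont, Hf|exact HS|].
  assert (HM0 : 0 <= M) by (eapply Rle_trans; [apply Cmod_ge_0|apply (HM 0)]).
  destruct (polylog_term_bound s b) as (K & r & HK & Hr & HB); [lra|].
  destruct (filterlim_RInt (V := C_R_CompleteNormedModule)
    (fun N t => (polylog_sum s t N * f t)%C) 0 1 eventually _
    (fun t => L t * f t)%C
    (fun N => sum_n (G := C_AbelianGroup) (moment_term f s) N)) as (I & HI & HR).
  - intros N; now apply is_RInt_polylog_sum.
  (* Uniformity is needed over all real [t]: outside [[a, b]] the factor [f t] vanishes, inside the
     geometric tail bound applies. *)
  - apply filterlim_locally; intros [eps Heps].
    destruct (pow_lt_eventually r (K / (1 - r) * M) eps Hr Heps) as [N HN].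
    exists N; intros n Hn t; specialize (HN n Hn).
    apply (norm_compat1 (V := C_R_NormedModule)); rewrite norm_C; simpl.
    change (Cmod (polylog_sum s t n * f t - L t * f t)%C < eps).
    replace (polylog_sum s t n * f t - L t * f t)%C with
      ((polylog_sum s t n - L t) * f t)%C by ring.
    rewrite Cmod_mult.
    destruct (Rle_dec a t) as [H1|H1], (Rle_dec t b) as [H2|H2];
      try (rewrite (HS t), Cmod_0, Rmult_0_r by lra; exact Heps).
    eapply Rle_lt_trans; [|exact HN].
    replace (K / (1 - r) * M * r ^ n) with (K / (1 - r) * r ^ n * M) by ring.
    apply Rmult_le_compat; [apply Cmod_ge_0|apply Cmod_ge_0| |apply HM].
    apply (polylog_tail s t K r (L t) Hr); [intros m; apply HB; lra|apply HL; lra].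
  - replace (Li s f) with I; [exact HR|].
    apply (filterlim_locally_unique (K := R_AbsRing) (V := C_R_NormedModule)
      (F := eventually) (fun N => sum_n (G := C_AbelianGroup) (moment_term f s) N));
      [exact HI|].
    exact (moment_series f a b Ha Hb Hf HS s).
Qed.

Theorem corollary4 :
  exists Li : C -> (R -> C) -> C,
    (forall (s : C) (f : R -> C), test_function 0 p_infty f ->
       is_li s (fun x => RtoC (exp x) * f (exp x))%C (Li s f)) /\
    entire_distribution 0 p_infty Li /\
    (forall s : C, exists L : R -> C,
       (forall t : R, 0 < t < 1 -> is_polylog s (RtoC t) (L t)) /\
       (forall f : R -> C, test_function 0 1 f ->
          is_RInt (V := C_R_NormedModule)
            (fun t => L t * f t)%C 0 1 (Li s f))).
Proof.
  exists Li; split; [exact Li_is_li|split; [exact Li_entire_distribution|]].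
  intros s.
  (* Outside [(0,1)] the chosen value is arbitrary, but there every test function of [(0,1)]
     vanishes. *)
  exists (fun t => epsilon (inhabits (RtoC 0)) (is_polylog s (RtoC t))).
  assert (H : forall t, 0 < t < 1 ->
    is_polylog s (RtoC t) (epsilon (inhabits (RtoC 0)) (is_polylog s (RtoC t)))).
  { intros t Ht; now apply epsilon_spec, polylog_converges. }
  split; [exact H|]; intros f Hf; now apply polylog_pairing.
Qed.
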